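(* Let $G=\widetilde{SL}_2$ and let $\Omega\subset\mathbb{C}$ be a simply connected domain with coordinate $z=x+iy$. (1) Let $f:\Omega\to G$ be a conformally immersed surface with generating spinor $\psi=(\psi_1,\psi_2)^{\top}$, mean curvature $H$, metric $e^{2\alpha}dz\,d\bar z$ and Hopf differential $A\,dz^2$, and let $Z_3=\psi_1\bar\psi_2$. Then $\psi$ satisfies the Dirac equation $$\left[\begin{pmatrix}0&\partial\\-\bar\partial&0\end{pmatrix}+\begin{pmatrix}U&0\\0&V\end{pmatrix}\right]\psi=0, \qquad ( * )$$ $$U=\frac H2\left(|\psi_1|^2+|\psi_2|^2\right)+i\left(\frac12|\psi_1|^2-\frac34|\psi_2|^2\right),\quad V=\frac H2\left(|\psi_1|^2+|\psi_2|^2\right)+i\left(\frac34|\psi_1|^2-\frac12|\psi_2|^2\right).$$ (2) Conversely, every smooth nowhere vanishing function $\psi=(\psi_1,\psi_2)^{\top}:\Omega\to\mathbb{C}^2$ satisfying $( * )$ with some smooth real-valued function $H$ is the generating spinor of a surface $f:\Omega\to G$ with mean curvature $H$. (3) For a surface as in (1), the Weingarten equations consist of $( * )$ together with $$\partial\psi_1=\alpha_z\psi_1+Ae^{-\alpha}\psi_2+\frac{5i}4\psi_1^2\bar\psi_2,\qquad \bar\partial\psi_2=-\bar Ae^{-\alpha}\psi_1+\alpha_{\bar z}\psi_2+\frac{5i}4\bar\psi_1\psi_2^2 ;$$ the Hopf differential is given by $$A=(\bar\psi_2\,\partial\psi_1-\psi_1\,\partial\bar\psi_2)-\frac{5i}2\psi_1^2\bar\psi_2^2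 ;$$ and the Codazzi equations are $$\alpha_{z\bar z}-e^{-2\alpha}|A|^2+\frac14e^{2\alpha}H^2=e^{2\alpha}-5|Z_3|^2,$$ $$\bar\partial\left(A+\frac{5Z_3^2}{2(H-i)}\right)=\frac12H_ze^{2\alpha}+\bar\partial\left(\frac5{2(H-i)}\right)Z_3^2 .$$ That is, all these identities hold for every such surface.
   Context: $\widetilde{SL}_2$ is the universal covering group of $SL(2,\mathbb{R})$, whose Lie algebra is realized (as $\mathfrak{su}(1,1)$) with basis $f_1=\begin{pmatrix}0&1\\1&0\end{pmatrix}$, $f_2=\begin{pmatrix}0&i\\-i&0\end{pmatrix}$, $f_3=\begin{pmatrix}i/2&0\\0&-i/2\end{pmatrix}$. The left-invariant metric is the one with $\langle f_j,f_k\rangle=4\delta_{jk}$, so that $e_j=\frac12f_j$ is an orthonormal basis, taken positively oriented; it satisfies $[e_1,e_2]=-2e_3$, $[e_1,e_3]=-\frac12e_2$, $[e_2,e_3]=\frac12e_1$. $\nabla$ is the Levi-Civita connection, and $\langle\cdot,\cdot\rangle$ is extended complex-bilinearly. $\partial=\frac12(\partial_x-i\partial_y)$, $\bar\partial=\frac12(\partial_x+i\partial_y)$; subscripts $z,\bar z$ denote these derivatives. For a conformal immersion $f$ with induced metric $e^{2\alpha}dz\,d\bar z$, write $f^{-1}f_z=\sum_{k=1}^3Z_ke_k$ (left translation to the Lie algebra). Conformality gives $Z_1^2+Z_2^2+Z_3^2=0$, and the generating spinor $\psi$ (defined up to a common sign) is a smooth function with $$Z_1=\tfrac i2(\bar\psi_2^2+\psi_1^2),\quad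 Z_2=\tfrac12(\bar\psi_2^2-\psi_1^2),\quad Z_3=\psi_1\bar\psi_2.$$ Then $e^\alpha=|\psi_1|^2+|\psi_2|^2$. The unit normal $N$ is given by $$f^{-1}(N)=2ie^{-2\alpha}\left[(\bar Z_2Z_3-Z_2\bar Z_3)e_1+(\bar Z_3Z_1-Z_3\bar Z_1)e_2+(\bar Z_1Z_2-Z_1\bar Z_2)e_3\right],$$ the mean curvature $H$ by $\nabla_{f_{\bar z}}f_z=\frac12e^{2\alpha}HN$, and the Hopf differential is $A\,dz^2$ with $A=\langle\nabla_{f_z}f_z,N\rangle$. The Weingarten equations are the formulas for $\partial\psi$ and $\bar\partial\psi$, and the Codazzi equations are their compatibility conditions. *)

(* Defs.v *)
(* Analysis is over the concrete reals of the standard library, with Coquelicot's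
   complex numbers C (as a type, C = R * R), derivatives and topology. *)
From Stdlib Require Export Reals Lra Lia Psatz.
From Coquelicot Require Export Coquelicot.

Open Scope C_scope.

(** * Calculus on the plane *)

Definition partial_x (u : C -> R) (z : C) : R :=
  Derive (fun s : R => u (s, Im z)) (Re z).
Definition partial_y (u : C -> R) (z : C) : R :=
  Derive (fun s : R => u (Re z, s)) (Im z).

Definition d_x (F : C -> C) (z : C) : C :=
  (partial_x (fun w => Re (F w)) z, partial_x (fun w => Im (F w)) z).
Definition d_y (F : C -> C) (z : C) : C :=
  (partial_y (fun w => Re (F w)) z, partial_y (fun w => Im (F w)) z).

Definition d_z (F : C -> C) (z : C) : C := / 2 * (d_x F z - Ci * d_y F z).
Definition d_zbar (F : C -> C) (z : C) : C := / 2 * (d_x F z + Ci * d_y F z).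

(* Functions are total on C; only their values on the open set Omega matter. *)
Fixpoint class_Ck (k : nat) (Omega : C -> Prop) (u : C -> R) : Prop :=
  (forall z, Omega z -> continuous u z) /\
  match k with
  | O => True
  | S k' =>
      (forall z, Omega z ->
         ex_derive (fun s : R => u (s, Im z)) (Re z) /\
         ex_derive (fun s : R => u (Re z, s)) (Im z)) /\
      class_Ck k' Omega (partial_x u) /\ class_Ck k' Omega (partial_y u)
  end.

Definition smooth (Omega : C -> Prop) (u : C -> R) : Prop :=
  forall k, class_Ck k Omega u.
Definition smoothC (Omega : C -> Prop) (F : C -> C) : Prop :=
  smooth Omega (fun z => Re (F z)) /\ smooth Omega (fun z => Im (F z)).

Definition unit_interval (t : R) : Prop := (0 <= t <= 1)%R.
Definition unit_square (p : R * R) : Prop :=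
  unit_interval (fst p) /\ unit_interval (snd p).

Definition path_in (Omega : C -> Prop) (gamma : R -> C) : Prop :=
  continuous_on unit_interval gamma /\
  forall t, unit_interval t -> Omega (gamma t).

(* Homotopy of loops with fixed base point, the first argument of h being the
   homotopy parameter. *)
Definition null_homotopic (Omega : C -> Prop) (gamma : R -> C) : Prop :=
  exists h : R * R -> C,
    continuous_on unit_square h /\
    (forall p, unit_square p -> Omega (h p)) /\
    (forall t, unit_interval t -> h (0%R, t) = gamma t) /\
    (forall t, unit_interval t -> h (1%R, t) = gamma 0%R) /\
    (forall s, unit_interval s ->
       h (s, 0%R) = gamma 0%R /\ h (s, 1%R) = gamma 0%R).

Record simply_connected_domain (Omega : C -> Prop) : Prop := {
  scd_open : open Omega;
  scd_nonempty : exists z, Omega z;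
  scd_connected : forall p q, Omega p -> Omega q ->
    exists gamma, path_in Omega gamma /\ gamma 0%R = p /\ gamma 1%R = q;
  scd_loops : forall gamma, path_in Omega gamma ->
    gamma 0%R = gamma 1%R -> null_homotopic Omega gamma
}.

(** * The universal covering group of SL(2,R)

   SL(2,R) is conjugate in SL(2,C) to SU(1,1), the group of the matrices
   [[a, b], [conj b, conj a]] with |a|^2 - |b|^2 = 1.  As |a| = sqrt (1 + |b|^2) > 0,
   SU(1,1) is diffeomorphic to C x S^1 by b and the phase of a, and its universal
   cover is C x R: the point (b, t) lies over the matrix with
   a = sqrt (1 + |b|^2) e^{it}.  The group law is the lift of the matrix product
   for which (0, 0) is neutral; see cover_gmul, cover_surj and cover_fiber. *)

Definition SL2tilde : Type := (C * R)%type.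

Definition off (g : SL2tilde) : C := fst g.
Definition angle (g : SL2tilde) : R := snd g.
Definition cis (t : R) : C := (cos t, sin t).
Definition diag (g : SL2tilde) : C := RtoC (sqrt (1 + Cmod (off g) ^ 2)) * cis (angle g).

Definition entry (M : @matrix C 2 2) (i j : nat) : C := coeff_mat (RtoC 0) M i j.

Definition su11 (a b : C) : @matrix C 2 2 := [ [a, b], [Cconj b, Cconj a] ].

Definition cover (g : SL2tilde) : @matrix C 2 2 := su11 (diag g) (off g).

(* Principal argument on the half plane Re w > 0. *)
Definition arg_right (w : C) : R := atan (Im w / Re w).

(* The diagonal entry of the product of the two matrices is
   a a' (1 + b conj b' / (a a')), and |b conj b' / (a a')| < 1. *)
Definition gmul (g h : SL2tilde) : SL2tilde :=
  (diag g * off h + off g * Cconj (diag h),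
   (angle g + angle h
    + arg_right (1 + off g * Cconj (off h) / (diag g * diag h)))%R).
Definition gone : SL2tilde := (RtoC 0, 0%R).
Definition ginv (g : SL2tilde) : SL2tilde := (- off g, (- angle g)%R).

Lemma cisE (s t : R) : cis (s + t)%R = cis s * cis t.
Proof.
unfold cis; rewrite cos_plus, sin_plus; apply injective_projections; simpl; ring.
Qed.

Lemma Cmod_cis (t : R) : Cmod (cis t) = 1%R.
Proof.
unfold Cmod, cis; simpl; transitivity (sqrt 1); [f_equal | apply sqrt_1].
pose proof (sin2_cos2 t) as E; unfold Rsqr in E; lra.
Qed.

Lemma Cmod_real (r : R) : (0 <= r)%R -> Cmod (RtoC r) = r.
Proof. intros H; rewrite Cmod_R; apply Rabs_pos_eq, H. Qed.

Lemma cis_eq (s t : R) :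
  cis s = cis t <-> exists n : Z, s = (t + 2 * PI * IZR n)%R.
Proof.
split.
- intros E; injection E; intros Es Ec.
  assert (C : cos (s - t) = 1%R).
  { rewrite cos_minus, Es, Ec; pose proof (sin2_cos2 t) as Q; unfold Rsqr in Q; lra. }
  assert (S : sin ((s - t) / 2) = 0%R).
  { replace (s - t)%R with (2 * ((s - t) / 2))%R in C by field.
    rewrite cos_2a_sin in C; nra. }
  destruct (sin_eq_0_0 _ S) as [n En]; exists n; lra.
- intros [n ->]; unfold cis.
  assert (H : sin (2 * PI * IZR n) = 0%R /\ cos (2 * PI * IZR n) = 1%R).
  { replace (2 * PI * IZR n)%R with (2 * (IZR n * PI))%R by ring.
    assert (S : sin (IZR n * PI) = 0%R) by (apply sin_eq_0_1; exists n; reflexivity).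
    rewrite sin_2a, cos_2a_sin, S; split; ring. }
  destruct H as [Hs Hc]; rewrite cos_plus, sin_plus, Hs, Hc; f_equal; ring.
Qed.

Lemma arg_rightE (w : C) :
  (0 < Re w)%R -> w = RtoC (Cmod w) * cis (arg_right w).
Proof.
destruct w as [x y]; unfold arg_right, cis, Cmod, Re, Im; simpl; intros H.
rewrite cos_atan, sin_atan.
assert (E : sqrt (x * (x * 1) + y * (y * 1)) = (x * sqrt (1 + (y / x)²))%R).
{ rewrite <- (sqrt_Rsqr x) at 3 by lra.
  rewrite <- sqrt_mult by (try apply Rle_0_sqr; pose proof (Rle_0_sqr (y / x)); lra).
  f_equal; unfold Rsqr; field; lra. }
assert (P : (0 < sqrt (1 + (y / x)²))%R).
{ apply sqrt_lt_R0; pose proof (Rle_0_sqr (y / x)); lra. }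
rewrite E; apply injective_projections; simpl; field; lra.
Qed.

Lemma arg_right_bound (w : C) : (- PI / 2 < arg_right w < PI / 2)%R.
Proof. unfold arg_right; pose proof (atan_bound (Im w / Re w)); lra. Qed.

Lemma diag_mod (g : SL2tilde) : Cmod (diag g) = sqrt (1 + Cmod (off g) ^ 2).
Proof.
unfold diag; rewrite Cmod_mult, Cmod_cis, Cmod_real by apply sqrt_pos; ring.
Qed.

Lemma diag_mod2 (g : SL2tilde) :
  diag g * Cconj (diag g) = 1 + off g * Cconj (off g).
Proof.
rewrite <- !Cmod2_conj, diag_mod, pow2_sqrt, RtoC_plus; [reflexivity|].
pose proof (pow2_ge_0 (Cmod (off g))); lra.
Qed.

Lemma off_lt_diag (g : SL2tilde) : (Cmod (off g) < Cmod (diag g))%R.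
Proof.
rewrite diag_mod, <- (sqrt_pow2 (Cmod (off g))) at 1 by apply Cmod_ge_0.
apply sqrt_lt_1; pose proof (pow2_ge_0 (Cmod (off g))); lra.
Qed.

Lemma diag_neq0 (g : SL2tilde) : diag g <> 0.
Proof.
intros E; pose proof (off_lt_diag g) as H; rewrite E, Cmod_0 in H.
pose proof (Cmod_ge_0 (off g)); lra.
Qed.

Lemma ratio_right (g h : SL2tilde) :
  (0 < Re (1 + off g * Cconj (off h) / (diag g * diag h)))%R.
Proof.
set (w := off g * Cconj (off h) / (diag g * diag h)).
assert (Hw : (Cmod w < 1)%R).
{ unfold w; rewrite Cmod_div by (apply Cmult_neq_0; apply diag_neq0).
  rewrite !Cmod_mult, Cmod_conj.
  pose proof (off_lt_diag g); pose proof (off_lt_diag h).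
  pose proof (Cmod_ge_0 (off g)); pose proof (Cmod_ge_0 (off h)).
  apply Rlt_div_l; nra. }
pose proof (re_le_Cmod w) as Hr; change (Re (1 + w)) with (1 + Re w)%R.
apply Rabs_le_between in Hr; lra.
Qed.

Lemma diag_gmul (g h : SL2tilde) :
  diag (gmul g h) = diag g * diag h + off g * Cconj (off h).
Proof.
set (w := 1 + off g * Cconj (off h) / (diag g * diag h)).
assert (Ht : diag g * diag h + off g * Cconj (off h) = diag g * diag h * w).
{ unfold w; field; split; apply diag_neq0. }
assert (Hm : Cmod (diag g * diag h * w) = sqrt (1 + Cmod (off (gmul g h)) ^ 2)).
{ rewrite <- (sqrt_pow2 (Cmod (diag g * diag h * w))) by apply Cmod_ge_0.
  f_equal; apply RtoC_inj; rewrite RtoC_plus, !Cmod2_conj, <- Ht; simpl.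
  rewrite !Cplus_conj, !Cmult_conj, !Cconj_conj.
  pose proof (diag_mod2 g) as E1; pose proof (diag_mod2 h) as E2.
  transitivity ((diag g * Cconj (diag g)) * (diag h * Cconj (diag h))
     + (off g * Cconj (off g)) * (off h * Cconj (off h))
     + diag g * diag h * (Cconj (off g) * off h)
     + off g * Cconj (off h) * (Cconj (diag g) * Cconj (diag h))); [ring|].
  transitivity (1 + (diag g * Cconj (diag g)) * (off h * Cconj (off h))
     + (off g * Cconj (off g)) * (diag h * Cconj (diag h))
     + diag g * diag h * (Cconj (off g) * off h)
     + off g * Cconj (off h) * (Cconj (diag g) * Cconj (diag h))); [|ring].
  rewrite E1, E2; ring. }
rewrite Ht; unfold diag at 1; rewrite <- Hm; clear Ht Hm.
unfold gmul; simpl angle; fold w; rewrite !cisE, !Cmod_mult, !diag_mod.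
rewrite (arg_rightE w (ratio_right g h)) at 3.
unfold diag; rewrite !RtoC_mult; ring.
Qed.

Lemma off_gmul (g h : SL2tilde) :
  off (gmul g h) = diag g * off h + off g * Cconj (diag h).
Proof. reflexivity. Qed.

Lemma cover_gmul (g h : SL2tilde) :
  cover (gmul g h) = @Mmult C_Ring 2 2 2 (cover g) (cover h).
Proof.
unfold cover, su11; rewrite diag_gmul, off_gmul.
unfold Mmult, mk_matrix; simpl; unfold coeff_mat, sum_n, sum_n_m; simpl.
unfold Iter.iter_nat; simpl.
change (@plus _) with Cplus; change (@mult _) with Cmult; change (@zero _) with (RtoC 0).
rewrite !Cplus_conj, !Cmult_conj, !Cconj_conj.
assert (mat_eq : forall a b c d a' b' c' d' : C, a = a' -> b = b' -> c = c' -> d = d' ->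
  [[a, b], [c, d]] = [[a', b'], [c', d']]) by (intros; subst; reflexivity).
apply mat_eq; ring.
Qed.

Lemma diag_gone : diag gone = 1.
Proof.
unfold diag, gone, off, angle, cis; simpl; rewrite Cmod_0, cos_0, sin_0.
replace (1 + 0 * (0 * 1))%R with 1%R by ring; rewrite sqrt_1.
apply injective_projections; simpl; ring.
Qed.

Lemma diag_ginv (g : SL2tilde) : diag (ginv g) = Cconj (diag g).
Proof.
unfold diag; simpl; rewrite Cmod_opp; unfold cis; rewrite cos_neg, sin_neg.
apply injective_projections; simpl; ring.
Qed.

Lemma arg_right_real (r : R) : arg_right (RtoC r) = 0%R.
Proof.
unfold arg_right; simpl; replace (0 / r)%R with 0%R by (unfold Rdiv; ring).
apply atan_0.
Qed.

Lemma cis_angle_eq (g h : SL2tilde) :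
  diag g = diag h -> off g = off h -> cis (angle g) = cis (angle h).
Proof.
intros Hd Ho; unfold diag in Hd; rewrite Ho in Hd.
set (r := RtoC (sqrt (1 + Cmod (off h) ^ 2))) in *.
assert (N : r <> 0).
{ intros E; apply RtoC_inj in E; revert E; apply Rgt_not_eq, sqrt_lt_R0.
  pose proof (pow2_ge_0 (Cmod (off h))); lra. }
transitivity (/ r * (r * cis (angle g))); [field; exact N|].
rewrite Hd; field; exact N.
Qed.

Lemma cover_close (g h : SL2tilde) :
  diag g = diag h -> off g = off h ->
  (Rabs (angle g - angle h) < 2 * PI)%R -> g = h.
Proof.
intros Hd Ho Ha.
pose proof (cis_angle_eq g h Hd Ho) as E; apply cis_eq in E; destruct E as [n En].
assert (n = 0%Z).
{ rewrite En in Ha; replace (angle h + 2 * PI * IZR n - angle h)%R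
    with (2 * PI * IZR n)%R in Ha by ring.
  pose proof PI_RGT_0; apply Rabs_def2 in Ha.
  assert ((-1 < IZR n)%R /\ (IZR n < 1)%R) as [H1 H2] by (split; nra).
  apply lt_IZR in H1; apply lt_IZR in H2; lia. }
subst n; apply injective_projections; [exact Ho|]; unfold angle in En; lra.
Qed.

Lemma gmul_assoc (g h k : SL2tilde) : gmul g (gmul h k) = gmul (gmul g h) k.
Proof.
apply cover_close.
- rewrite !diag_gmul, !off_gmul, !Cplus_conj, !Cmult_conj, Cconj_conj; ring.
- rewrite !off_gmul, !diag_gmul, !Cplus_conj, !Cmult_conj, Cconj_conj; ring.
- assert (A : forall a b, exists e,
    (- PI / 2 < e < PI / 2)%R /\ angle (gmul a b) = (angle a + angle b + e)%R).
  { intros a b; eexists; split; [|reflexivity]; apply arg_right_bound. }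
  destruct (A g (gmul h k)) as (e1 & ? & ->), (A h k) as (e2 & ? & ->),
    (A (gmul g h) k) as (e3 & ? & ->), (A g h) as (e4 & ? & ->).
  apply Rabs_def1; lra.
Qed.

Lemma gmul_1_l (g : SL2tilde) : gmul gone g = g.
Proof.
apply injective_projections.
- change (fst (gmul gone g)) with (off (gmul gone g)).
  rewrite off_gmul, diag_gone; simpl; change (fst g) with (off g); ring.
- unfold gmul; simpl; replace (1 + 0 * _ / _) with (RtoC 1).
  + rewrite arg_right_real; change (snd g) with (angle g); ring.
  + field; split; apply diag_neq0.
Qed.

Lemma gmul_inv_l (g : SL2tilde) : gmul (ginv g) g = gone.
Proof.
apply injective_projections.
- change (fst (gmul (ginv g) g)) with (off (gmul (ginv g) g)).
  rewrite off_gmul, diag_ginv; simpl; ring.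
- unfold gmul; simpl.
  replace (1 + - off g * Cconj (off g) / (diag (ginv g) * diag g))
    with (RtoC (1 - Cmod (off g) ^ 2 / Cmod (diag g) ^ 2)).
  + rewrite arg_right_real; ring.
  + rewrite diag_ginv, RtoC_minus, RtoC_div, !Cmod2_conj.
    match goal with |- ?x = ?y => change (@eq C x y) end; field.
    split; [apply diag_neq0|]; intros E; apply (diag_neq0 g).
    rewrite <- (Cconj_conj (diag g)), E; apply injective_projections; simpl; ring.
    apply pow_nonzero; intros E; apply (diag_neq0 g), Cmod_eq_0, E.
Qed.

Lemma cover_fiber (g h : SL2tilde) :
  cover g = cover h <->
  off g = off h /\ exists n : Z, angle g = (angle h + 2 * PI * IZR n)%R.
Proof.
split.
- intros E; pose proof (f_equal (fun M => entry M 0 0) E) as Hd.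
  pose proof (f_equal (fun M => entry M 0 1) E) as Ho.
  split; [exact Ho|]; apply cis_eq; exact (cis_angle_eq g h Hd Ho).
- intros [Ho Ha]; apply cis_eq in Ha; unfold cover, diag; rewrite Ho, Ha; reflexivity.
Qed.

Lemma polar (w : C) : exists t, w = RtoC (Cmod w) * cis t.
Proof.
assert (Hpi : cis PI = - (1)).
{ unfold cis; rewrite cos_PI, sin_PI; apply injective_projections; simpl; ring. }
destruct (Rtotal_order 0 (Re w)) as [H | [H | H]].
- exists (arg_right w); apply arg_rightE, H.
- destruct w as [x y]; simpl in H; subst x; unfold Cmod; simpl.
  replace (0 * (0 * 1) + y * (y * 1))%R with (y²)%R by (unfold Rsqr; ring).
  rewrite sqrt_Rsqr_abs; destruct (Rle_dec 0 y).
  + exists (PI / 2)%R; unfold cis; rewrite cos_PI2, sin_PI2, Rabs_pos_eq by lra.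
    apply injective_projections; simpl; ring.
  + exists (- (PI / 2))%R; unfold cis; rewrite cos_neg, sin_neg, cos_PI2, sin_PI2.
    rewrite Rabs_left by lra; apply injective_projections; simpl; ring.
- exists (arg_right (- w) + PI)%R; rewrite cisE, Hpi.
  transitivity (- - w); [ring|]; rewrite (arg_rightE (- w)) at 1.
  + rewrite Cmod_opp; ring.
  + destruct w; simpl in *; lra.
Qed.

Lemma cover_surj (a b : C) :
  a * Cconj a - b * Cconj b = 1 -> exists g, cover g = su11 a b.
Proof.
intros H; destruct (polar a) as [t Ht]; exists (b, t).
assert (Hm : Cmod a = sqrt (1 + Cmod b ^ 2)).
{ rewrite <- (sqrt_pow2 (Cmod a)) by apply Cmod_ge_0; f_equal; apply RtoC_inj.
  rewrite RtoC_plus, !Cmod2_conj, <- H; ring. }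
assert (Hd : diag (b, t) = a).
{ unfold diag; simpl off; simpl angle; rewrite <- Hm, <- Ht; reflexivity. }
unfold cover; rewrite Hd; reflexivity.
Qed.

(* (b, t) is a global chart of the Lie group. *)
Definition smoothG (Omega : C -> Prop) (f : C -> SL2tilde) : Prop :=
  smoothC Omega (fun z => off (f z)) /\ smooth Omega (fun z => angle (f z)).

(** * The complexified Lie algebra, the metric and its connection *)

Inductive idx : Type := I1 | I2 | I3.

(* Coordinates with respect to the orthonormal basis e_1, e_2, e_3. *)
Definition vec : Type := idx -> C.

Definition sum3 (F : idx -> C) : C := F I1 + F I2 + F I3.

Definition f_basis (j : idx) : @matrix C 2 2 :=
  match j with
  | I1 => [ [RtoC 0, RtoC 1], [RtoC 1, RtoC 0] ]
  | I2 => [ [RtoC 0, Ci], [- Ci, RtoC 0] ]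
  | I3 => [ [Ci / 2, RtoC 0], [RtoC 0, - (Ci / 2)] ]
  end.

Definition of_vec (u : vec) : @matrix C 2 2 :=
  mk_matrix 2 2 (fun i j => sum3 (fun k => u k * (/ 2 * entry (f_basis k) i j))).

(* The inverse of of_vec on traceless matrices; see of_vec_to_vec. *)
Definition to_vec (M : @matrix C 2 2) : vec := fun k =>
  match k with
  | I1 => entry M 0 1 + entry M 1 0
  | I2 => - Ci * (entry M 0 1 - entry M 1 0)
  | I3 => - (4 * Ci) * entry M 0 0
  end.

Definition e_ (j : idx) : vec := fun k =>
  match j, k with
  | I1, I1 | I2, I2 | I3, I3 => RtoC 1
  | _, _ => RtoC 0
  end.

(* <f_j, f_k> = 4 delta_jk, extended complex-bilinearly. *)
Definition inner (u v : vec) : C := sum3 (fun k => u k * v k).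

Definition bracket (u v : vec) : vec :=
  to_vec (@Mplus C_Ring 2 2
            (@Mmult C_Ring 2 2 2 (of_vec u) (of_vec v))
            (@Mopp C_Ring 2 2 (@Mmult C_Ring 2 2 2 (of_vec v) (of_vec u)))).

(* Levi-Civita connection on left-invariant fields: Koszul's formula
   2 <nabla_u v, w> = <[u,v],w> - <[v,w],u> + <[w,u],v>. *)
Definition nabla_lie (u v : vec) : vec := fun k =>
  / 2 * (inner (bracket u v) (e_ k) - inner (bracket v (e_ k)) u
         + inner (bracket (e_ k) u) v).

Lemma to_vec_of_vec (u : vec) (k : idx) : to_vec (of_vec u) k = u k.
Proof.
assert (Hi : Ci * Ci = - (1)) by (unfold Ci; apply injective_projections; simpl; ring).
destruct k; unfold to_vec, of_vec, entry, coeff_mat, sum3; simpl; unfold coeff_mat; simpl.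
- field; intros E; injection E; lra.
- transitivity (- (Ci * Ci) * u I2);
    [field; intros E; injection E; lra | rewrite Hi; ring].
- transitivity (- (Ci * Ci) * u I3);
    [field; split; intros E; injection E; lra | rewrite Hi; ring].
Qed.

Lemma of_vec_to_vec (M : @matrix C 2 2) :
  entry M 0 0 + entry M 1 1 = 0 -> of_vec (to_vec M) = M.
Proof.
assert (Hi : Ci * Ci = - (1)) by (unfold Ci; apply injective_projections; simpl; ring).
destruct M as [[a [b []]] [[c [d []]] []]].
unfold to_vec, of_vec, entry, coeff_mat, sum3, mk_matrix; simpl; unfold coeff_mat; simpl.
intros H.
assert (Hd : d = - a) by (replace d with (a + d - a) by ring; rewrite H; ring).
rewrite Hd; repeat f_equal.
- transitivity (- (Ci * Ci) * a);
    [field; split; intros E; injection E; lra | rewrite Hi; ring].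
- transitivity (/ 2 * (b + c) - / 2 * (Ci * Ci) * (b - c));
    [field; intros E; injection E; lra | rewrite Hi; field; intros E; injection E; lra].
- transitivity (/ 2 * (b + c) + / 2 * (Ci * Ci) * (b - c));
    [field; intros E; injection E; lra | rewrite Hi; field; intros E; injection E; lra].
- transitivity (Ci * Ci * a);
    [field; split; intros E; injection E; lra | rewrite Hi; ring].
Qed.

(* The relations [e_1,e_2] = -2 e_3, [e_1,e_3] = -1/2 e_2, [e_2,e_3] = 1/2 e_1,
   extended bilinearly. *)
Lemma bracketE (u v : vec) (k : idx) :
  bracket u v k =
  match k with
  | I1 => / 2 * (u I2 * v I3 - u I3 * v I2)
  | I2 => - / 2 * (u I1 * v I3 - u I3 * v I1)
  | I3 => - (2) * (u I1 * v I2 - u I2 * v I1)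
  end.
Proof.
unfold bracket, to_vec, of_vec, entry, sum3, Mmult, Mplus, Mopp, coeff_mat, mk_matrix.
destruct k; simpl; unfold coeff_mat; simpl.
all: unfold sum_n, sum_n_m; simpl; unfold Iter.iter_nat; simpl.
all: change (@plus _) with Cplus; change (@mult _) with Cmult;
  change (@opp _) with Copp; change (@zero _) with (RtoC 0).
all: destruct (u I1), (u I2), (u I3), (v I1), (v I2), (v I3).
all: unfold Cdiv, Cinv, Ci; apply injective_projections; simpl; field.
Qed.

Lemma inner_e (u : vec) (k : idx) : inner u (e_ k) = u k.
Proof. destruct k; unfold inner, sum3, e_; ring. Qed.

Lemma nabla_lie_torsion_free (u v : vec) (k : idx) :
  nabla_lie u v k - nabla_lie v u k = bracket u v k.
Proof.
assert (H2 : RtoC 2 <> 0) by (intros E; injection E; lra).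
destruct k; unfold nabla_lie, inner, sum3; rewrite !bracketE; unfold e_; field; exact H2.
Qed.

Lemma nabla_lie_metric (u v w : vec) :
  inner (nabla_lie u v) w + inner v (nabla_lie u w) = 0.
Proof.
assert (H2 : RtoC 2 <> 0) by (intros E; injection E; lra).
unfold nabla_lie, inner, sum3; rewrite !bracketE; unfold e_; field; exact H2.
Qed.

Lemma nabla_lie_unique (n : vec -> vec -> vec) :
  (forall u v k, n u v k - n v u k = bracket u v k) ->
  (forall u v w, inner (n u v) w + inner v (n u w) = 0) ->
  forall u v k, n u v k = nabla_lie u v k.
Proof.
intros tf met u v k.
assert (H2 : RtoC 2 <> 0) by (intros E; injection E; lra).
assert (br : forall a b c, inner (bracket a b) c = inner (n a b) c - inner (n b a) c).
{ intros a b c; unfold inner, sum3; rewrite <- !tf; ring. }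
assert (sk : forall a b c, inner (n a c) b = - inner (n a b) c).
{ intros a b c; pose proof (met a b c) as E.
  replace (inner (n a c) b) with (inner b (n a c)) by (unfold inner, sum3; ring).
  replace (inner b (n a c)) with (inner (n a b) c + inner b (n a c) - inner (n a b) c)
    by ring; rewrite E; ring. }
unfold nabla_lie; rewrite !br.
rewrite (sk v (e_ k) u), (sk u (e_ k) v), (sk (e_ k) u v), <- (inner_e (n u v) k).
rewrite (sk u v (e_ k)).
field; exact H2.
Qed.

(** * Surfaces *)

(* For D = d_x, d_y, d_z or d_zbar: the vector f^{-1} f_D, that is, the image of
   D f under the differential of the left translation by f(z)^{-1}.  The
   differential of [cover] at the identity identifies the Lie algebra with su(1,1). *)
Definition left_deriv (D : (C -> C) -> C -> C) (f : C -> SL2tilde) (z : C) : vec :=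
  to_vec (mk_matrix 2 2 (fun i j =>
    D (fun w => entry (cover (gmul (ginv (f z)) (f w))) i j) z)).

(* nabla_{f_D} Y for a field Y along f, everything being left-translated. *)
Definition nabla_along (D : (C -> C) -> C -> C) (f : C -> SL2tilde)
    (Y : C -> vec) (z : C) : vec := fun k =>
  D (fun w => Y w k) z + nabla_lie (left_deriv D f z) (Y z) k.

(* The induced metric is e^{2 alpha} dz dzbar = e^{2 alpha} (dx^2 + dy^2). *)
Definition conformal_immersion (Omega : C -> Prop) (f : C -> SL2tilde)
    (alpha : C -> R) : Prop :=
  smoothG Omega f /\
  forall z, Omega z ->
    let X := left_deriv d_x f z in
    let Y := left_deriv d_y f z in
    inner X X = RtoC (exp (2 * alpha z)) /\
    inner Y Y = RtoC (exp (2 * alpha z)) /\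
    inner X Y = 0.

Definition unit_normal (f : C -> SL2tilde) (alpha : C -> R) (z : C) : vec :=
  let Z := left_deriv d_z f z in
  let cross j k := Cconj (Z j) * Z k - Z j * Cconj (Z k) in
  fun k => 2 * Ci * RtoC (exp (- 2 * alpha z)) *
    match k with
    | I1 => cross I2 I3
    | I2 => cross I3 I1
    | I3 => cross I1 I2
    end.

Definition is_mean_curvature (Omega : C -> Prop) (f : C -> SL2tilde)
    (alpha : C -> R) (H : C -> R) : Prop :=
  forall z, Omega z -> forall k,
    nabla_along d_zbar f (left_deriv d_z f) z k
    = / 2 * RtoC (exp (2 * alpha z)) * RtoC (H z) * unit_normal f alpha z k.

Definition hopf (f : C -> SL2tilde) (alpha : C -> R) (z : C) : C :=
  inner (nabla_along d_z f (left_deriv d_z f) z) (unit_normal f alpha z).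

Definition generating_spinor (Omega : C -> Prop) (f : C -> SL2tilde)
    (psi1 psi2 : C -> C) : Prop :=
  smoothC Omega psi1 /\ smoothC Omega psi2 /\
  forall z, Omega z ->
    let Z := left_deriv d_z f z in
    Z I1 = Ci / 2 * (Cconj (psi2 z) ^ 2 + psi1 z ^ 2) /\
    Z I2 = / 2 * (Cconj (psi2 z) ^ 2 - psi1 z ^ 2) /\
    Z I3 = psi1 z * Cconj (psi2 z).

Definition surface (Omega : C -> Prop) (f : C -> SL2tilde) (alpha : C -> R)
    (psi1 psi2 : C -> C) (H : C -> R) : Prop :=
  conformal_immersion Omega f alpha /\
  generating_spinor Omega f psi1 psi2 /\
  is_mean_curvature Omega f alpha H.

Definition potU (psi1 psi2 : C -> C) (H : C -> R) (z : C) : C :=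
  RtoC (H z) / 2 * RtoC (Cmod (psi1 z) ^ 2 + Cmod (psi2 z) ^ 2)
  + Ci * (/ 2 * RtoC (Cmod (psi1 z) ^ 2) - 3 / 4 * RtoC (Cmod (psi2 z) ^ 2)).
Definition potV (psi1 psi2 : C -> C) (H : C -> R) (z : C) : C :=
  RtoC (H z) / 2 * RtoC (Cmod (psi1 z) ^ 2 + Cmod (psi2 z) ^ 2)
  + Ci * (3 / 4 * RtoC (Cmod (psi1 z) ^ 2) - / 2 * RtoC (Cmod (psi2 z) ^ 2)).

Definition dirac (Omega : C -> Prop) (psi1 psi2 : C -> C) (H : C -> R) : Prop :=
  forall z, Omega z ->
    d_z psi2 z + potU psi1 psi2 H z * psi1 z = 0 /\
    - d_zbar psi1 z + potV psi1 psi2 H z * psi2 z = 0.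

(* Main.v *)
Require Import Defs.
From Stdlib Require Import ClassicalChoice.

(* Given [Z = f^{-1} f_z], the mean curvature equation is linear in the two derivatives
   [d_zbar psi_1] and [d_zbar (conj psi_2)] and determines them: it is the Dirac equation.
   The formulas for [A] and the Weingarten equations follow by expanding the connection and
   [alpha = ln (|psi_1|^2 + |psi_2|^2)]; the Codazzi equations compare [d_z d_zbar] with
   [d_zbar d_z] on the spinor.

   Conversely, the antisymmetric part of the mean curvature equation is the Maurer-Cartan equation of
   the su(1,1)-valued form defined by [Z].  On a small square it is integrated by solving a linear
   differential equation along a vertical and then along horizontal lines.  The local
   solutions [S_c] differ by constant left factors, so the quotients [S_c(u)^{-1} S_c(v)] are
   a locally defined cocycle [P u v]; lifting paths and homotopies along [P] shows that on
   a simply connected domain [P u v = f(u)^{-1} f(v)] for a global [f]. *)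

(** * Wirtinger calculus *)

(** Two obstacles shape the converse. Solving the differential equation line by line gives a matrix
    function that is differentiable in x but whose dependence on y is unknown. Flatness has to
    supply the vertical derivative, through a quantitative comparison of neighbouring heights;
    bounded partial derivatives then give continuity, and the equations themselves give all higher
    derivatives. Moreover, equality in SU(1,1) determines an element of the cover only up to a
    multiple of 2 pi in the angle. The squares are therefore shrunk until the diagonal entry of each
    local solution stays within angle pi / 4 of the positive axis; two candidates for the same
    quotient then differ in angle by less than 2 pi and coincide. In the direct part everything is a
    rational expression in psi_1, conj psi_2, their conjugates and derivatives, and H. Treating
    conjugates as independent variables leaves identities that [field] decides with the one relation
    i^2 = -1. *)

Lemma Ci2 : Ci * Ci = -1.
Proof. apply injective_projections; simpl; ring. Qed.

Ltac C_neq := repeat split; try assumption; try (let E := fresh in intros E; injection E; lra).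

(** In the product uniform structure a ball is an open square, so it contains the axis-parallel
    paths between suitable pairs of its points that later arguments follow. *)
Lemma ball_C (z w : C) (r : R) :
  ball z r w <-> (Rabs (Re w - Re z) < r)%R /\ (Rabs (Im w - Im z) < r)%R.
Proof. split; intros H; exact H. Qed.

Lemma locally_slice_x (P : C -> Prop) (z : C) :
  locally z P -> locally (Re z) (fun s => P (s, Im z)).
Proof.
intros [e He]; exists e; intros s Hs; apply He, ball_C; split; [exact Hs|].
simpl; rewrite Rminus_diag, Rabs_R0; apply cond_pos.
Qed.

Lemma locally_slice_y (P : C -> Prop) (z : C) :
  locally z P -> locally (Im z) (fun s => P (Re z, s)).
Proof.
intros [e He]; exists e; intros s Hs; apply He, ball_C; split; [|exact Hs].
simpl; rewrite Rminus_diag, Rabs_R0; apply cond_pos.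
Qed.

(** Lets [eapply] synthesize a derivative and leaves the comparison with the expected value to
    [ring] or [field]; the later lemmas ending in [_val] have the same purpose. *)
Lemma is_derive_val (f : R -> R) (t l l' : R) : is_derive f t l -> l = l' -> is_derive f t l'.
Proof. intros H <-; exact H. Qed.

Definition cderiv (u : R -> C) (t : R) (v : C) : Prop :=
  is_derive (fun s => Re (u s)) t (Re v) /\ is_derive (fun s => Im (u s)) t (Im v).

Lemma cderiv_val (u : R -> C) (t : R) (v w : C) : cderiv u t v -> v = w -> cderiv u t w.
Proof. intros H <-; exact H. Qed.

Lemma cderiv_ext_loc (u v : R -> C) (t : R) (l : C) :
  locally t (fun s => u s = v s) -> cderiv u t l -> cderiv v t l.
Proof.
intros E [H1 H2]; split;
  [apply (is_derive_ext_loc (fun s => Re (u s))) | apply (is_derive_ext_loc (fun s => Im (u s)))];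
  try assumption; revert E; apply filter_imp; intros s ->; reflexivity.
Qed.

Lemma cderiv_const (c : C) (t : R) : cderiv (fun _ => c) t 0.
Proof. split; apply (@is_derive_const R_AbsRing R_NormedModule). Qed.

Lemma cderiv_plus (u v : R -> C) (t : R) (du dv : C) :
  cderiv u t du -> cderiv v t dv -> cderiv (fun s => u s + v s) t (du + dv).
Proof. intros [H1 H2] [H3 H4]; split; apply (@is_derive_plus R_AbsRing R_NormedModule); assumption. Qed.

Lemma cderiv_opp (u : R -> C) (t : R) (du : C) :
  cderiv u t du -> cderiv (fun s => - u s) t (- du).
Proof. intros [H1 H2]; split; apply (@is_derive_opp R_AbsRing R_NormedModule); assumption. Qed.

Lemma cderiv_conj (u : R -> C) (t : R) (du : C) :
  cderiv u t du -> cderiv (fun s => Cconj (u s)) t (Cconj du).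
Proof. intros [H1 H2]; split; [exact H1|]; apply (@is_derive_opp R_AbsRing R_NormedModule); exact H2. Qed.

Lemma cderiv_mult (u v : R -> C) (t : R) (du dv : C) :
  cderiv u t du -> cderiv v t dv ->
  cderiv (fun s => u s * v s) t (du * v t + u t * dv).
Proof.
intros [H1 H2] [H3 H4]; split; simpl.
- eapply is_derive_val;
    [apply (@is_derive_minus R_AbsRing R_NormedModule); apply Derive.is_derive_mult; eassumption|].
  unfold minus, plus, opp, Re, Im; simpl; ring.
- eapply is_derive_val;
    [apply (@is_derive_plus R_AbsRing R_NormedModule); apply Derive.is_derive_mult; eassumption|].
  unfold plus, Re, Im; simpl; ring.
Qed.

Lemma cderiv_RtoC (u : R -> R) (t l : R) :
  is_derive u t l -> cderiv (fun s => RtoC (u s)) t (RtoC l).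
Proof. intros H; split; [exact H | exact (@is_derive_const R_AbsRing R_NormedModule 0%R t)]. Qed.

Lemma cderiv_unique (u : R -> C) (t : R) (v : C) :
  cderiv u t v -> (Derive (fun s => Re (u s)) t, Derive (fun s => Im (u s)) t) = v.
Proof.
intros [H1 H2]; apply injective_projections; apply is_derive_unique; assumption.
Qed.

Lemma Cnorm2_pos (c : C) : c <> 0 -> (0 < Re c * Re c + Im c * Im c)%R.
Proof.
intros H; destruct c as [x y]; simpl.
destruct (Req_dec x 0); [|nra]; destruct (Req_dec y 0); [|nra]; subst; now elim H.
Qed.

Lemma cderiv_inv (u : R -> C) (t : R) (du : C) :
  cderiv u t du -> u t <> 0 -> cderiv (fun s => / u s) t (- du / (u t * u t)).
Proof.
intros [H1 H2] N; pose proof (Cnorm2_pos _ N) as P.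
assert (Q : is_derive (fun s => Re (u s) ^ 2 + Im (u s) ^ 2)%R t
   ((Re du * Re (u t) + Re (u t) * Re du) + (Im du * Im (u t) + Im (u t) * Im du))%R).
{ apply (@is_derive_plus R_AbsRing R_NormedModule).
  - apply is_derive_ext with (fun s => Re (u s) * Re (u s))%R; [intros; simpl; ring|].
    apply Derive.is_derive_mult; assumption.
  - apply is_derive_ext with (fun s => Im (u s) * Im (u s))%R; [intros; simpl; ring|].
    apply Derive.is_derive_mult; assumption. }
assert (N2 : (Re (u t) ^ 2 + Im (u t) ^ 2 <> 0)%R) by (simpl; nra).
split; simpl.
- eapply eq_ind; [apply is_derive_div; [exact H1 | exact Q | exact N2] |].
  unfold Re, Im in *; simpl; field; simpl in *; nra.
- eapply eq_ind; [apply is_derive_div; [apply (@is_derive_opp R_AbsRing R_NormedModule); exact H2 | exact Q | exact N2] |].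
  unfold Re, Im in *; simpl; unfold opp; simpl; field; simpl in *; nra.
Qed.

Lemma partial_x_ext (Omega : C -> Prop) (u v : C -> R) (z : C) :
  open Omega -> (forall w, Omega w -> u w = v w) -> Omega z ->
  locally (Re z) (fun s => u (s, Im z) = v (s, Im z)).
Proof.
intros HO E Hz; apply (locally_slice_x (fun w => u w = v w)).
apply filter_imp with Omega; [exact E | exact (HO z Hz)].
Qed.

Lemma partial_y_ext (Omega : C -> Prop) (u v : C -> R) (z : C) :
  open Omega -> (forall w, Omega w -> u w = v w) -> Omega z ->
  locally (Im z) (fun s => u (Re z, s) = v (Re z, s)).
Proof.
intros HO E Hz; apply (locally_slice_y (fun w => u w = v w)).
apply filter_imp with Omega; [exact E | exact (HO z Hz)].
Qed.

(** * Closure properties of the smoothness classes *)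

Lemma Ck_ext (k : nat) (Omega : C -> Prop) (u v : C -> R) :
  open Omega -> (forall z, Omega z -> u z = v z) ->
  class_Ck k Omega u -> class_Ck k Omega v.
Proof.
intros HO; revert u v; induction k as [|k IH]; intros u v E [Hc H].
- split; [|exact I]; intros z Hz; apply continuous_ext_loc with u; [|now apply Hc].
  apply filter_imp with Omega; [exact E | exact (HO z Hz)].
- destruct H as (Hd & Hx & Hy); split; [|split; [|split]].
  + intros z Hz; apply continuous_ext_loc with u; [|now apply Hc].
    apply filter_imp with Omega; [exact E | exact (HO z Hz)].
  + intros z Hz; destruct (Hd z Hz) as [H1 H2]; split.
    * apply (ex_derive_ext_loc (fun s => u (s, Im z))); [|exact H1].
      now apply (partial_x_ext Omega).
    * apply (ex_derive_ext_loc (fun s => u (Re z, s))); [|exact H2].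
      now apply (partial_y_ext Omega).
  + apply (IH (partial_x u)); [|exact Hx]; intros z Hz; apply Derive_ext_loc.
    now apply (partial_x_ext Omega).
  + apply (IH (partial_y u)); [|exact Hy]; intros z Hz; apply Derive_ext_loc.
    now apply (partial_y_ext Omega).
Qed.

Lemma Ck_cont (k : nat) (Omega : C -> Prop) (u : C -> R) (z : C) :
  class_Ck k Omega u -> Omega z -> continuous u z.
Proof. destruct k; intros [H _]; apply H. Qed.

Lemma Ck_pred (k : nat) (Omega : C -> Prop) (u : C -> R) :
  class_Ck (S k) Omega u -> class_Ck k Omega u.
Proof.
revert u; induction k as [|k IH]; intros u [Hc (Hd & Hx & Hy)].
- split; [exact Hc | exact I].
- split; [exact Hc|]; split; [exact Hd|]; split; apply IH; assumption.
Qed.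

Lemma Ck_dx (k : nat) (Omega : C -> Prop) (u : C -> R) (z : C) :
  class_Ck (S k) Omega u -> Omega z ->
  is_derive (fun s => u (s, Im z)) (Re z) (partial_x u z).
Proof. intros [_ (H & _)] Hz; apply Derive_correct, H, Hz. Qed.

Lemma Ck_dy (k : nat) (Omega : C -> Prop) (u : C -> R) (z : C) :
  class_Ck (S k) Omega u -> Omega z ->
  is_derive (fun s => u (Re z, s)) (Im z) (partial_y u z).
Proof. intros [_ (H & _)] Hz; apply Derive_correct, H, Hz. Qed.

(** Lets an induction name the partial derivatives by formulas, which agree with the total functions
    [partial_x u] and [partial_y u] only on [Omega]. *)
Lemma Ck_succ (k : nat) (Omega : C -> Prop) (u v w : C -> R) :
  open Omega -> (forall z, Omega z -> continuous u z) ->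
  (forall z, Omega z -> is_derive (fun s => u (s, Im z)) (Re z) (v z)) ->
  (forall z, Omega z -> is_derive (fun s => u (Re z, s)) (Im z) (w z)) ->
  class_Ck k Omega v -> class_Ck k Omega w -> class_Ck (S k) Omega u.
Proof.
intros HO Hc H1 H2 Hv Hw; split; [exact Hc|]; split; [|split].
- intros z Hz; split; [exists (v z) | exists (w z)]; [now apply H1 | now apply H2].
- apply Ck_ext with v; [exact HO | | exact Hv].
  intros z Hz; symmetry; apply is_derive_unique, H1, Hz.
- apply Ck_ext with w; [exact HO | | exact Hw].
  intros z Hz; symmetry; apply is_derive_unique, H2, Hz.
Qed.

(** Every clause of [class_Ck] is a condition on the total function [u] at single points, so it can
    be checked point by point. *)
Lemma Ck_local (k : nat) (Omega : C -> Prop) (u : C -> R) :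
  (forall z, Omega z -> exists B : C -> Prop, B z /\ class_Ck k B u) -> class_Ck k Omega u.
Proof.
revert u; induction k as [|k IH]; intros u H.
- split; [|exact I]; intros z Hz; destruct (H z Hz) as (B & Bz & Hc & _); now apply Hc.
- split; [|split; [|split]].
  + intros z Hz; destruct (H z Hz) as (B & Bz & Hc & _); now apply Hc.
  + intros z Hz; destruct (H z Hz) as (B & Bz & _ & Hd & _); now apply Hd.
  + apply IH; intros z Hz; destruct (H z Hz) as (B & Bz & _ & _ & Hx & _); now exists B.
  + apply IH; intros z Hz; destruct (H z Hz) as (B & Bz & _ & _ & _ & Hy); now exists B.
Qed.

Lemma Ck_subset (k : nat) (Omega B : C -> Prop) (u : C -> R) :
  (forall z, B z -> Omega z) -> class_Ck k Omega u -> class_Ck k B u.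
Proof. intros H Hu; apply Ck_local; intros z Hz; exists Omega; split; [now apply H | exact Hu]. Qed.

Lemma Ck_const (k : nat) (Omega : C -> Prop) (c : R) :
  open Omega -> class_Ck k Omega (fun _ => c).
Proof.
intros HO; revert c; induction k as [|k IH]; intros c.
- split; [|exact I]; intros z _; apply continuous_const.
- apply Ck_succ with (fun _ => 0%R) (fun _ => 0%R); try assumption; try apply IH.
  + intros z _; apply continuous_const.
  + intros z _; apply (@is_derive_const R_AbsRing R_NormedModule).
  + intros z _; apply (@is_derive_const R_AbsRing R_NormedModule).
Qed.

Lemma Ck_plus (k : nat) (Omega : C -> Prop) (u v : C -> R) :
  open Omega -> class_Ck k Omega u -> class_Ck k Omega v ->
  class_Ck k Omega (fun z => u z + v z)%R.
Proof.
intros HO; revert u v; induction k as [|k IH]; intros u v Hu Hv;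
  assert (Hc : forall z, Omega z -> continuous (fun z => u z + v z)%R z)
    by (intros z Hz; apply (@continuous_plus _ _ R_NormedModule); eapply Ck_cont; eassumption).
- split; [exact Hc | exact I].
- apply Ck_succ with (fun z => partial_x u z + partial_x v z)%R
    (fun z => partial_y u z + partial_y v z)%R; try assumption.
  + intros z Hz; apply (@is_derive_plus R_AbsRing R_NormedModule);
      eapply Ck_dx; eassumption.
  + intros z Hz; apply (@is_derive_plus R_AbsRing R_NormedModule);
      eapply Ck_dy; eassumption.
  + apply IH; [apply Hu | apply Hv].
  + apply IH; [apply Hu | apply Hv].
Qed.

Lemma Ck_mult (k : nat) (Omega : C -> Prop) (u v : C -> R) :
  open Omega -> class_Ck k Omega u -> class_Ck k Omega v ->
  class_Ck k Omega (fun z => u z * v z)%R.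
Proof.
intros HO; revert u v; induction k as [|k IH]; intros u v Hu Hv;
  assert (Hc : forall z, Omega z -> continuous (fun z => u z * v z)%R z)
    by (intros z Hz; apply (@continuous_mult _ R_AbsRing); eapply Ck_cont; eassumption).
- split; [exact Hc | exact I].
- apply Ck_succ with (fun z => partial_x u z * v z + u z * partial_x v z)%R
    (fun z => partial_y u z * v z + u z * partial_y v z)%R; try assumption.
  + intros [x y] Hz; apply (Derive.is_derive_mult (fun s => u (s, y)) (fun s => v (s, y)));
      [exact (Ck_dx _ _ _ (x, y) Hu Hz) | exact (Ck_dx _ _ _ (x, y) Hv Hz)].
  + intros [x y] Hz; apply (Derive.is_derive_mult (fun s => u (x, s)) (fun s => v (x, s)));
      [exact (Ck_dy _ _ _ (x, y) Hu Hz) | exact (Ck_dy _ _ _ (x, y) Hv Hz)].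
  + apply Ck_plus; [exact HO | |]; apply IH; try apply Hu; try apply Hv;
      apply Ck_pred; assumption.
  + apply Ck_plus; [exact HO | |]; apply IH; try apply Hu; try apply Hv;
      apply Ck_pred; assumption.
Qed.

Lemma Ck_opp (k : nat) (Omega : C -> Prop) (u : C -> R) :
  open Omega -> class_Ck k Omega u -> class_Ck k Omega (fun z => - u z)%R.
Proof.
intros HO Hu; apply Ck_ext with (fun z => (-1) * u z)%R; [exact HO | intros; ring|].
apply Ck_mult; [exact HO | now apply Ck_const | exact Hu].
Qed.

(* The derivative of [u |-> phi o u], being [phi'(u) u'], is as smooth as [phi' o u] and [u']. *)
Lemma Ck_comp (k : nat) (Omega : C -> Prop) (phi dphi : R -> R) (u : C -> R) :
  open Omega -> (forall z, Omega z -> is_derive phi (u z) (dphi (u z))) ->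
  class_Ck (S k) Omega u -> class_Ck k Omega (fun z => dphi (u z)) ->
  class_Ck (S k) Omega (fun z => phi (u z)).
Proof.
intros HO Hphi Hu Hd.
apply Ck_succ with (fun z => partial_x u z * dphi (u z))%R
    (fun z => partial_y u z * dphi (u z))%R; try assumption.
- intros z Hz; apply continuous_comp; [eapply Ck_cont; eassumption|].
  apply (@ex_derive_continuous R_AbsRing R_NormedModule); exists (dphi (u z)); now apply Hphi.
- intros [x y] Hz; apply (@is_derive_comp R_AbsRing R_NormedModule phi (fun s => u (s, y)));
    [exact (Hphi (x, y) Hz) | exact (Ck_dx _ _ _ (x, y) Hu Hz)].
- intros [x y] Hz; apply (@is_derive_comp R_AbsRing R_NormedModule phi (fun s => u (x, s)));
    [exact (Hphi (x, y) Hz) | exact (Ck_dy _ _ _ (x, y) Hu Hz)].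
- apply Ck_mult; [exact HO | apply Hu | exact Hd].
- apply Ck_mult; [exact HO | apply Hu | exact Hd].
Qed.

(** The derivative of a reciprocal is again built from reciprocals, so the induction hypothesis
    provides the smoothness of [dphi o u] that [Ck_comp] asks for. *)
Lemma Ck_inv (k : nat) (Omega : C -> Prop) (u : C -> R) :
  open Omega -> (forall z, Omega z -> u z <> 0%R) ->
  class_Ck k Omega u -> class_Ck k Omega (fun z => / u z)%R.
Proof.
intros HO N; induction k as [|k IH]; intros Hu.
- split; [|exact I]; intros z Hz; apply continuous_comp; [eapply Ck_cont; eassumption|].
  apply continuous_Rinv; now apply N.
- apply (Ck_comp k Omega Rinv (fun t => (- 1) * (/ t * / t))%R); try assumption.
  + intros z Hz; eapply is_derive_val; [apply is_derive_inv; [apply is_derive_id | now apply N]|].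
    unfold one; simpl; field; now apply N.
  + apply Ck_mult; [exact HO | now apply Ck_const|].
    apply Ck_mult; try exact HO; apply IH; now apply Ck_pred.
Qed.

Lemma Ck_atan (k : nat) (Omega : C -> Prop) (u : C -> R) :
  open Omega -> class_Ck k Omega u -> class_Ck k Omega (fun z => atan (u z)).
Proof.
intros HO; destruct k as [|k]; intros Hu.
- split; [|exact I]; intros z Hz; apply continuous_comp; [eapply Ck_cont; eassumption|].
  apply continuity_pt_filterlim, derivable_continuous_pt, derivable_pt_atan.
- apply (Ck_comp k Omega atan (fun t => / (1 + t * t))%R); try assumption.
  + intros z Hz; apply is_derive_Reals.
    replace (u z * u z)%R with (u z ^ 2)%R by ring; apply derivable_pt_lim_atan.
  + apply Ck_inv; [exact HO | intros z _; nra|].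
    apply Ck_plus; [exact HO | now apply Ck_const|].
    apply Ck_mult; try exact HO; now apply Ck_pred.
Qed.

Lemma smoothC_ext (Omega : C -> Prop) (F G : C -> C) :
  open Omega -> (forall z, Omega z -> F z = G z) -> smoothC Omega F -> smoothC Omega G.
Proof.
intros HO E [H1 H2]; split; intros k.
- apply Ck_ext with (fun z => Re (F z)); [exact HO | intros z Hz; now rewrite E | apply H1].
- apply Ck_ext with (fun z => Im (F z)); [exact HO | intros z Hz; now rewrite E | apply H2].
Qed.

Lemma smoothC_const (Omega : C -> Prop) (c : C) : open Omega -> smoothC Omega (fun _ => c).
Proof. intros HO; split; intros k; now apply Ck_const. Qed.

Lemma smoothC_RtoC (Omega : C -> Prop) (u : C -> R) :
  open Omega -> smooth Omega u -> smoothC Omega (fun z => RtoC (u z)).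
Proof. intros HO Hu; split; [exact Hu | intros k; exact (Ck_const k Omega 0%R HO)]. Qed.

Lemma smoothC_plus (Omega : C -> Prop) (F G : C -> C) :
  open Omega -> smoothC Omega F -> smoothC Omega G -> smoothC Omega (fun z => F z + G z).
Proof.
intros HO [H1 H2] [H3 H4]; split; intros k.
- exact (Ck_plus k Omega _ _ HO (H1 k) (H3 k)).
- exact (Ck_plus k Omega _ _ HO (H2 k) (H4 k)).
Qed.

Lemma smoothC_opp (Omega : C -> Prop) (F : C -> C) :
  open Omega -> smoothC Omega F -> smoothC Omega (fun z => - F z).
Proof.
intros HO [H1 H2]; split; intros k.
- exact (Ck_opp k Omega _ HO (H1 k)).
- exact (Ck_opp k Omega _ HO (H2 k)).
Qed.

Lemma smoothC_minus (Omega : C -> Prop) (F G : C -> C) :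
  open Omega -> smoothC Omega F -> smoothC Omega G -> smoothC Omega (fun z => F z - G z).
Proof. intros HO HF HG; apply smoothC_plus, smoothC_opp; assumption. Qed.

Lemma smoothC_conj (Omega : C -> Prop) (F : C -> C) :
  open Omega -> smoothC Omega F -> smoothC Omega (fun z => Cconj (F z)).
Proof.
intros HO [H1 H2]; split; intros k; [exact (H1 k) | exact (Ck_opp k Omega _ HO (H2 k))].
Qed.

Lemma smoothC_mult (Omega : C -> Prop) (F G : C -> C) :
  open Omega -> smoothC Omega F -> smoothC Omega G -> smoothC Omega (fun z => F z * G z).
Proof.
intros HO [H1 H2] [H3 H4]; split; intros k.
- exact (Ck_plus k Omega _ _ HO (Ck_mult k Omega _ _ HO (H1 k) (H3 k))
    (Ck_opp k Omega _ HO (Ck_mult k Omega _ _ HO (H2 k) (H4 k)))).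
- exact (Ck_plus k Omega _ _ HO (Ck_mult k Omega _ _ HO (H1 k) (H4 k))
    (Ck_mult k Omega _ _ HO (H2 k) (H3 k))).
Qed.

Lemma smoothC_inv (Omega : C -> Prop) (F : C -> C) :
  open Omega -> (forall z, Omega z -> F z <> 0) ->
  smoothC Omega F -> smoothC Omega (fun z => / F z).
Proof.
intros HO N [H1 H2].
assert (Q : smooth Omega (fun z => / (Re (F z) * Re (F z) + Im (F z) * Im (F z)))%R).
{ intros k; apply Ck_inv; [exact HO | intros z Hz; pose proof (Cnorm2_pos _ (N z Hz)); lra|].
  apply Ck_plus; [exact HO | |]; now apply Ck_mult. }
assert (E : forall z, / F z = (Cconj (F z)) *
   RtoC (/ (Re (F z) * Re (F z) + Im (F z) * Im (F z)))%R).
{ intros z; apply injective_projections; simpl; unfold Rdiv, Re, Im; ring_simplify;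
    repeat f_equal; ring. }
apply smoothC_ext with (fun z => (Cconj (F z)) *
   RtoC (/ (Re (F z) * Re (F z) + Im (F z) * Im (F z)))%R);
  [exact HO | intros z _; now rewrite E|].
apply smoothC_mult; [exact HO | apply smoothC_conj; [exact HO | split; assumption]|].
now apply smoothC_RtoC.
Qed.

Lemma smooth_arg_right (Omega : C -> Prop) (F : C -> C) :
  open Omega -> (forall z, Omega z -> Re (F z) <> 0%R) ->
  smoothC Omega F -> smooth Omega (fun z => arg_right (F z)).
Proof.
intros HO N [H1 H2] k; apply Ck_atan; [exact HO|].
apply Ck_mult; [exact HO | apply H2 | now apply Ck_inv].
Qed.

Lemma smooth_partial_x (Omega : C -> Prop) (u : C -> R) :
  smooth Omega u -> smooth Omega (partial_x u).
Proof. intros H k; apply (H (S k)). Qed.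

Lemma smooth_partial_y (Omega : C -> Prop) (u : C -> R) :
  smooth Omega u -> smooth Omega (partial_y u).
Proof. intros H k; apply (H (S k)). Qed.

Lemma smoothC_d_x (Omega : C -> Prop) (F : C -> C) :
  smoothC Omega F -> smoothC Omega (d_x F).
Proof. intros [H1 H2]; split; [exact (smooth_partial_x _ _ H1) | exact (smooth_partial_x _ _ H2)]. Qed.

Lemma smoothC_d_y (Omega : C -> Prop) (F : C -> C) :
  smoothC Omega F -> smoothC Omega (d_y F).
Proof. intros [H1 H2]; split; [exact (smooth_partial_y _ _ H1) | exact (smooth_partial_y _ _ H2)]. Qed.

Lemma smoothC_d_z (Omega : C -> Prop) (F : C -> C) :
  open Omega -> smoothC Omega F -> smoothC Omega (d_z F).
Proof.
intros HO H; apply smoothC_mult; [exact HO | now apply smoothC_const|].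
apply smoothC_minus; [exact HO | now apply smoothC_d_x|].
apply smoothC_mult; [exact HO | now apply smoothC_const | now apply smoothC_d_y].
Qed.

Lemma smoothC_d_zbar (Omega : C -> Prop) (F : C -> C) :
  open Omega -> smoothC Omega F -> smoothC Omega (d_zbar F).
Proof.
intros HO H; apply smoothC_mult; [exact HO | now apply smoothC_const|].
apply smoothC_plus; [exact HO | now apply smoothC_d_x|].
apply smoothC_mult; [exact HO | now apply smoothC_const | now apply smoothC_d_y].
Qed.

(* [a] and [b] are the Wirtinger derivatives: [d_x = d_z + d_zbar], [d_y = i (d_z - d_zbar)]. *)
Definition has_d (F : C -> C) (z a b : C) : Prop :=
  cderiv (fun s => F (s, Im z)) (Re z) (a + b) /\
  cderiv (fun s => F (Re z, s)) (Im z) (Ci * (a - b)).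

Lemma has_d_d_x (F : C -> C) (z a b : C) : has_d F z a b -> d_x F z = a + b.
Proof. intros [H _]; exact (cderiv_unique _ _ _ H). Qed.

Lemma has_d_d_y (F : C -> C) (z a b : C) : has_d F z a b -> d_y F z = Ci * (a - b).
Proof. intros [_ H]; exact (cderiv_unique _ _ _ H). Qed.

Lemma has_d_d_z (F : C -> C) (z a b : C) : has_d F z a b -> d_z F z = a.
Proof.
intros H; unfold d_z; rewrite (has_d_d_x _ _ _ _ H), (has_d_d_y _ _ _ _ H).
field [Ci2]; C_neq.
Qed.

Lemma has_d_d_zbar (F : C -> C) (z a b : C) : has_d F z a b -> d_zbar F z = b.
Proof.
intros H; unfold d_zbar; rewrite (has_d_d_x _ _ _ _ H), (has_d_d_y _ _ _ _ H).
field [Ci2]; C_neq.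
Qed.

Lemma has_d_intro (F : C -> C) (z vx vy : C) :
  cderiv (fun s => F (s, Im z)) (Re z) vx -> cderiv (fun s => F (Re z, s)) (Im z) vy ->
  has_d F z (/ 2 * (vx - Ci * vy)) (/ 2 * (vx + Ci * vy)).
Proof.
intros H1 H2; split; eapply cderiv_val; try eassumption; field [Ci2]; C_neq.
Qed.

Lemma has_d_smooth (Omega : C -> Prop) (F : C -> C) (z : C) :
  smoothC Omega F -> Omega z -> has_d F z (d_z F z) (d_zbar F z).
Proof.
intros [H1 H2] Hz; apply has_d_intro; split.
- exact (Ck_dx 0 Omega _ z (H1 1%nat) Hz).
- exact (Ck_dx 0 Omega _ z (H2 1%nat) Hz).
- exact (Ck_dy 0 Omega _ z (H1 1%nat) Hz).
- exact (Ck_dy 0 Omega _ z (H2 1%nat) Hz).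
Qed.

Lemma has_d_val (F : C -> C) (z a b a' b' : C) :
  has_d F z a b -> a = a' -> b = b' -> has_d F z a' b'.
Proof. intros H <- <-; exact H. Qed.

Lemma has_d_ext (Omega : C -> Prop) (F G : C -> C) (z a b : C) :
  open Omega -> (forall w, Omega w -> F w = G w) -> Omega z ->
  has_d F z a b -> has_d G z a b.
Proof.
intros HO E Hz [H1 H2]; split.
- apply cderiv_ext_loc with (fun s => F (s, Im z)); [|exact H1].
  apply (locally_slice_x (fun w => F w = G w)).
  apply filter_imp with Omega; [exact E | exact (HO z Hz)].
- apply cderiv_ext_loc with (fun s => F (Re z, s)); [|exact H2].
  apply (locally_slice_y (fun w => F w = G w)).
  apply filter_imp with Omega; [exact E | exact (HO z Hz)].
Qed.

Lemma has_d_const (c z : C) : has_d (fun _ => c) z 0 0.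
Proof. split; (eapply cderiv_val; [apply cderiv_const | ring]). Qed.

Lemma has_d_plus (F G : C -> C) (z a b a' b' : C) :
  has_d F z a b -> has_d G z a' b' -> has_d (fun w => F w + G w) z (a + a') (b + b').
Proof.
intros [H1 H2] [H3 H4]; split;
  (eapply cderiv_val; [apply cderiv_plus; eassumption | ring]).
Qed.

Lemma has_d_opp (F : C -> C) (z a b : C) :
  has_d F z a b -> has_d (fun w => - F w) z (- a) (- b).
Proof.
intros [H1 H2]; split; (eapply cderiv_val; [apply cderiv_opp; eassumption | ring]).
Qed.

Lemma has_d_minus (F G : C -> C) (z a b a' b' : C) :
  has_d F z a b -> has_d G z a' b' -> has_d (fun w => F w - G w) z (a - a') (b - b').
Proof. intros H1 H2; apply has_d_plus, has_d_opp; assumption. Qed.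

Lemma has_d_mult (F G : C -> C) (z a b a' b' : C) :
  has_d F z a b -> has_d G z a' b' ->
  has_d (fun w => F w * G w) z (a * G z + F z * a') (b * G z + F z * b').
Proof.
destruct z as [x y]; intros [H1 H2] [H3 H4]; split;
  (eapply cderiv_val; [apply cderiv_mult; eassumption | simpl; ring]).
Qed.

Lemma has_d_sqr (F : C -> C) (z a b : C) :
  has_d F z a b -> has_d (fun w => F w ^ 2) z (2 * F z * a) (2 * F z * b).
Proof.
intros H; apply has_d_val with (a * (F z * 1) + F z * (a * 1 + F z * 0))
  (b * (F z * 1) + F z * (b * 1 + F z * 0)); try ring.
apply (has_d_mult F (fun w => F w * 1)); [exact H|].
apply (has_d_mult F (fun w => 1)); [exact H | apply has_d_const].
Qed.

Lemma has_d_inv (F : C -> C) (z a b : C) :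
  has_d F z a b -> F z <> 0 ->
  has_d (fun w => / F w) z (- a / (F z * F z)) (- b / (F z * F z)).
Proof.
destruct z as [x y]; intros [H1 H2] N; split;
  (eapply cderiv_val; [apply cderiv_inv; [eassumption | exact N] | simpl; field; exact N]).
Qed.

Lemma has_d_conj (F : C -> C) (z a b : C) :
  has_d F z a b -> has_d (fun w => Cconj (F w)) z (Cconj b) (Cconj a).
Proof.
intros [H1 H2]; split; (eapply cderiv_val; [apply cderiv_conj; eassumption|]);
  apply injective_projections; simpl; ring.
Qed.

Lemma d_conj (Omega : C -> Prop) (F : C -> C) (z : C) :
  smoothC Omega F -> Omega z ->
  has_d (fun w => Cconj (F w)) z (Cconj (d_zbar F z)) (Cconj (d_z F z)).
Proof. intros H Hz; apply has_d_conj, has_d_smooth with Omega; assumption. Qed.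

Lemma partial_comm (Omega : C -> Prop) (u : C -> R) (z : C) :
  open Omega -> smooth Omega u -> Omega z ->
  partial_x (partial_y u) z = partial_y (partial_x u) z.
Proof.
intros HO Hu Hz; destruct z as [x y].
assert (Hx := smooth_partial_x _ _ Hu); assert (Hy := smooth_partial_y _ _ Hu).
apply (Schwarz (fun s t => u (s, t)) x y).
- apply locally_2d_locally, filter_imp with Omega; [|exact (HO _ Hz)].
  intros [s t] Hst; simpl; repeat split.
  + exists (partial_x u (s, t)); exact (Ck_dx 0 Omega u (s, t) (Hu 1%nat) Hst).
  + exists (partial_y u (s, t)); exact (Ck_dy 0 Omega u (s, t) (Hu 1%nat) Hst).
  + eexists; exact (Ck_dx 0 Omega _ (s, t) (Hy 1%nat) Hst).
  + eexists; exact (Ck_dy 0 Omega _ (s, t) (Hx 1%nat) Hst).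
- apply continuity_2d_pt_filterlim.
  apply filterlim_ext with (partial_x (partial_y u)); [intros [s t]; reflexivity|].
  exact (Ck_cont 0 Omega _ (x, y) (smooth_partial_x _ _ Hy 0%nat) Hz).
- apply continuity_2d_pt_filterlim.
  apply filterlim_ext with (partial_y (partial_x u)); [intros [s t]; reflexivity|].
  exact (Ck_cont 0 Omega _ (x, y) (smooth_partial_y _ _ Hx 0%nat) Hz).
Qed.

Lemma d_xy_comm (Omega : C -> Prop) (F : C -> C) (z : C) :
  open Omega -> smoothC Omega F -> Omega z -> d_x (d_y F) z = d_y (d_x F) z.
Proof.
intros HO [H1 H2] Hz; apply injective_projections; simpl.
- exact (partial_comm Omega _ z HO H1 Hz).
- exact (partial_comm Omega _ z HO H2 Hz).
Qed.

Lemma d_z_zbar_comm (Omega : C -> Prop) (F : C -> C) (z : C) :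
  open Omega -> smoothC Omega F -> Omega z -> d_z (d_zbar F) z = d_zbar (d_z F) z.
Proof.
intros HO HF Hz.
assert (Hx := has_d_smooth Omega _ z (smoothC_d_x _ _ HF) Hz).
assert (Hy := has_d_smooth Omega _ z (smoothC_d_y _ _ HF) Hz).
assert (E : d_x (d_y F) z = d_y (d_x F) z) by now apply (d_xy_comm Omega).
rewrite (has_d_d_x _ _ _ _ Hy), (has_d_d_y _ _ _ _ Hx) in E.
assert (A : d_z (d_zbar F) z = / 2 * (d_z (d_x F) z + Ci * d_z (d_y F) z)).
{ eapply has_d_d_z; eapply has_d_val.
  - apply (has_d_mult (fun _ => / 2)); [apply has_d_const|].
    apply (has_d_plus (d_x F)); [exact Hx|].
    apply (has_d_mult (fun _ => Ci)); [apply has_d_const | exact Hy].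
  - ring.
  - reflexivity. }
assert (B : d_zbar (d_z F) z = / 2 * (d_zbar (d_x F) z - Ci * d_zbar (d_y F) z)).
{ eapply has_d_d_zbar; eapply has_d_val.
  - apply (has_d_mult (fun _ => / 2)); [apply has_d_const|].
    apply (has_d_minus (d_x F)); [exact Hx|].
    apply (has_d_mult (fun _ => Ci)); [apply has_d_const | exact Hy].
  - reflexivity.
  - ring. }
rewrite A, B; f_equal.
transitivity (d_z (d_x F) z + Ci * (d_z (d_y F) z + d_zbar (d_y F) z) - Ci * d_zbar (d_y F) z);
  [ring|].
rewrite E; ring [Ci2].
Qed.

(** * Algebra of the generating spinor *)

Lemma nabla_lieE (u v : vec) (k : idx) :
  nabla_lie u v k =
  match k with
  | I1 => - u I2 * v I3 - 3 / 2 * u I3 * v I2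
  | I2 => u I1 * v I3 + 3 / 2 * u I3 * v I1
  | I3 => u I2 * v I1 - u I1 * v I2
  end.
Proof.
destruct k; unfold nabla_lie, inner, sum3; rewrite !bracketE; unfold e_; field; C_neq.
Qed.

(* [Z_k] in terms of [p = psi_1] and [s = conj psi_2]. *)
Definition spin_Z (p s : C) : vec := fun k =>
  match k with
  | I1 => Ci / 2 * (s ^ 2 + p ^ 2)
  | I2 => / 2 * (s ^ 2 - p ^ 2)
  | I3 => p * s
  end.

Definition spin_dZ (p s dp ds : C) : vec := fun k =>
  match k with
  | I1 => Ci * (s * ds + p * dp)
  | I2 => s * ds - p * dp
  | I3 => dp * s + p * ds
  end.

(** The conformal factor e^alpha, written with conjugates instead of moduli so that [field] sees a
    polynomial. *)
Definition spin_E (p s : C) : C := p * Cconj p + s * Cconj s.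

Definition spin_N (p s : C) : vec := fun k =>
  let Z := spin_Z p s in
  let cross j k := Cconj (Z j) * Z k - Z j * Cconj (Z k) in
  2 * Ci / spin_E p s ^ 2 *
  match k with
  | I1 => cross I2 I3
  | I2 => cross I3 I1
  | I3 => cross I1 I2
  end.

Definition spin_V (p s h : C) : C :=
  h / 2 * spin_E p s + Ci * (3 / 4 * (p * Cconj p) - / 2 * (s * Cconj s)).

Lemma Ci_conj : Cconj Ci = - Ci.
Proof. apply injective_projections; simpl; ring. Qed.

Lemma RtoC_conj (r : R) : Cconj (RtoC r) = RtoC r.
Proof. apply injective_projections; simpl; ring. Qed.

Lemma Cconj_inv (c : C) : c <> 0 -> Cconj (/ c) = / Cconj c.
Proof.
intros H; pose proof (Cnorm2_pos c H) as P; unfold Cinv, Cconj, Re, Im in *; simpl.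
apply injective_projections; simpl; field; simpl in *; nra.
Qed.

Lemma Cconj_half : Cconj (/ 2) = / 2.
Proof. rewrite Cconj_inv, RtoC_conj by C_neq; reflexivity. Qed.

Lemma spin_Z_conj (p s : C) (k : idx) :
  Cconj (spin_Z p s k) =
  match k with
  | I1 => - (Ci / 2) * (Cconj s ^ 2 + Cconj p ^ 2)
  | I2 => / 2 * (Cconj s ^ 2 - Cconj p ^ 2)
  | I3 => Cconj p * Cconj s
  end.
Proof.
destruct k; unfold spin_Z, Cdiv; rewrite ?Cmult_conj, ?Cplus_conj, ?Cminus_conj, ?Cpow_conj,
  ?Cconj_half, ?Ci_conj; try reflexivity; ring.
Qed.

Lemma spin_E_conj (p s : C) : Cconj (spin_E p s) = spin_E p s.
Proof. unfold spin_E; rewrite Cplus_conj, !Cmult_conj, !Cconj_conj; ring. Qed.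

Lemma spin_E_neq0 (p s : C) : p <> 0 \/ s <> 0 -> spin_E p s <> 0.
Proof.
intros H E; unfold spin_E in E; apply (f_equal fst) in E; revert E; simpl.
destruct p as [a b], s as [c d]; simpl; intros E.
assert (a * a + b * b + c * c + d * d = 0)%R by lra.
assert (a = 0 /\ b = 0 /\ c = 0 /\ d = 0)%R as (-> & -> & -> & ->) by (repeat split; nra).
destruct H as [H | H]; now apply H.
Qed.

Lemma has_d_spin_Z (p s : C -> C) (z a b a' b' : C) (k : idx) :
  has_d p z a b -> has_d s z a' b' ->
  has_d (fun w => spin_Z (p w) (s w) k) z
    (spin_dZ (p z) (s z) a a' k) (spin_dZ (p z) (s z) b b' k).
Proof.
intros Hp Hs; destruct k.
- eapply has_d_val;
    [apply (has_d_mult (fun _ => Ci / 2)); [apply has_d_const|];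
     apply has_d_plus; apply has_d_sqr; eassumption | |]; unfold spin_dZ; field; C_neq.
- eapply has_d_val;
    [apply (has_d_mult (fun _ => / 2)); [apply has_d_const|];
     apply has_d_minus; apply has_d_sqr; eassumption | |]; unfold spin_dZ; field; C_neq.
- now apply has_d_mult.
Qed.

(** The Dirac values solve the linear mean curvature equation for [dp] and [ds]; by [spin_dZ_inj]
    they are its only solution. *)
Lemma spin_mean (p s h dp ds : C) :
  p <> 0 \/ s <> 0 ->
  dp = spin_V p s h * Cconj s ->
  ds = - (h / 2 * spin_E p s - Ci * (/ 2 * (p * Cconj p) - 3 / 4 * (s * Cconj s))) * Cconj p ->
  forall k, spin_dZ p s dp ds k
      + nabla_lie (fun j => Cconj (spin_Z p s j)) (spin_Z p s) k
    = / 2 * spin_E p s ^ 2 * h * spin_N p s k.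
Proof.
intros N -> -> k; apply spin_E_neq0 in N; rewrite nabla_lieE; unfold spin_N; rewrite !spin_Z_conj.
destruct k; unfold spin_dZ, spin_Z, spin_V, spin_E in *; field [Ci2]; C_neq.
Qed.

(** The first two components determine [p * dp] and [s * ds]. Where [p] or [s] vanishes, one of the
    derivatives is lost in this way, and the third component recovers it. *)
Lemma spin_dZ_inj (p s dp ds dp' ds' : C) :
  p <> 0 \/ s <> 0 -> (forall k, spin_dZ p s dp ds k = spin_dZ p s dp' ds' k) ->
  dp = dp' /\ ds = ds'.
Proof.
intros N H.
assert (H1 := H I1); assert (H2 := H I2); assert (H3 := H I3); simpl in H1, H2, H3.
assert (Hs : s * (ds - ds') = 0).
{ transitivity (/ 2 * (- Ci * (Ci * (s * ds + p * dp)) + (s * ds - p * dp)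
     - (- Ci * (Ci * (s * ds' + p * dp')) + (s * ds' - p * dp')))).
  - field [Ci2]; C_neq.
  - rewrite H1, H2; ring. }
assert (Hp : p * (dp - dp') = 0).
{ transitivity (/ 2 * (- Ci * (Ci * (s * ds + p * dp)) - (s * ds - p * dp)
     - (- Ci * (Ci * (s * ds' + p * dp')) - (s * ds' - p * dp')))).
  - field [Ci2]; C_neq.
  - rewrite H1, H2; ring. }
assert (Hm : (dp - dp') * s + p * (ds - ds') = 0).
{ transitivity (dp * s + p * ds - (dp' * s + p * ds')); [ring | rewrite H3; ring]. }
assert (cancel : forall c d e : C, c <> 0 -> c * (d - e) = 0 -> d = e).
{ intros c d e Nc E; transitivity (e + c * (d - e) / c); [field; exact Nc|].
  rewrite E; field; exact Nc. }
destruct N as [N | N].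
- assert (E := cancel p dp dp' N Hp); split; [exact E|].
  apply (cancel p); [exact N|]; rewrite <- Hm, E; ring.
- assert (E := cancel s ds ds' N Hs); split; [|exact E].
  apply (cancel s); [exact N|]; rewrite <- Hm, E; ring.
Qed.

(** By [nabla_lieE] the vector nabla_Z Z is 5/2 Z_3 (- Z_2, Z_1, 0), where 5/2 = 1 + 3/2; its
    pairing with the normal is the term in Z_3^2. *)
Lemma spin_hopf (p s a a' : C) :
  p <> 0 \/ s <> 0 ->
  inner (fun k => spin_dZ p s a a' k + nabla_lie (spin_Z p s) (spin_Z p s) k) (spin_N p s)
  = s * a - p * a' - 5 * Ci / 2 * p ^ 2 * s ^ 2.
Proof.
intros N; apply spin_E_neq0 in N; unfold inner, sum3; rewrite !nabla_lieE; unfold spin_N.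
rewrite !spin_Z_conj; unfold spin_dZ, spin_Z, spin_E in *; field [Ci2]; C_neq.
Qed.

(** * Left-translated derivatives of maps into the group *)

(** Existence is enough: [left_deriv_real] holds whatever the Wirtinger derivatives of the diagonal
    entry are. *)
Lemma cderiv_diag (g : R -> SL2tilde) (t : R) (db : C) (dt : R) :
  cderiv (fun s => off (g s)) t db -> is_derive (fun s => angle (g s)) t dt ->
  exists v, cderiv (fun s => diag (g s)) t v.
Proof.
intros [H1 H2] H3.
set (m := fun s => (1 + (Re (off (g s)) * Re (off (g s)) + Im (off (g s)) * Im (off (g s))))%R).
assert (Hm : forall s, (0 < m s)%R) by (intros s; unfold m; nra).
assert (Q : exists l, is_derive (fun s => sqrt (m s)) t l).
{ eexists; apply is_derive_sqrt; [|apply Hm]; unfold m.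
  apply (@is_derive_plus R_AbsRing R_NormedModule);
    [apply (@is_derive_const R_AbsRing R_NormedModule)|].
  apply (@is_derive_plus R_AbsRing R_NormedModule); apply Derive.is_derive_mult; eassumption. }
destruct Q as [l Hl].
assert (Hc : cderiv (fun s => cis (angle (g s))) t
   (dt * - sin (angle (g t)), dt * cos (angle (g t)))%R).
{ split.
  - apply (@is_derive_comp R_AbsRing R_NormedModule cos); [apply is_derive_cos | exact H3].
  - apply (@is_derive_comp R_AbsRing R_NormedModule sin); [apply is_derive_sin | exact H3]. }
eexists; eapply cderiv_ext_loc; [|apply cderiv_mult; [apply cderiv_RtoC, Hl | exact Hc]].
exists (mkposreal 1 Rlt_0_1); intros s _; simpl; unfold diag, m; do 3 f_equal.
unfold Cmod; rewrite pow2_sqrt; unfold Re, Im; simpl; [|nra].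
now rewrite !Rmult_1_r.
Qed.

(* The first row of the matrix [cover g^{-1} cover h]. *)
Definition rel_diag (g h : SL2tilde) : C := Cconj (diag g) * diag h - off g * Cconj (off h).
Definition rel_off (g h : SL2tilde) : C := Cconj (diag g) * off h - off g * Cconj (diag h).

Lemma rel_diagE (g h : SL2tilde) : diag (gmul (ginv g) h) = rel_diag g h.
Proof. rewrite diag_gmul, diag_ginv; unfold rel_diag; simpl; ring. Qed.

Lemma rel_offE (g h : SL2tilde) : off (gmul (ginv g) h) = rel_off g h.
Proof. rewrite off_gmul, diag_ginv; unfold rel_off; simpl; ring. Qed.

Lemma rel_diag_refl (g : SL2tilde) : rel_diag g g = 1.
Proof. unfold rel_diag; rewrite Cmult_comm, diag_mod2; ring. Qed.

Lemma rel_off_refl (g : SL2tilde) : rel_off g g = 0.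
Proof. unfold rel_off; ring. Qed.

(** The congruence hypothesis on [D] takes the place of functional extensionality; [d_x], [d_y],
    [d_z] and [d_zbar] all satisfy it. *)
Lemma left_derivE (D : (C -> C) -> C -> C) (f : C -> SL2tilde) (z : C) (k : idx) :
  (forall F G, (forall w, F w = G w) -> D F z = D G z) ->
  left_deriv D f z k =
  match k with
  | I1 => D (fun w => rel_off (f z) (f w)) z + D (fun w => Cconj (rel_off (f z) (f w))) z
  | I2 => - Ci * (D (fun w => rel_off (f z) (f w)) z - D (fun w => Cconj (rel_off (f z) (f w))) z)
  | I3 => - (4 * Ci) * D (fun w => rel_diag (f z) (f w)) z
  end.
Proof.
intros HD.
rewrite <- (HD _ _ (fun w => rel_offE (f z) (f w))), <- (HD _ _ (fun w => rel_diagE (f z) (f w))).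
rewrite <- (HD _ _ (fun w => f_equal Cconj (rel_offE (f z) (f w)))).
destruct k; reflexivity.
Qed.

Lemma d_x_ext (z : C) (F G : C -> C) : (forall w, F w = G w) -> d_x F z = d_x G z.
Proof. intros E; unfold d_x, partial_x; f_equal; apply Derive_ext; intros; now rewrite E. Qed.

Lemma d_y_ext (z : C) (F G : C -> C) : (forall w, F w = G w) -> d_y F z = d_y G z.
Proof. intros E; unfold d_y, partial_y; f_equal; apply Derive_ext; intros; now rewrite E. Qed.

Lemma d_z_ext (z : C) (F G : C -> C) : (forall w, F w = G w) -> d_z F z = d_z G z.
Proof. intros E; unfold d_z; now rewrite (d_x_ext z F G E), (d_y_ext z F G E). Qed.

Lemma d_zbar_ext (z : C) (F G : C -> C) : (forall w, F w = G w) -> d_zbar F z = d_zbar G z.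
Proof. intros E; unfold d_zbar; now rewrite (d_x_ext z F G E), (d_y_ext z F G E). Qed.

(* Reality of the third component: [|rel_diag|^2 - |rel_off|^2 = 1] forces the derivative of [rel_diag]
   at [w = z], where [rel_diag = 1] and [rel_off = 0], to be imaginary. *)
Lemma left_deriv_real (f : C -> SL2tilde) (z : C) (a a' b b' : C) :
  has_d (fun w => diag (f w)) z a a' -> has_d (fun w => off (f w)) z b b' ->
  forall k, let Z := left_deriv d_z f z k in
  left_deriv d_zbar f z k = Cconj Z /\
  left_deriv d_x f z k = Z + Cconj Z /\
  left_deriv d_y f z k = Ci * (Z - Cconj Z).
Proof.
intros Ha Hb.
assert (Hoff : has_d (fun w => rel_off (f z) (f w)) z
   (Cconj (diag (f z)) * b - off (f z) * Cconj a') (Cconj (diag (f z)) * b' - off (f z) * Cconj a)).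
{ eapply has_d_val.
  - apply (has_d_minus (fun w => Cconj (diag (f z)) * off (f w)));
      [apply (has_d_mult (fun _ => Cconj (diag (f z)))); [apply has_d_const | exact Hb]|].
    apply (has_d_mult (fun _ => off (f z))); [apply has_d_const | apply has_d_conj, Ha].
  - ring.
  - ring. }
assert (Hdiag : has_d (fun w => rel_diag (f z) (f w)) z
   (Cconj (diag (f z)) * a - off (f z) * Cconj b') (Cconj (diag (f z)) * a' - off (f z) * Cconj b)).
{ eapply has_d_val.
  - apply (has_d_minus (fun w => Cconj (diag (f z)) * diag (f w)));
      [apply (has_d_mult (fun _ => Cconj (diag (f z)))); [apply has_d_const | exact Ha]|].
    apply (has_d_mult (fun _ => off (f z))); [apply has_d_const | apply has_d_conj, Hb].
  - ring.
  - ring. }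
set (n := Cconj (diag (f z)) * b - off (f z) * Cconj a') in *.
set (n' := Cconj (diag (f z)) * b' - off (f z) * Cconj a) in *.
set (m := Cconj (diag (f z)) * a - off (f z) * Cconj b') in *.
set (m' := Cconj (diag (f z)) * a' - off (f z) * Cconj b) in *.
assert (Em : m' = - Cconj m).
{ assert (Hdet : has_d (fun w => rel_diag (f z) (f w) * Cconj (rel_diag (f z) (f w))
      - rel_off (f z) (f w) * Cconj (rel_off (f z) (f w))) z (m + Cconj m') (m' + Cconj m)).
  { eapply has_d_val.
    - apply (has_d_minus
        (fun w => rel_diag (f z) (f w) * Cconj (rel_diag (f z) (f w)))
        (fun w => rel_off (f z) (f w) * Cconj (rel_off (f z) (f w)))).
      + exact (has_d_mult _ _ _ _ _ _ _ Hdiag (has_d_conj _ _ _ _ Hdiag)).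
      + exact (has_d_mult _ _ _ _ _ _ _ Hoff (has_d_conj _ _ _ _ Hoff)).
    - cbv beta; rewrite rel_diag_refl, rel_off_refl, !RtoC_conj; ring.
    - cbv beta; rewrite rel_diag_refl, rel_off_refl, !RtoC_conj; ring. }
  assert (H0 := has_d_const 1 z).
  apply has_d_d_zbar in Hdet; apply has_d_d_zbar in H0.
  rewrite (d_zbar_ext z _ (fun _ => RtoC 1)), H0 in Hdet.
  - transitivity (m' + Cconj m - Cconj m); [ring | rewrite <- Hdet; ring].
  - intros w; rewrite <- rel_diagE, <- rel_offE, diag_mod2; ring. }
assert (Hoffc := has_d_conj _ _ _ _ Hoff).
intros k Z; unfold Z; clear Z.
rewrite (left_derivE d_x f z k (d_x_ext z)), (left_derivE d_y f z k (d_y_ext z)),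
  (left_derivE d_z f z k (d_z_ext z)), (left_derivE d_zbar f z k (d_zbar_ext z)).
rewrite (has_d_d_x _ _ _ _ Hoff), (has_d_d_y _ _ _ _ Hoff), (has_d_d_z _ _ _ _ Hoff),
  (has_d_d_zbar _ _ _ _ Hoff), (has_d_d_x _ _ _ _ Hoffc), (has_d_d_y _ _ _ _ Hoffc),
  (has_d_d_z _ _ _ _ Hoffc), (has_d_d_zbar _ _ _ _ Hoffc),
  (has_d_d_x _ _ _ _ Hdiag), (has_d_d_y _ _ _ _ Hdiag), (has_d_d_z _ _ _ _ Hdiag),
  (has_d_d_zbar _ _ _ _ Hdiag), Em.
destruct k; rewrite ?Cmult_conj, ?Copp_conj, ?Cmult_conj, ?Cplus_conj, ?Cminus_conj, ?Cconj_conj,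
  ?RtoC_conj, ?Ci_conj; repeat split; ring [Ci2].
Qed.

Lemma smoothG_has_d (Omega : C -> Prop) (f : C -> SL2tilde) (z : C) :
  smoothG Omega f -> Omega z ->
  (exists a a', has_d (fun w => diag (f w)) z a a') /\
  (exists b b', has_d (fun w => off (f w)) z b b').
Proof.
intros [Hoff Hang] Hz.
destruct (has_d_smooth Omega _ z Hoff Hz) as [H1 H2]; split.
- destruct (cderiv_diag (fun s => f (s, Im z)) (Re z) _ _ H1 (Ck_dx 0 Omega _ z (Hang 1%nat) Hz))
    as [vx Hx].
  destruct (cderiv_diag (fun s => f (Re z, s)) (Im z) _ _ H2 (Ck_dy 0 Omega _ z (Hang 1%nat) Hz))
    as [vy Hy].
  do 2 eexists; apply has_d_intro; eassumption.
- do 2 eexists; split; eassumption.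
Qed.

Lemma left_deriv_smooth (Omega : C -> Prop) (f : C -> SL2tilde) (z : C) (k : idx) :
  smoothG Omega f -> Omega z -> let Z := left_deriv d_z f z k in
  left_deriv d_zbar f z k = Cconj Z /\
  left_deriv d_x f z k = Z + Cconj Z /\
  left_deriv d_y f z k = Ci * (Z - Cconj Z).
Proof.
intros Hf Hz; destruct (smoothG_has_d _ _ _ Hf Hz) as [(a & a' & Ha) (b & b' & Hb)].
exact (left_deriv_real f z _ _ _ _ Ha Hb k).
Qed.

Lemma spin_E_real (p s : C) :
  spin_E p s = RtoC (Cmod p ^ 2 + Cmod s ^ 2).
Proof. rewrite RtoC_plus, !Cmod2_conj; reflexivity. Qed.

Lemma RtoC_exp2 (a : R) : RtoC (exp (2 * a)) = RtoC (exp a) ^ 2.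
Proof.
replace (2 * a)%R with (a + a)%R by ring; rewrite exp_plus, RtoC_mult; ring.
Qed.

Lemma RtoC_exp_neq0 (a : R) : RtoC (exp a) <> 0.
Proof. intros E; apply RtoC_inj in E; pose proof (exp_pos a); lra. Qed.

Lemma RtoC_exp_opp (a : R) : RtoC (exp (- a)) = / RtoC (exp a).
Proof. rewrite exp_Ropp; apply RtoC_inv; pose proof (exp_pos a); lra. Qed.

Lemma RtoC_exp_m2 (a : R) : RtoC (exp (- 2 * a)) = / RtoC (exp a) ^ 2.
Proof.
replace (- 2 * a)%R with (- (2 * a))%R by ring; rewrite RtoC_exp_opp, RtoC_exp2; reflexivity.
Qed.

(** From Z . Z = 0, f_x = Z + conj Z and f_y = i (Z - conj Z) it follows that f_x and f_y are
    orthogonal with the common square 2 Z . conj Z = [spin_E] ^ 2. What remains of conformality is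
    the value of [alpha]. *)
Lemma spin_conformal (Omega : C -> Prop) (f : C -> SL2tilde) (alpha : C -> R)
    (p s : C -> C) :
  smoothG Omega f ->
  (forall z, Omega z -> forall k, left_deriv d_z f z k = spin_Z (p z) (s z) k) ->
  conformal_immersion Omega f alpha <->
  forall z, Omega z -> RtoC (exp (alpha z)) = spin_E (p z) (s z).
Proof.
intros Hf HZ.
assert (HX : forall z k, Omega z ->
  left_deriv d_x f z k = spin_Z (p z) (s z) k + Cconj (spin_Z (p z) (s z) k) /\
  left_deriv d_y f z k = Ci * (spin_Z (p z) (s z) k - Cconj (spin_Z (p z) (s z) k))).
{ intros z k Hz; rewrite <- (HZ z Hz k); now apply (left_deriv_smooth Omega). }
assert (HI : forall z, Omega z ->
  inner (left_deriv d_x f z) (left_deriv d_x f z) = spin_E (p z) (s z) ^ 2 /\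
  inner (left_deriv d_y f z) (left_deriv d_y f z) = spin_E (p z) (s z) ^ 2 /\
  inner (left_deriv d_x f z) (left_deriv d_y f z) = 0).
{ intros z Hz; unfold inner, sum3.
  rewrite !(proj1 (HX z _ Hz)), !(proj2 (HX z _ Hz)).
  rewrite !spin_Z_conj; unfold spin_Z, spin_E; repeat split; field [Ci2]; C_neq. }
split.
- intros [_ H] z Hz; destruct (H z Hz) as [H1 _]; destruct (HI z Hz) as [H2 _].
  cbv zeta in H1; rewrite H2, RtoC_exp2, spin_E_real in H1; rewrite spin_E_real.
  f_equal; set (r := (Cmod (p z) ^ 2 + Cmod (s z) ^ 2)%R) in *.
  assert (0 <= r)%R by (unfold r; nra); pose proof (exp_pos (alpha z)).
  rewrite <- !RtoC_pow in H1; apply RtoC_inj in H1; simpl in H1; nra.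
- intros H; split; [exact Hf|]; intros z Hz; cbv zeta.
  rewrite RtoC_exp2, (H z Hz); exact (HI z Hz).
Qed.

Lemma spin_normal (f : C -> SL2tilde) (alpha : C -> R) (z p s : C) (k : idx) :
  (forall j, left_deriv d_z f z j = spin_Z p s j) ->
  RtoC (exp (alpha z)) = spin_E p s ->
  unit_normal f alpha z k = spin_N p s k.
Proof.
intros HZ HE; unfold unit_normal, spin_N; rewrite !HZ, RtoC_exp_m2, HE; reflexivity.
Qed.

Lemma spin_nabla (Omega : C -> Prop) (f : C -> SL2tilde) (p s : C -> C) (z a a' b b' : C)
    (k : idx) :
  open Omega -> smoothG Omega f ->
  (forall w, Omega w -> forall j, left_deriv d_z f w j = spin_Z (p w) (s w) j) ->
  Omega z -> has_d p z a a' -> has_d s z b b' ->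
  nabla_along d_z f (left_deriv d_z f) z k
  = spin_dZ (p z) (s z) a b k + nabla_lie (spin_Z (p z) (s z)) (spin_Z (p z) (s z)) k /\
  nabla_along d_zbar f (left_deriv d_z f) z k
  = spin_dZ (p z) (s z) a' b' k
    + nabla_lie (fun j => Cconj (spin_Z (p z) (s z) j)) (spin_Z (p z) (s z)) k.
Proof.
intros HO Hf HZ Hz Hp Hs.
assert (HD : has_d (fun w => left_deriv d_z f w k) z
   (spin_dZ (p z) (s z) a b k) (spin_dZ (p z) (s z) a' b' k)).
{ apply has_d_ext with Omega (fun w => spin_Z (p w) (s w) k); try assumption.
  - intros w Hw; symmetry; now apply HZ.
  - now apply has_d_spin_Z. }
unfold nabla_along; rewrite (has_d_d_z _ _ _ _ HD), (has_d_d_zbar _ _ _ _ HD), !nabla_lieE.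
assert (HZb : forall j, left_deriv d_zbar f z j = Cconj (spin_Z (p z) (s z) j)).
{ intros j; rewrite <- (HZ z Hz j); now apply (left_deriv_smooth Omega). }
rewrite !HZb, !(HZ z Hz); split; reflexivity.
Qed.

Lemma potUE (psi1 psi2 : C -> C) (H : C -> R) (z : C) :
  potU psi1 psi2 H z =
  RtoC (H z) / 2 * spin_E (psi1 z) (Cconj (psi2 z))
  + Ci * (/ 2 * (psi1 z * Cconj (psi1 z)) - 3 / 4 * (Cconj (psi2 z) * psi2 z)).
Proof.
unfold potU; rewrite !RtoC_plus, !Cmod2_conj; unfold spin_E; rewrite Cconj_conj; ring.
Qed.

Lemma potVE (psi1 psi2 : C -> C) (H : C -> R) (z : C) :
  potV psi1 psi2 H z =
  RtoC (H z) / 2 * spin_E (psi1 z) (Cconj (psi2 z))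
  + Ci * (3 / 4 * (psi1 z * Cconj (psi1 z)) - / 2 * (Cconj (psi2 z) * psi2 z)).
Proof.
unfold potV; rewrite !RtoC_plus, !Cmod2_conj; unfold spin_E; rewrite Cconj_conj; ring.
Qed.

(** Conjugating the first Dirac equation turns both into formulas for the [d_zbar] derivatives of p
    = psi_1 and s = conj psi_2, the unknowns of [spin_mean]. *)
Lemma dirac_spin (Omega : C -> Prop) (psi1 psi2 : C -> C) (H : C -> R) :
  dirac Omega psi1 psi2 H <->
  forall z, Omega z ->
  let p := psi1 z in let s := Cconj (psi2 z) in let h := RtoC (H z) in
  d_zbar psi1 z = spin_V p s h * Cconj s /\
  Cconj (d_z psi2 z)
  = - (h / 2 * spin_E p s - Ci * (/ 2 * (p * Cconj p) - 3 / 4 * (s * Cconj s))) * Cconj p.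
Proof.
assert (HU : forall z, Cconj (potU psi1 psi2 H z) =
   RtoC (H z) / 2 * spin_E (psi1 z) (Cconj (psi2 z))
   - Ci * (/ 2 * (psi1 z * Cconj (psi1 z)) - 3 / 4 * (Cconj (psi2 z) * Cconj (Cconj (psi2 z))))).
{ intros z; rewrite potUE; unfold Cdiv.
  assert (Q : Cconj (/ 4) = / 4) by (rewrite Cconj_inv, RtoC_conj by C_neq; reflexivity).
  rewrite ?Cplus_conj, ?Cmult_conj, ?Cminus_conj, ?Cmult_conj, spin_E_conj, !RtoC_conj, Cconj_half,
    Ci_conj, Q, !Cconj_conj; ring. }
split; intros HD z Hz; destruct (HD z Hz) as [H1 H2]; cbv zeta.
- split.
  + transitivity (potV psi1 psi2 H z * psi2 z
       - (- d_zbar psi1 z + potV psi1 psi2 H z * psi2 z)); [ring|].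
    rewrite H2, potVE; unfold spin_V; rewrite Cconj_conj; ring.
  + rewrite <- HU, <- Copp_conj, <- Cmult_conj; f_equal.
    transitivity (d_z psi2 z + potU psi1 psi2 H z * psi1 z - potU psi1 psi2 H z * psi1 z);
      [ring | rewrite H1; ring].
- split.
  + apply (f_equal Cconj) in H2; rewrite Cconj_conj, <- HU, <- Copp_conj, <- Cmult_conj, Cconj_conj in H2.
    rewrite H2; ring.
  + rewrite H1, potVE; unfold spin_V; rewrite Cconj_conj; ring.
Qed.

Lemma surface_spin (Omega : C -> Prop) (f : C -> SL2tilde) (alpha : C -> R)
    (psi1 psi2 : C -> C) (H : C -> R) :
  open Omega -> smoothC Omega psi1 -> smoothC Omega psi2 -> smoothG Omega f ->
  (forall z, Omega z -> forall k,
     left_deriv d_z f z k = spin_Z (psi1 z) (Cconj (psi2 z)) k) ->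
  (forall z, Omega z -> RtoC (exp (alpha z)) = spin_E (psi1 z) (Cconj (psi2 z))) ->
  is_mean_curvature Omega f alpha H <-> dirac Omega psi1 psi2 H.
Proof.
intros HO S1 S2 Hf HZ HE.
rewrite dirac_spin; unfold is_mean_curvature.
assert (N : forall z, Omega z -> psi1 z <> 0 \/ Cconj (psi2 z) <> 0).
{ intros z Hz; destruct (Classical_Prop.classic (psi1 z = 0)) as [E1 | E1]; [right | now left].
  intros E2; apply (RtoC_exp_neq0 (alpha z)); rewrite (HE z Hz); unfold spin_E.
  rewrite E1, E2; ring. }
assert (HM : forall z k, Omega z ->
  nabla_along d_zbar f (left_deriv d_z f) z k
  = spin_dZ (psi1 z) (Cconj (psi2 z)) (d_zbar psi1 z) (Cconj (d_z psi2 z)) k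
    + nabla_lie (fun j => Cconj (spin_Z (psi1 z) (Cconj (psi2 z)) j))
        (spin_Z (psi1 z) (Cconj (psi2 z))) k).
{ intros z k Hz.
  apply (spin_nabla Omega f psi1 (fun w => Cconj (psi2 w)) z (d_z psi1 z) (d_zbar psi1 z)
     (Cconj (d_zbar psi2 z)) (Cconj (d_z psi2 z))); try assumption.
  - now apply has_d_smooth with Omega.
  - now apply d_conj with Omega. }
assert (HR : forall z k, Omega z ->
  / 2 * RtoC (exp (2 * alpha z)) * RtoC (H z) * unit_normal f alpha z k
  = / 2 * spin_E (psi1 z) (Cconj (psi2 z)) ^ 2 * RtoC (H z)
    * spin_N (psi1 z) (Cconj (psi2 z)) k).
{ intros z k Hz; rewrite (spin_normal f alpha z (psi1 z) (Cconj (psi2 z)) k).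
  - rewrite RtoC_exp2, (HE z Hz); reflexivity.
  - intros j; now apply HZ.
  - now apply HE. }
split; intros HH z Hz.
- cbv zeta; apply (spin_dZ_inj (psi1 z) (Cconj (psi2 z))); [now apply N|]; intros k.
  pose proof (HH z Hz k) as E; rewrite (HM z k Hz), (HR z k Hz) in E.
  (* The right-hand side is written as the left-hand side for the Dirac values; the connection terms
     are then equal and cancel, which leaves the hypothesis of [spin_dZ_inj]. *)
  rewrite <- (spin_mean (psi1 z) (Cconj (psi2 z)) (RtoC (H z)) _ _ (N z Hz) eq_refl eq_refl k) in E.
  match type of E with ?a + ?b = ?c + ?b =>
    transitivity (a + b - b); [ring | rewrite E; ring] end.
- intros k; rewrite (HM z k Hz), (HR z k Hz).
  destruct (HH z Hz) as [E1 E2]; now apply spin_mean; [apply N | | ].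
Qed.

(* [s], [P], [S], [hz] stand for [conj psi_2], [d_z psi_1], [d_z (conj psi_2)], [d_z H]; a final [b]
   marks conjugates, a final [z] or [zb] the Wirtinger derivatives. *)
Lemma spin_codazzi (p pb q s P Pb S Sb h hz : C) :
  let E := p * pb + q * s in
  E <> 0 -> h - Ci <> 0 ->
  let V := h / 2 * E + Ci * (3/4 * (p * pb) - / 2 * (s * q)) in
  let Vb := h / 2 * E - Ci * (3/4 * (p * pb) - / 2 * (s * q)) in
  let Ub := h / 2 * E - Ci * (/2 * (p * pb) - 3/4 * (s * q)) in
  let U := h / 2 * E + Ci * (/2 * (p * pb) - 3/4 * (s * q)) in
  let Ez := P * pb + q * S + 5 * Ci / 4 * p * s * (q * s - p * pb) in
  let Ezb := Pb * p + s * Sb - 5 * Ci / 4 * pb * q * (q * s - p * pb) in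
  let qz := - U * p in let pbz := Vb * s in let pzb := V * q in let szb := - Ub * pb in
  let ppbz := P * pb + p * pbz in
  let qsz := qz * s + q * S in
  let ppbzb := pzb * pb + p * Pb in
  let qszb := Sb * s + q * szb in
  let Vz := hz / 2 * E + h / 2 * Ez + Ci * (3/4 * ppbz - /2 * qsz) in
  let Ubz := hz / 2 * E + h / 2 * Ez - Ci * (/2 * ppbz - 3/4 * qsz) in
  let Pzb := Vz * q + V * qz in
  let Szb := - Ubz * pb - Ub * pbz in
  let Ezzb := Pzb * pb + P * Pb + Sb * S + q * Szb
    + 5 * Ci / 4 * ((pzb * s + p * szb) * (q * s - p * pb) + p * s * (qszb - ppbzb)) in
  let A := s * P - p * S - 5 * Ci / 2 * p ^ 2 * s ^ 2 in
  let Ab := q * Pb - pb * Sb + 5 * Ci / 2 * pb ^ 2 * q ^ 2 in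
  let Azb := szb * P + s * Pzb - pzb * S - p * Szb
    - 5 * Ci / 2 * (2 * p * pzb * s ^ 2 + 2 * p ^ 2 * s * szb) in
  Ez = ppbz + qsz /\ Ezb = ppbzb + qszb /\
  (Ezzb * E - Ez * Ezb) / E ^ 2 - A * Ab / E ^ 2 + / 4 * E ^ 2 * h ^ 2 = E ^ 2 - 5 * (p * s * pb * q) /\
  Azb + 5 * (p * s) * (pzb * s + p * szb) / (h - Ci) = / 2 * hz * E ^ 2.
Proof.
intros E HE Hh V Vb Ub U Ez Ezb qz pbz pzb szb ppbz qsz ppbzb qszb Vz Ubz Pzb Szb Ezzb A Ab Azb.
split; [|split; [|split]].
- unfold Ez, ppbz, qsz, pbz, qz, U, Vb, E; field; C_neq.
- unfold Ezb, ppbzb, qszb, pzb, szb, V, Ub, E; field; C_neq.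
- unfold Ezzb, A, Ab, Szb, Pzb, Ubz, Vz, Ez, Ezb, qszb, ppbzb, qsz, ppbz, szb, pzb, pbz, qz, U, Ub, V, Vb;
  unfold E in *; field [Ci2]; C_neq.
- unfold Azb, Szb, Pzb, Ubz, Vz, Ez, Ezb, qszb, ppbzb, qsz, ppbz, szb, pzb, pbz, qz, U, Ub, V, Vb;
  unfold E in *; field [Ci2]; C_neq.
Qed.

(** * The Weingarten and Codazzi equations *)

Ltac has_d_auto :=
  cbv beta;
  lazymatch goal with
  | |- has_d (fun _ => ?c) _ _ _ => apply (has_d_const c)
  | |- has_d (fun w => @?F w + @?G w) _ _ _ => apply (has_d_plus F G); has_d_auto
  | |- has_d (fun w => @?F w - @?G w) _ _ _ => apply (has_d_minus F G); has_d_auto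
  | |- has_d (fun w => - @?F w) _ _ _ => apply (has_d_opp F); has_d_auto
  | |- has_d (fun w => @?F w * @?G w) _ _ _ => apply (has_d_mult F G); has_d_auto
  | |- has_d (fun w => @?F w / @?G w) _ _ _ =>
      apply (has_d_mult F (fun w => / G w)); has_d_auto
  | |- has_d (fun w => / @?F w) _ _ _ => apply (has_d_inv F); [has_d_auto|]
  | |- has_d (fun w => @?F w ^ 2) _ _ _ => apply (has_d_sqr F); has_d_auto
  | |- _ => eassumption
  end.

(** The differentiability of [a] comes from that of [F], since a = ln (Re F) near [t]. As [F] is
    real there, [Im v] vanishes and the complex quotient is the real one. *)
Lemma cderiv_ln (a : R -> R) (F : R -> C) (t : R) (v : C) :
  locally t (fun s => RtoC (exp (a s)) = F s) -> cderiv F t v ->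
  cderiv (fun s => RtoC (a s)) t (v / F t).
Proof.
intros HE [H1 H2].
assert (Et := locally_singleton _ _ HE); cbv beta in Et.
assert (I0 : Im v = 0%R).
{ rewrite <- (is_derive_unique _ _ _ H2).
  rewrite (Derive_ext_loc _ (fun _ => 0%R)); [apply Derive_const|].
  revert HE; apply filter_imp; intros s <-; reflexivity. }
assert (Ha : is_derive a t (Re v / Re (F t))%R).
{ apply is_derive_ext_loc with (fun s => ln (Re (F s))).
  - revert HE; apply filter_imp; intros s <-; simpl; apply ln_exp.
  - apply (@is_derive_comp R_AbsRing R_NormedModule ln); [|exact H1].
    apply is_derive_ln; rewrite <- Et; apply exp_pos. }
apply cderiv_RtoC in Ha; eapply cderiv_val; [exact Ha|].
rewrite RtoC_div by (rewrite <- Et; simpl; pose proof (exp_pos (a t)); lra).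
rewrite <- Et; f_equal.
apply injective_projections; [reflexivity | symmetry; exact I0].
Qed.

Lemma has_d_ln (Omega : C -> Prop) (a : C -> R) (F : C -> C) (z u v : C) :
  open Omega -> Omega z -> (forall w, Omega w -> RtoC (exp (a w)) = F w) ->
  has_d F z u v -> has_d (fun w => RtoC (a w)) z (u / F z) (v / F z).
Proof.
intros HO Hz HE [H1 H2].
assert (N : F z <> 0) by (rewrite <- (HE z Hz); apply RtoC_exp_neq0).
assert (L : locally z (fun w => RtoC (exp (a w)) = F w))
  by (apply filter_imp with Omega; [exact HE | exact (HO z Hz)]).
destruct z as [x y]; split.
- eapply cderiv_val; [apply (cderiv_ln _ (fun s => F (s, y)));
    [exact (locally_slice_x _ _ L) | exact H1] | simpl; field; exact N].
- eapply cderiv_val; [apply (cderiv_ln _ (fun s => F (x, s)));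
    [exact (locally_slice_y _ _ L) | exact H2] | simpl; field; exact N].
Qed.

Lemma surface_data (Omega : C -> Prop) (f : C -> SL2tilde) (alpha : C -> R)
    (psi1 psi2 : C -> C) (H : C -> R) :
  open Omega -> surface Omega f alpha psi1 psi2 H ->
  smoothG Omega f /\
  (forall z, Omega z -> forall k,
     left_deriv d_z f z k = spin_Z (psi1 z) (Cconj (psi2 z)) k) /\
  (forall z, Omega z -> RtoC (exp (alpha z)) = spin_E (psi1 z) (Cconj (psi2 z))) /\
  dirac Omega psi1 psi2 H.
Proof.
intros HO (Hc & (S1 & S2 & HZ) & HH).
assert (Hf := proj1 Hc).
assert (HZ' : forall z, Omega z -> forall k,
     left_deriv d_z f z k = spin_Z (psi1 z) (Cconj (psi2 z)) k).
{ intros z Hz k; destruct (HZ z Hz) as (E1 & E2 & E3); destruct k; assumption. }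
assert (HE := proj1 (spin_conformal Omega f alpha psi1 (fun z => Cconj (psi2 z)) Hf HZ') Hc).
split; [exact Hf|]; split; [exact HZ'|]; split; [exact HE|].
exact (proj1 (surface_spin Omega f alpha psi1 psi2 H HO S1 S2 Hf HZ' HE) HH).
Qed.

Lemma hopf_spin (Omega : C -> Prop) (f : C -> SL2tilde) (alpha : C -> R)
    (psi1 psi2 : C -> C) (H : C -> R) (z : C) :
  open Omega -> surface Omega f alpha psi1 psi2 H -> Omega z ->
  hopf f alpha z =
  Cconj (psi2 z) * d_z psi1 z - psi1 z * d_z (fun w => Cconj (psi2 w)) z
  - 5 * Ci / 2 * psi1 z ^ 2 * Cconj (psi2 z) ^ 2.
Proof.
intros HO Hs Hz; destruct (surface_data _ _ _ _ _ _ HO Hs) as (Hf & HZ & HE & _).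
destruct Hs as (_ & (S1 & S2 & _) & _).
rewrite <- spin_hopf.
- unfold hopf, inner, sum3.
  rewrite !(spin_normal f alpha z (psi1 z) (Cconj (psi2 z)) _ (HZ z Hz) (HE z Hz)).
  assert (HN : forall k, nabla_along d_z f (left_deriv d_z f) z k
    = spin_dZ (psi1 z) (Cconj (psi2 z)) (d_z psi1 z) (d_z (fun w => Cconj (psi2 w)) z) k
      + nabla_lie (spin_Z (psi1 z) (Cconj (psi2 z))) (spin_Z (psi1 z) (Cconj (psi2 z))) k).
  { intros k; eapply (spin_nabla Omega f psi1 (fun w => Cconj (psi2 w))); try assumption;
      apply has_d_smooth with Omega; try assumption; now apply smoothC_conj. }
  rewrite !HN; reflexivity.
- destruct (Classical_Prop.classic (psi1 z = 0)) as [E1 | E1]; [right | now left].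
  intros E2; apply (RtoC_exp_neq0 (alpha z)); rewrite (HE z Hz); unfold spin_E.
  rewrite E1, E2; ring.
Qed.

(** [surface] puts no regularity on [H], but the Codazzi equations differentiate it. The combination
    [G] of the two Dirac equations equals H E^2 / 2 + i (|psi_1|^4 - |psi_2|^4) / 2, so H is the
    real part of 2 G / E^2. *)
Lemma dirac_H_smooth (Omega : C -> Prop) (psi1 psi2 : C -> C) (H : C -> R) :
  open Omega -> smoothC Omega psi1 -> smoothC Omega psi2 ->
  (forall z, Omega z -> spin_E (psi1 z) (Cconj (psi2 z)) <> 0) ->
  dirac Omega psi1 psi2 H -> smooth Omega H.
Proof.
intros HO S1 S2 N HD.
set (G := fun z => d_zbar psi1 z * Cconj (psi2 z) - d_z psi2 z * Cconj (psi1 z)).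
set (E := fun z => spin_E (psi1 z) (Cconj (psi2 z))).
assert (SE : smoothC Omega E).
{ unfold E, spin_E; apply smoothC_plus; [exact HO | |]; apply smoothC_mult; try exact HO;
    repeat (apply smoothC_conj; [exact HO|]); assumption. }
assert (SG : smoothC Omega G).
{ apply smoothC_minus; [exact HO | |]; apply smoothC_mult; try exact HO.
  - now apply smoothC_d_zbar.
  - now apply smoothC_conj.
  - now apply smoothC_d_z.
  - now apply smoothC_conj. }
assert (S : smoothC Omega (fun z => 2 * G z * / (E z * E z))).
{ apply smoothC_mult; [exact HO | |].
  - apply smoothC_mult; [exact HO | now apply smoothC_const | exact SG].
  - apply smoothC_inv; [exact HO | | now apply smoothC_mult].
    intros z Hz; apply Cmult_neq_0; now apply N. }
intros k; apply Ck_ext with (fun z => Re (2 * G z * / (E z * E z))); [exact HO | | apply S].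
intros z Hz; destruct (HD z Hz) as [H1 H2].
rewrite potUE in H1; rewrite potVE in H2.
set (p := psi1 z) in *; set (q := psi2 z) in *.
set (e := Ci * (/ 2 * ((p * Cconj p) * (p * Cconj p)) - / 2 * ((q * Cconj q) * (q * Cconj q)))).
assert (EG : G z = RtoC (H z) / 2 * (E z * E z) + e).
{ assert (A1 : d_z psi2 z = - (RtoC (H z) / 2 * E z
     + Ci * (/ 2 * (p * Cconj p) - 3 / 4 * (Cconj q * q))) * p).
  { match type of H1 with ?a + ?b = _ => transitivity (a + b - b); [ring|] end.
    rewrite H1; unfold E; fold p q; ring. }
  assert (A2 : d_zbar psi1 z = (RtoC (H z) / 2 * E z
     + Ci * (3 / 4 * (p * Cconj p) - / 2 * (Cconj q * q))) * q).
  { match type of H2 with - ?a + ?b = _ => transitivity (b - (- a + b)); [ring|] end.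
    rewrite H2; unfold E; fold p q; ring. }
  unfold G; rewrite A1, A2; unfold e, E, spin_E; fold p q; rewrite Cconj_conj; field; C_neq. }
assert (NE : E z <> 0) by now apply N.
replace (2 * G z * / (E z * E z)) with (RtoC (H z) + 2 * e / (E z * E z))
  by (rewrite EG; field; C_neq).
assert (Ee : exists r s : R, 2 * e = Ci * RtoC r /\ E z * E z = RtoC s).
{ exists (Cmod p ^ 2 * Cmod p ^ 2 - Cmod q ^ 2 * Cmod q ^ 2)%R,
    ((Cmod p ^ 2 + Cmod (Cconj q) ^ 2) * (Cmod p ^ 2 + Cmod (Cconj q) ^ 2))%R; split.
  - rewrite RtoC_minus, !RtoC_mult, !Cmod2_conj; unfold e; field; C_neq.
  - rewrite RtoC_mult; unfold E; rewrite spin_E_real; reflexivity. }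
destruct Ee as (r & s & -> & Es); rewrite Es.
assert (Ns : s <> 0%R).
{ intros E0; subst s; apply (Cmult_neq_0 _ _ NE NE Es). }
replace (Ci * RtoC r / RtoC s) with (Ci * RtoC (r / s)).
- simpl; ring.
- rewrite RtoC_div by exact Ns; unfold Cdiv; ring.
Qed.

(** The Dirac equation fixes half of the first derivatives of the spinor and its conjugate; the
    others are [P], [S] and their conjugates, the free variables of [spin_codazzi]. *)
Lemma dirac_has_d (Omega : C -> Prop) (psi1 psi2 : C -> C) (H : C -> R) (z : C) :
  open Omega -> smoothC Omega psi1 -> smoothC Omega psi2 ->
  dirac Omega psi1 psi2 H -> Omega z ->
  let p := psi1 z in let q := psi2 z in let pb := Cconj p in let s := Cconj q in
  let h := RtoC (H z) in let E := p * pb + q * s in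
  let P := d_z psi1 z in let S := d_z (fun w => Cconj (psi2 w)) z in
  let V := h / 2 * E + Ci * (3/4 * (p * pb) - / 2 * (s * q)) in
  let Vb := h / 2 * E - Ci * (3/4 * (p * pb) - / 2 * (s * q)) in
  let U := h / 2 * E + Ci * (/2 * (p * pb) - 3/4 * (s * q)) in
  let Ub := h / 2 * E - Ci * (/2 * (p * pb) - 3/4 * (s * q)) in
  has_d psi1 z P (V * q) /\
  has_d psi2 z (- U * p) (Cconj S) /\
  has_d (fun w => Cconj (psi1 w)) z (Vb * s) (Cconj P) /\
  has_d (fun w => Cconj (psi2 w)) z S (- Ub * pb).
Proof.
intros HO S1 S2 HD Hz p q pb s h E P S V Vb U Ub.
destruct (HD z Hz) as [H1 H2]; rewrite potUE in H1; rewrite potVE in H2.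
destruct (proj1 (dirac_spin _ _ _ _) HD z Hz) as [H3 H4].
assert (EE : spin_E (psi1 z) (Cconj (psi2 z)) = E)
  by (unfold spin_E, E, s, pb, q, p; rewrite Cconj_conj; ring).
assert (D1 := has_d_smooth Omega psi1 z S1 Hz); assert (D2 := has_d_smooth Omega psi2 z S2 Hz).
assert (D3 := has_d_conj _ _ _ _ D1); assert (D4 := has_d_conj _ _ _ _ D2).
assert (ES : S = Cconj (d_zbar psi2 z)) by exact (has_d_d_z _ _ _ _ D4).
assert (E1 : d_zbar psi1 z = V * q).
{ match type of H2 with - ?a + ?b = _ => transitivity (b - (- a + b)); [ring|] end.
  rewrite H2, EE; unfold V, h, E, s, pb, q, p; ring. }
assert (E2 : d_z psi2 z = - U * p).
{ match type of H1 with ?a + ?b = _ => transitivity (a + b - b); [ring|] end.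
  rewrite H1, EE; unfold U, h, E, s, pb, q, p; ring. }
assert (Q : Cconj (V * q) = Vb * s).
{ assert (Q4 : Cconj (/ 4) = / 4) by (rewrite Cconj_inv, RtoC_conj by C_neq; reflexivity).
  unfold V, Vb, E, s, pb, h, Cdiv.
  repeat (rewrite Cmult_conj || rewrite Cplus_conj || rewrite Cminus_conj).
  rewrite ?RtoC_conj, ?Cconj_half, ?Q4, ?Ci_conj, !Cconj_conj; ring. }
split; [|split; [|split]].
- rewrite <- E1; exact D1.
- rewrite <- E2, ES, Cconj_conj; exact D2.
- rewrite <- Q, <- E1; exact D3.
- rewrite ES; eapply has_d_val; [exact D4 | reflexivity|].
  rewrite H4; rewrite EE; unfold Ub, h, s, pb, q, p; rewrite Cconj_conj; ring.
Qed.

(** The formulas for A and for alpha_z are two linear equations for the z-derivatives of psi_1 and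
    conj psi_2, with determinant |psi_1|^2 + |psi_2|^2 = e^alpha; their solution gives the
    Weingarten equations, the second one after conjugation. *)
Lemma surface_weingarten_codazzi (Omega : C -> Prop) (f : C -> SL2tilde) (alpha : C -> R)
    (psi1 psi2 : C -> C) (H : C -> R) (z : C) :
  open Omega -> surface Omega f alpha psi1 psi2 H -> Omega z ->
  let A := hopf f alpha in
  let alphaC := fun w => RtoC (alpha w) in
  let HC := fun w => RtoC (H w) in
  let Z3 := fun w => psi1 w * Cconj (psi2 w) in
  (d_z psi1 z = d_z alphaC z * psi1 z + A z * RtoC (exp (- alpha z)) * psi2 z
                + 5 * Ci / 4 * psi1 z ^ 2 * Cconj (psi2 z) /\
   d_zbar psi2 z = - Cconj (A z) * RtoC (exp (- alpha z)) * psi1 z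
                   + d_zbar alphaC z * psi2 z
                   + 5 * Ci / 4 * Cconj (psi1 z) * psi2 z ^ 2) /\
  (d_zbar (d_z alphaC) z - RtoC (exp (- 2 * alpha z) * Cmod (A z) ^ 2)
     + / 4 * RtoC (exp (2 * alpha z) * H z ^ 2)
   = RtoC (exp (2 * alpha z)) - 5 * RtoC (Cmod (Z3 z) ^ 2) /\
   d_zbar (fun w => A w + 5 * Z3 w ^ 2 / (2 * (HC w - Ci))) z
   = / 2 * d_z HC z * RtoC (exp (2 * alpha z))
     + d_zbar (fun w => 5 / (2 * (HC w - Ci))) z * Z3 z ^ 2).
Proof.
intros HO Hsurf Hz A alphaC HC Z3.
destruct (surface_data _ _ _ _ _ _ HO Hsurf) as (Hf & HZ & HE & HD).
assert (HA : forall w, Omega w -> Cconj (psi2 w) * d_z psi1 w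
   - psi1 w * d_z (fun w => Cconj (psi2 w)) w - 5 * Ci / 2 * psi1 w ^ 2 * Cconj (psi2 w) ^ 2 = A w)
  by (intros w Hw; symmetry; now apply (hopf_spin Omega _ _ _ _ H)).
destruct Hsurf as (_ & (S1 & S2 & _) & _).
assert (HE' : forall w, Omega w ->
   RtoC (exp (alpha w)) = psi1 w * Cconj (psi1 w) + psi2 w * Cconj (psi2 w)).
{ intros w Hw; rewrite (HE w Hw); unfold spin_E; rewrite Cconj_conj; ring. }
assert (SH : smooth Omega H).
{ apply (dirac_H_smooth Omega psi1 psi2 H HO S1 S2); [|exact HD].
  intros w Hw; rewrite <- (HE w Hw); apply RtoC_exp_neq0. }
assert (DH := has_d_smooth Omega HC z (smoothC_RtoC Omega H HO SH) Hz).
assert (S2b := smoothC_conj Omega psi2 HO S2).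
set (sf := fun w => Cconj (psi2 w)) in *.
assert (NH : forall w, RtoC (H w) - Ci <> 0).
{ intros w E; apply (f_equal snd) in E; simpl in E; lra. }
assert (DD := fun w Hw => dirac_has_d Omega psi1 psi2 H w HO S1 S2 HD Hw).
cbv zeta in DD; fold sf in DD.
destruct (DD z Hz) as (Dp & Dq & Dpb & Ds).
(* The mixed second derivative is recorded as [d_z] of [d_zbar psi1], because the Dirac equation
   expresses the inner derivative through first-order data. The same is done for conj psi_2. *)
assert (DP : has_d (d_z psi1) z (d_z (d_z psi1) z) (d_z (d_zbar psi1) z)).
{ rewrite (d_z_zbar_comm Omega psi1 z HO S1 Hz).
  apply has_d_smooth with Omega; [now apply smoothC_d_z | exact Hz]. }
assert (DS : has_d (d_z sf) z (d_z (d_z sf) z) (d_z (d_zbar sf) z)).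
{ rewrite (d_z_zbar_comm Omega sf z HO S2b Hz).
  apply has_d_smooth with Omega; [now apply smoothC_d_z | exact Hz]. }
assert (EP : has_d (fun w => (RtoC (H w) / 2 * (psi1 w * Cconj (psi1 w) + psi2 w * sf w)
   + Ci * (3 / 4 * (psi1 w * Cconj (psi1 w)) - / 2 * (sf w * psi2 w))) * psi2 w) z
   (d_z (d_zbar psi1) z) (d_zbar (d_zbar psi1) z)).
{ apply has_d_ext with Omega (d_zbar psi1); try assumption.
  - intros w Hw; destruct (DD w Hw) as (Dp' & _); exact (has_d_d_zbar _ _ _ _ Dp').
  - apply has_d_smooth with Omega; [now apply smoothC_d_zbar | exact Hz]. }
assert (ES : has_d (fun w => - (RtoC (H w) / 2 * (psi1 w * Cconj (psi1 w) + psi2 w * sf w)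
   - Ci * (/ 2 * (psi1 w * Cconj (psi1 w)) - 3 / 4 * (sf w * psi2 w))) * Cconj (psi1 w)) z
   (d_z (d_zbar sf) z) (d_zbar (d_zbar sf) z)).
{ apply has_d_ext with Omega (d_zbar sf); try assumption.
  - intros w Hw; destruct (DD w Hw) as (_ & _ & _ & Ds'); exact (has_d_d_zbar _ _ _ _ Ds').
  - apply has_d_smooth with Omega; [now apply smoothC_d_zbar | exact Hz]. }

(* The mean curvature drops out of alpha_z: in the notation of [dirac_has_d] it enters only through
   Vb - U = 5 i / 4 (|psi_2|^2 - |psi_1|^2). *)
assert (DA : forall w, Omega w ->
   has_d alphaC w
    ((d_z psi1 w * Cconj (psi1 w) + psi2 w * d_z sf w
      + 5 * Ci / 4 * psi1 w * sf w * (psi2 w * sf w - psi1 w * Cconj (psi1 w)))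
     / (psi1 w * Cconj (psi1 w) + psi2 w * sf w))
    ((Cconj (d_z psi1 w) * psi1 w + sf w * Cconj (d_z sf w)
      - 5 * Ci / 4 * Cconj (psi1 w) * psi2 w * (psi2 w * sf w - psi1 w * Cconj (psi1 w)))
     / (psi1 w * Cconj (psi1 w) + psi2 w * sf w))).
{ intros w Hw; destruct (DD w Hw) as (Dp' & Dq' & Dpb' & Ds').
  eapply has_d_val.
  - apply (has_d_ln Omega alpha (fun w => psi1 w * Cconj (psi1 w) + psi2 w * sf w) w); try assumption.
    has_d_auto.
  - cbv beta; apply (f_equal (fun x => x / _)); unfold sf; field; C_neq.
  - cbv beta; apply (f_equal (fun x => x / _)); unfold sf; field; C_neq. }
assert (NE : psi1 z * Cconj (psi1 z) + psi2 z * sf z <> 0)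
  by (unfold sf; rewrite <- (HE' z Hz); apply RtoC_exp_neq0).
assert (HAc : Cconj (A z) = psi2 z * Cconj (d_z psi1 z) - Cconj (psi1 z) * Cconj (d_z sf z)
   + 5 * Ci / 2 * Cconj (psi1 z) ^ 2 * psi2 z ^ 2).
{ rewrite <- (HA z Hz); unfold Cdiv.
  repeat (rewrite Cmult_conj || rewrite Cplus_conj || rewrite Cminus_conj).
  rewrite !Cpow_conj, !RtoC_conj, Cconj_half, Ci_conj, !Cconj_conj; ring. }
split.
- rewrite (has_d_d_z _ _ _ _ (DA z Hz)), (has_d_d_zbar _ _ _ _ (DA z Hz)), RtoC_exp_opp,
    (HE' z Hz), HAc, <- (HA z Hz), <- (Cconj_conj (psi2 z)).
  fold (sf z).
  replace (d_zbar psi2 z) with (Cconj (d_z sf z)) by (symmetry; exact (has_d_d_zbar _ _ _ _ Dq)).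
  unfold sf in *; rewrite Cconj_conj; split; field; C_neq.
- rewrite RtoC_mult, RtoC_exp_m2, Cmod2_conj, HAc, RtoC_mult, RtoC_pow, RtoC_exp2, Cmod2_conj.
  unfold Z3; rewrite Cmult_conj, Cconj_conj, (HE' z Hz).
  (* [EP] names the derivative of the Dirac right-hand side and [has_d_auto] computes it; equating
     the two makes the mixed second derivative explicit. *)
  assert (VP := has_d_d_z _ _ _ _ EP); erewrite has_d_d_z in VP; [|has_d_auto].
  assert (VS := has_d_d_z _ _ _ _ ES); erewrite has_d_d_z in VS; [|has_d_auto].
  cbv beta in VP, VS.
  destruct (spin_codazzi (psi1 z) (Cconj (psi1 z)) (psi2 z) (sf z) (d_z psi1 z)
    (Cconj (d_z psi1 z)) (d_z sf z) (Cconj (d_z sf z)) (RtoC (H z)) (d_z HC z) NE (NH z))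
    as (_ & _ & E3 & E4).
  split.
  + erewrite has_d_d_zbar.
    2:{ apply has_d_ext with Omega (fun w =>
      (d_z psi1 w * Cconj (psi1 w) + psi2 w * d_z sf w
       + 5 * Ci / 4 * psi1 w * sf w * (psi2 w * sf w - psi1 w * Cconj (psi1 w)))
       / (psi1 w * Cconj (psi1 w) + psi2 w * sf w)); try assumption.
      - intros w Hw; symmetry; exact (has_d_d_z _ _ _ _ (DA w Hw)).
      - has_d_auto; exact NE. }
    cbv beta; rewrite <- VP, <- VS, <- (HA z Hz); fold (sf z).
    refine (eq_trans (eq_trans _ E3) _); [|ring].
    field; C_neq.
  + erewrite has_d_d_zbar.
    2:{ apply has_d_ext with Omega (fun w => sf w * d_z psi1 w
     - psi1 w * d_z sf w - 5 * Ci / 2 * psi1 w ^ 2 * sf w ^ 2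
     + 5 * (psi1 w * sf w) ^ 2 / (2 * (RtoC (H w) - Ci))); try assumption.
      - intros w Hw; rewrite <- (HA w Hw); reflexivity.
      - has_d_auto; cbv beta; apply Cmult_neq_0; [C_neq | apply NH]. }
    erewrite (has_d_d_zbar (fun w => 5 / (2 * (HC w - Ci)))).
    2:{ has_d_auto; cbv beta; apply Cmult_neq_0; [C_neq | apply NH]. }
    cbv beta; rewrite <- VP, <- VS; fold (sf z).
    (* Both sides contain Z_3^2 times the [d_zbar] derivative of 5 / (2 (H - i)), which is - 5/2
       H_zbar / (H - i)^2; adding this common term to [E4] gives the equation. *)
    refine (eq_trans _ (eq_trans (f_equal (fun x => x
       - 5 / 2 * d_zbar HC z / (RtoC (H z) - Ci) ^ 2 * (psi1 z * sf z) ^ 2) E4) _)).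
    * unfold HC; field; C_neq; apply NH.
    * unfold HC; field; C_neq; apply NH.
Qed.

(** * Linear differential equations *)

Fixpoint picard {I : Type} (f : I -> R -> (I -> R) -> R) (t0 : R) (c : I -> R) (n : nat) :
    I -> R -> R :=
  match n with
  | O => fun i _ => c i
  | S n => fun i t => (c i + RInt (fun s => f i s (fun j => picard f t0 c n j s)) t0 t)%R
  end.

Lemma picard_0 {I : Type} (f : I -> R -> (I -> R) -> R) (t0 : R) (c : I -> R) (n : nat) (i : I) :
  picard f t0 c n i t0 = c i.
Proof.
destruct n; [reflexivity|]; simpl; rewrite RInt_point; unfold zero; simpl; ring.
Qed.

Open Scope R_scope.

Lemma between_near (t0 t s rho : R) :
  Rabs (t - t0) < rho -> Rmin t0 t <= s <= Rmax t0 t -> Rabs (s - t0) < rho.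
Proof.
intros Ht [H1 H2]; apply Rabs_def2 in Ht; apply Rabs_def1;
  unfold Rmin, Rmax in *; destruct (Rle_dec t0 t); lra.
Qed.

Lemma near_open (t0 t rho : R) :
  Rabs (t - t0) < rho -> locally t (fun s => Rabs (s - t0) < rho).
Proof.
intros H; assert (P : 0 < rho - Rabs (t - t0)) by lra.
exists (mkposreal _ P); intros s Hs; change (Rabs (s - t) < rho - Rabs (t - t0)) in Hs.
replace (s - t0) with ((s - t) + (t - t0)) by ring.
eapply Rle_lt_trans; [apply Rabs_triang | lra].
Qed.

(** Since rho * L <= 1/2, consecutive Picard iterates differ by at most M rho / 2^n, and the
    geometric series gives both convergence and the bound 2 M rho. The Lipschitz condition is global
    in the unknown, as for linear equations, so the iterates need not be confined to a ball. *)
Theorem picard_lindelof {I : Type} (f : I -> R -> (I -> R) -> R) (t0 rho L M : R) (c : I -> R) :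
  0 < rho -> 0 <= M -> 0 <= L -> rho * L <= / 2 ->
  (forall t, Rabs (t - t0) < rho -> forall i, Rabs (f i t c) <= M) ->
  (forall t, Rabs (t - t0) < rho -> forall (u v : I -> R) e,
     (forall j, Rabs (u j - v j) <= e) -> forall i, Rabs (f i t u - f i t v) <= L * e) ->
  (forall t, Rabs (t - t0) < rho -> forall phi : I -> R -> R,
     (forall j, continuous (phi j) t) ->
     forall i, continuous (fun s => f i s (fun j => phi j s)) t) ->
  exists phi : I -> R -> R,
    (forall i, phi i t0 = c i) /\
    forall t, Rabs (t - t0) < rho -> forall i,
      is_derive (phi i) t (f i t (fun j => phi j t)) /\
      Rabs (phi i t - c i) <= 2 * (M * rho).
Proof.
intros Hrho HM HL HrL Hb Hlip Hcont.
set (u := picard f t0 c).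
(* Continuity and differentiability go together: the integral defining an iterate can be
   differentiated once the preceding iterate is continuous. *)
assert (Hc : forall n t, Rabs (t - t0) < rho -> forall i, continuous (u n i) t /\
   is_derive (u (S n) i) t (f i t (fun j => u n j t))).
{ assert (step : forall n, (forall t, Rabs (t - t0) < rho -> forall i, continuous (u n i) t) ->
     forall t, Rabs (t - t0) < rho -> forall i,
     is_derive (u (S n) i) t (f i t (fun j => u n j t))).
  { intros n Hn t Ht i.
    eapply is_derive_val; [apply (@is_derive_plus R_AbsRing R_NormedModule)|].
    - apply (@is_derive_const R_AbsRing R_NormedModule).
    - apply (is_derive_RInt (fun s => f i s (fun j => u n j s)) _ t0).
      + generalize (near_open _ _ _ Ht); apply filter_imp; intros s Hs.
        apply (@RInt_correct R_CompleteNormedModule), (@ex_RInt_continuous R_CompleteNormedModule).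
        intros r Hr; apply Hcont; [now apply between_near with s|].
        intros j; apply Hn; now apply between_near with s.
      + apply Hcont; [exact Ht|]; intros j; now apply Hn.
    - unfold plus, zero; simpl; ring. }
  induction n as [|n IH]; intros t Ht i.
  - split; [apply continuous_const|]; apply step; try assumption.
    intros; apply continuous_const.
  - assert (Hn : forall t, Rabs (t - t0) < rho -> forall i, continuous (u (S n) i) t).
    { intros s Hs j; apply (@ex_derive_continuous R_AbsRing R_NormedModule).
      eexists; apply (proj2 (IH s Hs j)). }
    split; [now apply Hn | now apply step]. }
assert (near : forall t s, Rabs (t - t0) < rho -> Rabs (s - t0) <= Rabs (t - t0) ->
   Rabs (s - t0) < rho) by (intros; lra).
assert (Hd : forall n t, Rabs (t - t0) < rho -> forall i,
   Rabs (u (S n) i t - u n i t) <= M * rho * (/ 2) ^ n).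
{ induction n as [|n IH]; intros t Ht i.
  - replace (u 1%nat i t - u O i t) with (u 1%nat i t - u 1%nat i t0)
      by (unfold u; now rewrite !picard_0).
    eapply Rle_trans; [apply (bounded_variation (u 1%nat i) (fun s => f i s (fun j => u O j s)) M)|].
    + intros s Hs; split; [apply Hc; now apply near with t | apply Hb; now apply near with t].
    + simpl; rewrite Rmult_1_r; apply Rmult_le_compat_l; lra.
  - replace (u (S (S n)) i t - u (S n) i t)
      with ((u (S (S n)) i t - u (S n) i t) - (u (S (S n)) i t0 - u (S n) i t0))
      by (unfold u; rewrite !picard_0; ring).
    eapply Rle_trans; [apply (bounded_variation (fun s => u (S (S n)) i s - u (S n) i s)
      (fun s => f i s (fun j => u (S n) j s) - f i s (fun j => u n j s))
      (L * (M * rho * (/ 2) ^ n)))|].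
    + intros s Hs; assert (Hs' := near _ _ Ht Hs); split.
      * apply (@is_derive_minus R_AbsRing R_NormedModule); now apply Hc.
      * apply Hlip; [exact Hs'|]; intros j; now apply IH.
    + assert (0 <= (/ 2) ^ n) by (apply pow_le; lra).
      assert (P : 0 <= M * rho * (/ 2) ^ n) by (apply Rmult_le_pos; [nra | assumption]).
      apply Rle_trans with (L * (M * rho * (/ 2) ^ n) * rho);
        [apply Rmult_le_compat_l; [nra | lra]|].
      simpl; nra. }
assert (Hdk : forall k n t, Rabs (t - t0) < rho -> forall i,
   Rabs (u (n + k)%nat i t - u n i t) <= 2 * (M * rho * (/ 2) ^ n) * (1 - (/ 2) ^ k)).
{ induction k as [|k IH]; intros n t Ht i.
  - rewrite Nat.add_0_r, Rminus_diag, Rabs_R0; simpl; lra.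
  - rewrite Nat.add_succ_r; pose proof (Hd (n + k)%nat t Ht i) as D; pose proof (IH n t Ht i) as E.
    replace (u (S (n + k)) i t - u n i t)
      with ((u (S (n + k)) i t - u (n + k)%nat i t) + (u (n + k)%nat i t - u n i t)) by ring.
    eapply Rle_trans; [apply Rabs_triang|]; rewrite pow_add in D; simpl; lra. }
assert (small : forall e, 0 < e -> exists N, forall n, (N <= n)%nat ->
   2 * (M * rho * (/ 2) ^ n) < e).
{ intros e He.
  destruct (pow_lt_1_zero (/ 2) (ltac:(rewrite Rabs_pos_eq; lra)) (e / (2 * (M * rho) + 1)))
    as [N HN]; [apply Rdiv_lt_0_compat; nra|].
  exists N; intros n Hn; specialize (HN n Hn); rewrite Rabs_pos_eq in HN by (apply pow_le; lra).
  apply Rlt_div_r in HN; [|nra]; assert (0 < (/ 2) ^ n) by (apply pow_lt; lra); nra. }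
assert (Hdk' : forall k n t, Rabs (t - t0) < rho -> forall i,
   Rabs (u (n + k)%nat i t - u n i t) <= 2 * (M * rho * (/ 2) ^ n)).
{ intros k n t Ht i; eapply Rle_trans; [now apply Hdk|].
  assert (0 < (/ 2) ^ k) by (apply pow_lt; lra).
  assert (0 <= (/ 2) ^ n) by (apply pow_le; lra).
  assert (P : 0 <= M * rho * (/ 2) ^ n) by (apply Rmult_le_pos; [nra | assumption]); nra. }
set (phi := fun i t => real (Lim_seq (fun n => u n i t))).
assert (Hlim : forall t, Rabs (t - t0) < rho -> forall i,
   is_lim_seq (fun n => u n i t) (phi i t)).
{ intros t Ht i; apply Lim_seq_correct'; apply ex_lim_seq_cauchy_corr; intros e.
  destruct (small (e / 2) (ltac:(destruct e; simpl; lra))) as [N HN]; exists N.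
  intros n m Hn Hm.
  pose proof (Hdk' (n - N)%nat N t Ht i) as D1; pose proof (Hdk' (m - N)%nat N t Ht i) as D2.
  replace (N + (n - N))%nat with n in D1 by lia; replace (N + (m - N))%nat with m in D2 by lia.
  specialize (HN N (le_n _)).
  replace (u n i t - u m i t) with ((u n i t - u N i t) - (u m i t - u N i t)) by ring.
  eapply Rle_lt_trans; [apply Rabs_triang|]; rewrite Rabs_Ropp; lra. }
assert (Htail : forall n t, Rabs (t - t0) < rho -> forall i,
   Rabs (phi i t - u n i t) <= 2 * (M * rho * (/ 2) ^ n)).
{ intros n t Ht i.
  assert (D : is_lim_seq (fun k => Rabs (u (k + n)%nat i t - u n i t)) (Rabs (phi i t - u n i t))).
  { apply (is_lim_seq_abs _ (Finite (phi i t - u n i t))).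
    apply is_lim_seq_minus'; [|apply is_lim_seq_const].
    apply (is_lim_seq_incr_n (fun k => u k i t)); now apply Hlim. }
  refine (is_lim_seq_le _ (fun _ => 2 * (M * rho * (/ 2) ^ n)) _ _ _ D (is_lim_seq_const _)).
  intros k; cbv beta; rewrite Nat.add_comm; now apply Hdk'. }
exists phi; split.
- intros i; unfold phi; rewrite (Lim_seq_ext _ (fun _ => c i)); [now rewrite Lim_seq_const|].
  intros n; apply picard_0.
- intros t Ht i; split.
  + apply is_derive_Reals.
    (* The sequence is shifted because iterate n + 1 has derivative [f] at iterate n; the Lipschitz
       condition makes these derivatives converge uniformly. *)
    apply (CVU_derivable (fun n => u (S n) i) (fun n s => f i s (fun j => u n j s)) (phi i)
      (fun s => f i s (fun j => phi j s)) t0 (mkposreal rho Hrho)).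
    * intros e He; destruct (small (e / (L + 1))) as [N HN]; [apply Rdiv_lt_0_compat; lra|].
      exists N; intros n s Hn Hs; specialize (HN n Hn).
      eapply Rle_lt_trans; [apply (Hlip s Hs); intros j; now apply Htail|].
      apply Rlt_div_r in HN; [|lra].
      assert (0 <= (/ 2) ^ n) by (apply pow_le; lra).
      assert (P : 0 <= M * rho * (/ 2) ^ n) by (apply Rmult_le_pos; [nra | assumption]); nra.
    * intros s Hs; apply is_lim_seq_Reals, (is_lim_seq_incr_1 (fun n => u n i s)).
      now apply Hlim.
    * intros n s Hs; apply is_derive_Reals; now apply Hc.
    * exact Ht.
  + pose proof (Htail O t Ht i) as D; simpl in D; unfold u in D; simpl in D; lra.
Qed.

Open Scope C_scope.

(* The pair (p, q) stands for the matrix [[p, q], [conj q, conj p]]. *)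
Definition pmul (u v : C * C) : C * C :=
  (fst u * fst v + snd u * Cconj (snd v), fst u * snd v + snd u * Cconj (fst v)).
Definition padd (u v : C * C) : C * C := (fst u + fst v, snd u + snd v).
Definition popp (u : C * C) : C * C := (- fst u, - snd u).
Definition pone : C * C := (RtoC 1, RtoC 0).
Definition padj (u : C * C) : C * C := (Cconj (fst u), - snd u).
Definition pscal (h : R) (u : C * C) : C * C := (RtoC h * fst u, RtoC h * snd u).
Definition pdet (u : C * C) : C := fst u * Cconj (fst u) - snd u * Cconj (snd u).

(** Real coordinates turn the matrix equation into a system for [picard_lindelof] and allow the real
    mean value theorem. *)
Definition comp (i : bool * bool) (u : C * C) : R :=
  let c := if fst i then fst u else snd u in if snd i then Re c else Im c.

Lemma comp_ext (u v : C * C) : (forall i, comp i u = comp i v) -> u = v.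
Proof.
intros H; apply injective_projections; apply injective_projections.
- exact (H (true, true)).
- exact (H (true, false)).
- exact (H (false, true)).
- exact (H (false, false)).
Qed.

Lemma pmul_assoc (u v w : C * C) : pmul u (pmul v w) = pmul (pmul u v) w.
Proof.
unfold pmul; apply injective_projections; simpl;
  rewrite !Cplus_conj, !Cmult_conj, ?Cconj_conj; ring.
Qed.

Lemma pmul_1_r (u : C * C) : pmul u pone = u.
Proof.
unfold pmul, pone; apply injective_projections; simpl; rewrite !RtoC_conj; ring.
Qed.

Lemma pmul_1_l (u : C * C) : pmul pone u = u.
Proof. unfold pmul, pone; apply injective_projections; simpl; ring. Qed.

Lemma pmul_padj (u : C * C) : pdet u = 1 -> pmul u (padj u) = pone.
Proof.
intros H; unfold pmul, padj, pone; apply injective_projections; simpl.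
- rewrite <- H; unfold pdet; rewrite Copp_conj; ring.
- rewrite Cconj_conj; ring.
Qed.

Lemma padj_pmul (u : C * C) : pdet u = 1 -> pmul (padj u) u = pone.
Proof.
intros H; unfold pmul, padj, pone; apply injective_projections; simpl.
- rewrite <- H; unfold pdet; ring.
- ring.
Qed.

Definition pderiv (u : R -> C * C) (t : R) (v : C * C) : Prop :=
  cderiv (fun s => fst (u s)) t (fst v) /\ cderiv (fun s => snd (u s)) t (snd v).

Lemma pderiv_comp (u : R -> C * C) (t : R) (v : C * C) :
  pderiv u t v <-> forall i, is_derive (fun s => comp i (u s)) t (comp i v).
Proof.
split.
- intros [[H1 H2] [H3 H4]] [[] []]; assumption.
- intros H; split; split.
  + exact (H (true, true)).
  + exact (H (true, false)).
  + exact (H (false, true)).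
  + exact (H (false, false)).
Qed.

Lemma pderiv_val (u : R -> C * C) (t : R) (v w : C * C) :
  pderiv u t v -> v = w -> pderiv u t w.
Proof. intros H <-; exact H. Qed.

Lemma pderiv_const (c : C * C) (t : R) : pderiv (fun _ => c) t (RtoC 0, RtoC 0).
Proof. split; apply cderiv_const. Qed.

Lemma pderiv_padd (u v : R -> C * C) (t : R) (du dv : C * C) :
  pderiv u t du -> pderiv v t dv -> pderiv (fun s => padd (u s) (v s)) t (padd du dv).
Proof. intros [H1 H2] [H3 H4]; split; now apply cderiv_plus. Qed.

Lemma pderiv_pmul (u v : R -> C * C) (t : R) (du dv : C * C) :
  pderiv u t du -> pderiv v t dv ->
  pderiv (fun s => pmul (u s) (v s)) t (padd (pmul du (v t)) (pmul (u t) dv)).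
Proof.
intros [H1 H2] [H3 H4]; split.
- eapply cderiv_val; [exact (cderiv_plus _ _ _ _ _ (cderiv_mult _ _ _ _ _ H1 H3)
    (cderiv_mult _ _ _ _ _ H2 (cderiv_conj _ _ _ H4)))|].
  simpl; ring.
- eapply cderiv_val; [exact (cderiv_plus _ _ _ _ _ (cderiv_mult _ _ _ _ _ H1 H4)
    (cderiv_mult _ _ _ _ _ H2 (cderiv_conj _ _ _ H3)))|].
  simpl; ring.
Qed.

Lemma pderiv_padj (u : R -> C * C) (t : R) (du : C * C) :
  pderiv u t du -> pderiv (fun s => padj (u s)) t (padj du).
Proof. intros [H1 H2]; split; [now apply cderiv_conj | now apply cderiv_opp]. Qed.

Open Scope R_scope.

Definition pbound (B : R) (u : C * C) : Prop := forall i, Rabs (comp i u) <= B.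

Lemma Rabs_mult_le (a b A B : R) : Rabs a <= A -> Rabs b <= B -> Rabs (a * b) <= A * B.
Proof.
intros H1 H2; rewrite Rabs_mult; apply Rmult_le_compat; try assumption; apply Rabs_pos.
Qed.

Definition comp_pmul (v w : bool * bool -> R) (i : bool * bool) : R :=
  match i with
  | (true, true) => v (true, true) * w (true, true) - v (true, false) * w (true, false)
      + (v (false, true) * w (false, true) + v (false, false) * w (false, false))
  | (true, false) => v (true, true) * w (true, false) + v (true, false) * w (true, true)
      + (v (false, false) * w (false, true) - v (false, true) * w (false, false))
  | (false, true) => v (true, true) * w (false, true) - v (true, false) * w (false, false)
      + (v (false, true) * w (true, true) + v (false, false) * w (true, false))
  | (false, false) => v (true, true) * w (false, false) + v (true, false) * w (false, true)
      + (v (false, false) * w (true, true) - v (false, true) * w (true, false))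
  end.

Lemma comp_pmulE (u v : C * C) (i : bool * bool) :
  comp i (pmul u v) = comp_pmul (fun j => comp j u) (fun j => comp j v) i.
Proof. destruct i as [[] []]; unfold comp, pmul, comp_pmul, Re, Im; simpl; ring. Qed.

(** Each coordinate of a product is a signed sum of four products of coordinates; this is the origin
    of the 4 in [linear_ode] and of the 16 in [flat_vertical]. *)
Lemma pbound_pmul (A B : R) (u v : C * C) :
  pbound A u -> pbound B v -> pbound (4 * (A * B)) (pmul u v).
Proof.
intros Hu Hv.
assert (Q : forall i j, Rabs (comp i u * comp j v) <= A * B)
  by (intros i j; now apply Rabs_mult_le).
assert (T : forall i1 j1 i2 j2 i3 j3 i4 j4,
  Rabs (comp i1 u * comp j1 v) <= A * B /\ Rabs (comp i2 u * comp j2 v) <= A * B /\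
  Rabs (comp i3 u * comp j3 v) <= A * B /\ Rabs (comp i4 u * comp j4 v) <= A * B)
  by (intros; repeat split; apply Q).
intros i; rewrite comp_pmulE; destruct i as [[] []]; unfold comp_pmul.
- destruct (T (true, true) (true, true) (true, false) (true, false)
    (false, true) (false, true) (false, false) (false, false)) as (T1 & T2 & T3 & T4).
  apply Rabs_le_between in T1, T2, T3, T4; apply Rabs_le; lra.
- destruct (T (true, true) (true, false) (true, false) (true, true)
    (false, false) (false, true) (false, true) (false, false)) as (T1 & T2 & T3 & T4).
  apply Rabs_le_between in T1, T2, T3, T4; apply Rabs_le; lra.
- destruct (T (true, true) (false, true) (true, false) (false, false)
    (false, true) (true, true) (false, false) (true, false)) as (T1 & T2 & T3 & T4).
  apply Rabs_le_between in T1, T2, T3, T4; apply Rabs_le; lra.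
- destruct (T (true, true) (false, false) (true, false) (false, true)
    (false, false) (true, true) (false, true) (true, false)) as (T1 & T2 & T3 & T4).
  apply Rabs_le_between in T1, T2, T3, T4; apply Rabs_le; lra.
Qed.

Lemma comp_padd (i : bool * bool) (u v : C * C) : comp i (padd u v) = comp i u + comp i v.
Proof. destruct i as [[] []]; reflexivity. Qed.

Lemma comp_popp (i : bool * bool) (u : C * C) : comp i (popp u) = - comp i u.
Proof. destruct i as [[] []]; reflexivity. Qed.

Lemma comp_pscal (i : bool * bool) (h : R) (u : C * C) : comp i (pscal h u) = h * comp i u.
Proof. destruct i as [[] []]; unfold comp, pscal, Re, Im; simpl; ring. Qed.

Lemma pbound_padd (A B : R) (u v : C * C) :
  pbound A u -> pbound B v -> pbound (A + B) (padd u v).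
Proof.
intros Hu Hv i; rewrite comp_padd; eapply Rle_trans; [apply Rabs_triang|].
specialize (Hu i); specialize (Hv i); lra.
Qed.

Lemma pbound_padj (B : R) (u : C * C) : pbound B u -> pbound B (padj u).
Proof.
intros H [[] []]; unfold comp, padj; simpl; rewrite ?Rabs_Ropp.
- exact (H (true, true)).
- exact (H (true, false)).
- exact (H (false, true)).
- exact (H (false, false)).
Qed.

Definition pofcomp (v : bool * bool -> R) : C * C :=
  ((v (true, true), v (true, false)), (v (false, true), v (false, false))).

Lemma comp_pofcomp (v : bool * bool -> R) (i : bool * bool) : comp i (pofcomp v) = v i.
Proof. destruct i as [[] []]; reflexivity. Qed.

Lemma continuous_comp_pmul (U : UniformSpace) (v w : U -> bool * bool -> R) (x : U) :
  (forall j, continuous (fun y => v y j) x) -> (forall j, continuous (fun y => w y j) x) ->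
  forall i, continuous (fun y => comp_pmul (v y) (w y) i) x.
Proof.
intros Hv Hw [[] []]; unfold comp_pmul;
repeat lazymatch goal with
  | |- continuous (fun y => @?f y + @?g y) _ => apply (@continuous_plus _ _ R_NormedModule f g)
  | |- continuous (fun y => @?f y - @?g y) _ => apply (@continuous_minus _ _ R_NormedModule f g)
  | |- continuous (fun y => @?f y * @?g y) _ => apply (@continuous_mult _ R_AbsRing f g)
  end; lazymatch goal with
  | |- continuous (fun y => v y ?j) _ => exact (Hv j)
  | |- continuous (fun y => w y ?j) _ => exact (Hw j)
  end.
Qed.

(** The right-hand side at [u0] is at most 4 B K and its Lipschitz constant is 4 K. The solution
    therefore moves by at most 2 (4 B K) rho <= B, which gives the bound 2 B. *)
Lemma linear_ode (M : R -> C * C) (t0 rho K B : R) (u0 : C * C) :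
  0 < rho -> 0 <= K -> 0 <= B -> rho * (4 * K) <= / 2 -> pbound B u0 ->
  (forall t, Rabs (t - t0) < rho -> pbound K (M t) /\ forall i, continuous (fun s => comp i (M s)) t) ->
  exists u : R -> C * C, u t0 = u0 /\
    forall t, Rabs (t - t0) < rho -> pderiv u t (pmul (u t) (M t)) /\ pbound (2 * B) (u t).
Proof.
intros Hrho HK HB HrK Hu0 HM.
destruct (picard_lindelof (fun i t v => comp i (pmul (pofcomp v) (M t))) t0 rho (4 * K) (4 * (B * K))
  (fun i => comp i u0)) as (phi & P0 & P1); try assumption; try nra.
- intros t Ht i; apply pbound_pmul; [|now apply HM].
  intros j; rewrite comp_pofcomp; apply Hu0.
- intros t Ht v w e He i.
  replace (comp i (pmul (pofcomp v) (M t)) - comp i (pmul (pofcomp w) (M t)))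
    with (comp i (pmul (pofcomp (fun j => v j - w j)) (M t))).
  + replace (4 * K * e) with (4 * (e * K)) by ring; apply pbound_pmul; [|now apply HM].
    intros j; rewrite comp_pofcomp; apply He.
  + rewrite !comp_pmulE; destruct i as [[] []]; unfold comp_pmul; cbv beta; rewrite !comp_pofcomp; ring.
- intros t Ht phi Hphi i.
  apply continuous_ext with
    (fun s => comp_pmul (fun j => phi j s) (fun j => comp j (M s)) i).
  + intros s; match goal with |- ?a = ?b => change (@eq R a b) end.
    rewrite comp_pmulE; destruct i as [[] []]; unfold comp_pmul; cbv beta; rewrite !comp_pofcomp; ring.
  + apply (continuous_comp_pmul _ (fun s j => phi j s) (fun s j => comp j (M s))); [exact Hphi|].
    now apply HM.
- exists (fun t => pofcomp (fun i => phi i t)); split.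
  + apply comp_ext; intros i; rewrite comp_pofcomp; apply P0.
  + intros t Ht; split.
    * apply pderiv_comp; intros i.
      apply is_derive_ext with (phi i); [intros s; now rewrite comp_pofcomp|].
      apply (P1 t Ht i).
    * intros i; rewrite comp_pofcomp; destruct (P1 t Ht i) as [_ P].
      pose proof (Hu0 i) as Q; replace (phi i t) with ((phi i t - comp i u0) + comp i u0) by ring.
      eapply Rle_trans; [apply Rabs_triang|]; nra.
Qed.

(** The condition on the diagonal entry says that the matrix of [M] has trace zero, so the
    determinant of a solution is constant. *)
Lemma ode_det (u M : R -> C * C) (t0 rho : R) :
  (forall t, Rabs (t - t0) < rho -> pderiv u t (pmul (u t) (M t)) /\
     Cconj (fst (M t)) = (- fst (M t))%C) ->
  forall t, Rabs (t - t0) < rho -> pdet (u t) = pdet (u t0).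
Proof.
intros H t Ht.
assert (HD : forall s, Rabs (s - t0) < rho -> cderiv (fun s => pdet (u s)) s 0).
{ intros s Hs; destruct (H s Hs) as [[H1 H2] HM]; unfold pdet.
  eapply cderiv_val; [exact (cderiv_plus _ _ _ _ _
    (cderiv_mult _ _ _ _ _ H1 (cderiv_conj _ _ _ H1))
    (cderiv_opp _ _ _ (cderiv_mult _ _ _ _ _ H2 (cderiv_conj _ _ _ H2))))|].
  unfold pmul; simpl; rewrite !Cplus_conj, !Cmult_conj, !Cconj_conj, HM; ring. }
apply injective_projections; apply Rminus_diag_uniq, Rabs_eq_0, Rle_antisym; try apply Rabs_pos.
- rewrite <- (Rmult_0_l (Rabs (t - t0))).
  apply (bounded_variation (fun s => Re (pdet (u s))) (fun _ => 0)).
  intros s Hs; split; [apply HD; lra | rewrite Rabs_R0; lra].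
- rewrite <- (Rmult_0_l (Rabs (t - t0))).
  apply (bounded_variation (fun s => Im (pdet (u s))) (fun _ => 0)).
  intros s Hs; split; [apply HD; lra | rewrite Rabs_R0; lra].
Qed.

(** * Local integration of flat su(1,1)-valued forms *)

(** The quotient-free form in which [flat_vertical] obtains the derivative from an error
    estimate. *)
Lemma is_derive_small (f : R -> R) (t l : R) :
  is_derive f t l <->
  forall e, 0 < e -> locally t (fun s => Rabs (f s - f t - (s - t) * l) <= e * Rabs (s - t)).
Proof.
rewrite is_derive_Reals; split.
- intros H e He; destruct (H e He) as [d Hd]; exists d; intros s Hs.
  destruct (Req_dec s t) as [-> | N]; [rewrite !Rminus_diag, Rmult_0_l, Rminus_diag, Rabs_R0; lra|].
  assert (N' : s - t <> 0) by lra.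
  specialize (Hd (s - t) N' Hs); rewrite Rplus_minus in Hd.
  replace (f s - f t - (s - t) * l) with (((f s - f t) / (s - t) - l) * (s - t)) by (field; lra).
  rewrite Rabs_mult; apply Rmult_le_compat_r; [apply Rabs_pos | lra].
- intros H e He; destruct (H (e / 2) (ltac:(lra))) as [d Hd]; exists d; intros h N Hh.
  assert (P := Rabs_pos_lt h N).
  assert (Q : ball t d (t + h)) by (change (Rabs (t + h - t) < d); now replace (t + h - t) with h by ring).
  specialize (Hd (t + h) Q); replace (t + h - t) with h in Hd by ring.
  replace ((f (t + h) - f t) / h - l) with ((f (t + h) - f t - h * l) / h) by (field; lra).
  unfold Rdiv at 1; rewrite Rabs_mult, Rabs_inv; apply Rlt_div_l; [exact P|].
  assert (0 < e * Rabs h) by (apply Rmult_lt_0_compat; assumption); lra.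
Qed.

Lemma locally_forall_comp (t : R) (P : bool * bool -> R -> Prop) :
  (forall i, locally t (P i)) -> locally t (fun s => forall i, P i s).
Proof.
intros H.
generalize (filter_and _ _ (filter_and _ _ (H (true, true)) (H (true, false)))
  (filter_and _ _ (H (false, true)) (H (false, false)))); apply filter_imp.
intros s [[H1 H2] [H3 H4]] [[] []]; assumption.
Qed.

Lemma pderiv_pscal (a : R) (v : C * C) (t : R) : pderiv (fun s => pscal (s - a) v) t v.
Proof.
apply pderiv_comp; intros i; apply is_derive_ext with (fun s => (s - a) * comp i v);
  [intros s; now rewrite comp_pscal|].
auto_derive; [exact I | ring].
Qed.

Lemma pderiv_pscal_l (h : R) (u : R -> C * C) (t : R) (du : C * C) :
  pderiv u t du -> pderiv (fun s => pscal h (u s)) t (pscal h du).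
Proof.
rewrite !pderiv_comp; intros H i; rewrite comp_pscal.
apply is_derive_ext with (fun s => h * comp i (u s)); [intros s; now rewrite comp_pscal|].
apply is_derive_scal, H.
Qed.

Lemma pair_variation (u du : R -> C * C) (D x y : R) :
  (forall t, Rabs (t - x) <= Rabs (y - x) -> pderiv u t (du t) /\ pbound D (du t)) ->
  pbound (D * Rabs (y - x)) (padd (u y) (popp (u x))).
Proof.
intros H i; rewrite comp_padd, comp_popp.
apply (bounded_variation (fun s => comp i (u s)) (fun s => comp i (du s))).
intros t Ht; destruct (H t Ht) as [H1 H2]; split; [|apply H2].
now apply (proj1 (pderiv_comp u t (du t))).
Qed.

Lemma pbound_pscal (h B : R) (u : C * C) : pbound B u -> pbound (Rabs h * B) (pscal h u).
Proof.
intros H i; rewrite comp_pscal, Rabs_mult; apply Rmult_le_compat_l; [apply Rabs_pos | apply H].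
Qed.

Lemma pbound_popp (B : R) (u : C * C) : pbound B u -> pbound B (popp u).
Proof. intros H i; rewrite comp_popp, Rabs_Ropp; apply H. Qed.

Lemma pbound_le (A B : R) (u : C * C) : A <= B -> pbound A u -> pbound B u.
Proof. intros HA H i; eapply Rle_trans; [apply H | exact HA]. Qed.

(* Compare [F(., y')] with the approximate solution [F(., y) (1 + h Y)], [h = y' - y]: by flatness the
   defect [W] of the latter moves by O(h^2) only along the horizontal line. *)
Lemma flat_vertical (F X Y Xy Yx : C -> C * C) (x0 y0 rho K B : R) :
  0 < rho -> 0 <= K -> 0 <= B ->
  (forall x y, Rabs (x - x0) < rho -> Rabs (y - y0) < rho ->
    pderiv (fun s => F (s, y)) x (pmul (F (x, y)) (X (x, y))) /\
    pderiv (fun s => F (x0, s)) y (pmul (F (x0, y)) (Y (x0, y))) /\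
    pbound B (F (x, y)) /\ pdet (F (x, y)) = RtoC 1 /\
    pderiv (fun s => Y (s, y)) x (Yx (x, y)) /\ pbound K (Y (x, y)) /\
    Cconj (fst (X (x, y))) = (- fst (X (x, y)))%C /\
    Cconj (fst (Y (x, y))) = (- fst (Y (x, y)))%C /\
    Yx (x, y) = padd (padd (pmul (Y (x, y)) (X (x, y))) (Xy (x, y)))
                     (popp (pmul (X (x, y)) (Y (x, y))))) ->
  (forall x y y', Rabs (x - x0) < rho -> Rabs (y - y0) < rho -> Rabs (y' - y0) < rho ->
    let d := padd (X (x, y')) (popp (X (x, y))) in
    pbound (K * Rabs (y' - y)) d /\
    pbound (K * (y' - y) ^ 2) (padd d (popp (pscal (y' - y) (Xy (x, y)))))) ->
  forall x y, Rabs (x - x0) < rho -> Rabs (y - y0) < rho ->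
  pderiv (fun s => F (x, s)) y (pmul (F (x, y)) (Y (x, y))).
Proof.
intros Hrho HK HB H1 H2 x y Hx Hy.
assert (Hx0 : Rabs (x0 - x0) < rho) by (rewrite Rminus_diag, Rabs_R0; exact Hrho).
set (W := fun y' s => pmul (pmul (F (s, y)) (padd pone (pscal (y' - y) (Y (s, y))))) (padj (F (s, y')))).
(* The s-derivative of [W] is a triple product with two factors bounded by [B] and a middle one
   bounded by (K + 4 K^2) h^2; two uses of [pbound_pmul] give 16, and [rho] bounds the length of the
   path. *)
set (N := 16 * (B * B) * (K + 4 * (K * K)) * rho).
assert (HN : 0 <= N) by (unfold N; assert (0 <= B * B) by nra; assert (0 <= K + 4 * (K * K)) by nra;
  repeat apply Rmult_le_pos; lra).
assert (HW : forall y', Rabs (y' - y0) < rho ->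
   pbound (N * (y' - y) ^ 2) (padd (W y' x) (popp (W y' x0)))).
{ intros y' Hy'.
  set (h := y' - y).
  set (D := (K + 4 * (K * K)) * h ^ 2).
  (* Let X' and F' be the values at height y'. Differentiating [W] in s gives F Rm F'^{-1} with Rm =
     - (X' - X - h X_y) - h Y (X' - X): flatness has replaced Y_x, and both remaining terms are
     O(h^2). *)
  set (Rm := fun s => padd (popp (padd (padd (X (s, y')) (popp (X (s, y)))) (popp (pscal h (Xy (s, y))))))
     (popp (pmul (pscal h (Y (s, y))) (padd (X (s, y')) (popp (X (s, y))))))).
  apply pbound_le with (16 * (B * B) * D * Rabs (x - x0)).
  { replace (16 * (B * B) * D * Rabs (x - x0))
      with (16 * (B * B) * (K + 4 * (K * K)) * (h ^ 2 * Rabs (x - x0))) by (unfold D; ring).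
    replace (N * h ^ 2) with (16 * (B * B) * (K + 4 * (K * K)) * (h ^ 2 * rho))
      by (unfold N; ring).
    apply Rmult_le_compat_l; [nra|]; apply Rmult_le_compat_l; [apply pow2_ge_0 | lra]. }
  apply (pair_variation (W y') (fun s => pmul (pmul (F (s, y)) (Rm s)) (padj (F (s, y'))))).
  intros s Hs; assert (Hs' : Rabs (s - x0) < rho) by lra.
  destruct (H1 s y Hs' Hy) as (Fx & _ & FB & _ & YX & YB & _ & _ & flat).
  destruct (H1 s y' Hs' Hy') as (Fx' & _ & FB' & _ & _ & _ & anti & _ & _).
  destruct (H2 s y y' Hs' Hy Hy') as [d1 d2].
  split.
  - eapply pderiv_val.
    + apply pderiv_pmul; [|apply pderiv_padj, Fx'].
      apply pderiv_pmul; [exact Fx|]; apply pderiv_padd; [apply pderiv_const|].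
      apply pderiv_pscal_l, YX.
    + cbv beta; rewrite flat; unfold Rm, W; fold h.
      destruct (F (s, y)) as [f1 f2], (F (s, y')) as [g1 g2], (X (s, y)) as [a1 a2],
        (X (s, y')) as [b1 b2], (Y (s, y)) as [c1 c2], (Xy (s, y)) as [e1 e2].
      simpl in anti; unfold pmul, padd, popp, padj, pscal, pone; simpl.
      apply injective_projections; simpl;
        repeat (rewrite Cplus_conj || rewrite Cmult_conj || rewrite Copp_conj || rewrite Cconj_conj
          || rewrite RtoC_conj); rewrite anti; ring.
  - replace (16 * (B * B) * D) with (4 * ((4 * (B * D)) * B)) by ring.
    apply pbound_pmul; [|now apply pbound_padj].
    apply pbound_pmul; [exact FB|].
    apply pbound_le with (K * h ^ 2 + 4 * ((Rabs h * K) * (K * Rabs h))).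
    + unfold D; rewrite <- (pow2_abs h); right; ring.
    + apply pbound_padd; [apply pbound_popp, d2 |].
      apply pbound_popp, pbound_pmul; [apply pbound_pscal, YB | apply d1]. }
(* On the line x = x0 the vertical equation holds by assumption, so [W] differs from 1 there by o(h)
   only. *)
assert (HW0 : forall e, 0 < e -> locally y (fun y' => forall i,
   Rabs (comp i (padd pone (popp (W y' x0)))) <= e * Rabs (y' - y))).
{ intros e He; apply locally_forall_comp; intros i.
  destruct (H1 x0 y Hx0 Hy) as (_ & Fy & _ & Fdet & _ & _ & _ & anti & _).
  assert (HD : pderiv (fun y' => W y' x0) y (RtoC 0, RtoC 0)).
  { eapply pderiv_val.
    - apply pderiv_pmul; [|apply pderiv_padj, Fy].
      apply pderiv_pmul; [apply pderiv_const|]; apply pderiv_padd; [apply pderiv_const|].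
      apply pderiv_pscal.
    - cbv beta; rewrite Rminus_diag; clear Fdet.
      destruct (F (x0, y)) as [f1 f2], (Y (x0, y)) as [c1 c2]; simpl in anti.
      unfold pmul, padd, popp, padj, pscal, pone; simpl.
      apply injective_projections; simpl;
        repeat (rewrite Cplus_conj || rewrite Cmult_conj || rewrite Copp_conj || rewrite Cconj_conj
          || rewrite RtoC_conj); rewrite anti; ring. }
  assert (HD' := proj1 (is_derive_small _ _ _) (proj1 (pderiv_comp _ _ _) HD i) e He).
  revert HD'; apply filter_imp; intros y' Hy'; rewrite comp_padd, comp_popp.
  replace (comp i pone) with (comp i (W y x0)).
  - replace (comp i (W y x0) + - comp i (W y' x0))
      with (- (comp i (W y' x0) - comp i (W y x0) - (y' - y) * comp i (RtoC 0, RtoC 0)))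
      by (destruct i as [[] []]; unfold comp; simpl; ring).
    rewrite Rabs_Ropp; exact Hy'.
  - f_equal; rewrite <- (pmul_padj _ Fdet); unfold W; f_equal; rewrite Rminus_diag.
    rewrite <- (pmul_1_r (F (x0, y))) at 2; f_equal.
    unfold padd, pone, pscal; apply injective_projections; simpl; ring. }
apply pderiv_comp; intros i; apply is_derive_small; intros e He.
(* The final error is 4 (2 k |h| B) = 8 B k |h|. One [k] bounds the defect at x0; the other bounds
   its transport N h^2, hence the restriction |h| < k / (N + 1). Adding 1 keeps the denominators
   positive. *)
set (k := e / (8 * B + 1)).
assert (Hk : 0 < k) by (apply Rdiv_lt_0_compat; lra).
assert (Hke : 8 * B * k <= e).
{ unfold k; apply Rmult_le_reg_r with (8 * B + 1); [lra|].
  replace (8 * B * (e / (8 * B + 1)) * (8 * B + 1)) with (8 * B * e) by (field; lra); nra. }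
assert (HNs : 0 < k / (N + 1)) by (apply Rdiv_lt_0_compat; lra).
enough (key : forall y' : R, (forall i, Rabs (comp i (padd pone (popp (W y' x0)))) <= k * Rabs (y' - y)) ->
    Rabs (y' - y0) < rho -> Rabs (y' - y) < k / (N + 1) ->
    Rabs (comp i (F (x, y')) - comp i (F (x, y)) - (y' - y) * comp i (pmul (F (x, y)) (Y (x, y))))
    <= e * Rabs (y' - y)).
{ generalize (filter_and _ _ (HW0 k Hk) (filter_and _ _ (near_open _ _ _ Hy)
    (locally_ball y (mkposreal _ HNs)))).
  apply filter_imp; intros y' (Hy0 & Hy' & Hb); now apply key. }
intros y' Hy0 Hy' Hb.
destruct (H1 x y' Hx Hy') as (_ & _ & FB' & Fdet' & _).
(* The error of the approximate solution is (1 - W) F', and 1 - W at x is split into its value at x0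
   and the change along the horizontal line. *)
assert (E : padd (F (x, y')) (popp (padd (F (x, y)) (pscal (y' - y) (pmul (F (x, y)) (Y (x, y))))))
  = pmul (padd (padd pone (popp (W y' x0))) (popp (padd (W y' x) (popp (W y' x0))))) (F (x, y'))).
{ assert (EW : pmul (W y' x) (F (x, y'))
    = padd (F (x, y)) (pscal (y' - y) (pmul (F (x, y)) (Y (x, y))))).
  { unfold W; rewrite <- (pmul_assoc _ (padj _)), (padj_pmul _ Fdet'), pmul_1_r.
    unfold pmul, padd, pscal, pone; apply injective_projections; simpl;
      rewrite ?Cplus_conj, ?Cmult_conj, ?RtoC_conj; ring. }
  rewrite <- EW; unfold pmul, padd, popp, pone; apply injective_projections; simpl; ring. }
assert (Hbd : pbound (4 * ((2 * k * Rabs (y' - y)) * B))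
  (padd (F (x, y')) (popp (padd (F (x, y)) (pscal (y' - y) (pmul (F (x, y)) (Y (x, y)))))))).
{ rewrite E; apply pbound_pmul; [|exact FB'].
  apply pbound_le with (k * Rabs (y' - y) + N * (y' - y) ^ 2).
  - rewrite <- (pow2_abs (y' - y)); assert (Q := Rabs_pos (y' - y)).
    apply Rlt_div_r in Hb; [|lra].
    assert (N * Rabs (y' - y) <= k) by nra; simpl; nra.
  - apply pbound_padd; [exact Hy0 | apply pbound_popp, HW, Hy']. }
specialize (Hbd i); rewrite comp_padd, comp_popp, comp_padd, comp_pscal in Hbd.
replace (comp i (F (x, y')) - comp i (F (x, y)) - (y' - y) * comp i (pmul (F (x, y)) (Y (x, y))))
  with (comp i (F (x, y')) + - (comp i (F (x, y)) + (y' - y) * comp i (pmul (F (x, y)) (Y (x, y)))))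
  by ring.
eapply Rle_trans; [exact Hbd|].
replace (4 * (2 * k * Rabs (y' - y) * B)) with (8 * B * k * Rabs (y' - y)) by ring.
apply Rmult_le_compat_r; [apply Rabs_pos | exact Hke].
Qed.

Lemma Ck_comp_pmul (k : nat) (Omega : C -> Prop) (u v : C -> C * C) :
  open Omega -> (forall i, class_Ck k Omega (fun z => comp i (u z))) ->
  (forall i, class_Ck k Omega (fun z => comp i (v z))) ->
  forall i, class_Ck k Omega (fun z => comp i (pmul (u z) (v z))).
Proof.
intros HO Hu Hv i.
apply Ck_ext with (fun z => comp_pmul (fun j => comp j (u z)) (fun j => comp j (v z)) i);
  [exact HO | intros z _; symmetry; apply comp_pmulE|].
assert (Q : forall j l, class_Ck k Omega (fun z => comp j (u z) * comp l (v z)))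
  by (intros; now apply Ck_mult).
assert (Qm : forall j l, class_Ck k Omega (fun z => - (comp j (u z) * comp l (v z))))
  by (intros; now apply Ck_opp).
destruct i as [[] []]; unfold comp_pmul;
  repeat lazymatch goal with
  | |- class_Ck _ _ (fun z => @?f z - @?g z) => apply (Ck_plus k Omega f (fun z => - g z) HO)
  | |- class_Ck _ _ (fun z => @?f z + @?g z) => apply (Ck_plus k Omega f g HO)
  | |- class_Ck _ _ (fun z => - @?f z) => apply Qm
  | |- _ => apply Q
  end.
Qed.

Definition pdy (u : C -> C * C) (z : C) : C * C :=
  pofcomp (fun i => partial_y (fun w => comp i (u w)) z).
Definition pdx (u : C -> C * C) (z : C) : C * C :=
  pofcomp (fun i => partial_x (fun w => comp i (u w)) z).

Definition psmooth (Omega : C -> Prop) (u : C -> C * C) : Prop :=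
  forall i, smooth Omega (fun z => comp i (u z)).

Lemma psmooth_pdy (Omega : C -> Prop) (u : C -> C * C) :
  open Omega -> psmooth Omega u -> psmooth Omega (pdy u).
Proof.
intros HO H i k; apply Ck_ext with (partial_y (fun w => comp i (u w))); [exact HO | |].
- intros z _; unfold pdy; now rewrite comp_pofcomp.
- exact (smooth_partial_y _ _ (H i) k).
Qed.

Lemma psmooth_dx (Omega : C -> Prop) (u : C -> C * C) (x y : R) :
  psmooth Omega u -> Omega (x, y) -> pderiv (fun s => u (s, y)) x (pdx u (x, y)).
Proof.
intros H Hz; apply pderiv_comp; intros i; unfold pdx; rewrite comp_pofcomp.
exact (Ck_dx 0 Omega (fun w => comp i (u w)) (x, y) (H i 1%nat) Hz).
Qed.

Lemma psmooth_dy (Omega : C -> Prop) (u : C -> C * C) (x y : R) :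
  psmooth Omega u -> Omega (x, y) -> pderiv (fun s => u (x, s)) y (pdy u (x, y)).
Proof.
intros H Hz; apply pderiv_comp; intros i; unfold pdy; rewrite comp_pofcomp.
exact (Ck_dy 0 Omega (fun w => comp i (u w)) (x, y) (H i 1%nat) Hz).
Qed.

Lemma pderiv_ext_loc (u v : R -> C * C) (t : R) (l : C * C) :
  locally t (fun s => u s = v s) -> pderiv u t l -> pderiv v t l.
Proof.
intros E [H1 H2]; split; (eapply cderiv_ext_loc; [|eassumption]);
  revert E; apply filter_imp; intros s ->; reflexivity.
Qed.

Lemma pbound_locally (Omega : C -> Prop) (u : C -> C * C) (c : C) :
  psmooth Omega u -> Omega c ->
  exists K, 0 <= K /\ locally c (fun z => pbound K (u z)).
Proof.
intros H Hc.
assert (Q : forall i, locally c (fun z => Rabs (comp i (u z)) <= Rabs (comp i (u c)) + 1)).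
{ intros i.
  assert (Hi := Ck_cont 0 Omega _ c (H i 0%nat) Hc).
  generalize (Hi _ (locally_ball (comp i (u c)) (mkposreal 1 Rlt_0_1))).
  unfold filtermap; apply filter_imp; intros z Hz.
  change (Rabs (comp i (u z) - comp i (u c)) < 1) in Hz.
  replace (comp i (u z)) with ((comp i (u z) - comp i (u c)) + comp i (u c)) by ring.
  eapply Rle_trans; [apply Rabs_triang | lra]. }
set (m := fun i => Rabs (comp i (u c)) + 1).
assert (Hm : forall i, 0 <= m i) by (intros i; unfold m; pose proof (Rabs_pos (comp i (u c))); lra).
exists (m (true, true) + m (true, false) + (m (false, true) + m (false, false))).
split; [pose proof (Hm (true, true)); pose proof (Hm (true, false));
  pose proof (Hm (false, true)); pose proof (Hm (false, false)); lra|].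
generalize (filter_and _ _ (filter_and _ _ (Q (true, true)) (Q (true, false)))
  (filter_and _ _ (Q (false, true)) (Q (false, false)))); apply filter_imp.
intros z [[H1 H2] [H3 H4]] i.
pose proof (Hm (true, true)); pose proof (Hm (true, false));
  pose proof (Hm (false, true)); pose proof (Hm (false, false)).
destruct i as [[] []]; eapply Rle_trans; try eassumption; unfold m in *; lra.
Qed.

(** [class_Ck] demands joint continuity, which separate differentiability does not give. With
    bounded partial derivatives it follows from the mean value theorem along a horizontal and a
    vertical segment. *)
Lemma continuous_of_partials (c : C) (rho : posreal) (u ux uy : C -> R) (D : R) :
  (forall z, ball c rho z -> is_derive (fun s => u (s, Im z)) (Re z) (ux z) /\
     is_derive (fun s => u (Re z, s)) (Im z) (uy z) /\ Rabs (ux z) <= D /\ Rabs (uy z) <= D) ->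
  forall z, ball c rho z -> continuous u z.
Proof.
intros H z Hz.
assert (HD : 0 <= D)
  by (destruct (H z Hz) as (_ & _ & Q & _); eapply Rle_trans; [apply Rabs_pos | exact Q]).
destruct (proj1 (ball_C _ _ _) Hz) as [Hx Hy].
intros P [e He].
assert (Hd : 0 < Rmin (Rmin (rho - Rabs (Re z - Re c)) (rho - Rabs (Im z - Im c))) (e / (2 * D + 1))).
{ repeat apply Rmin_glb_lt; try lra; apply Rdiv_lt_0_compat; [apply cond_pos | lra]. }
exists (mkposreal _ Hd); intros w Hw; destruct (proj1 (ball_C _ _ _) Hw) as [Wx Wy].
simpl in Wx, Wy; apply He.
assert (L1 := Rle_trans _ _ _ (Rmin_l (Rmin (rho - Rabs (Re z - Re c)) (rho - Rabs (Im z - Im c)))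
  (e / (2 * D + 1))) (Rmin_l _ _)).
assert (L2 := Rle_trans _ _ _ (Rmin_l (Rmin (rho - Rabs (Re z - Re c)) (rho - Rabs (Im z - Im c)))
  (e / (2 * D + 1))) (Rmin_r _ _)).
assert (L3 := Rmin_r (Rmin (rho - Rabs (Re z - Re c)) (rho - Rabs (Im z - Im c))) (e / (2 * D + 1))).
assert (near : forall a b r t : R, Rabs (t - a) < r - Rabs (a - b) -> Rabs (t - b) < r).
{ intros a b r t Q; replace (t - b) with ((t - a) + (a - b)) by ring.
  eapply Rle_lt_trans; [apply Rabs_triang | lra]. }
destruct z as [zx zy], w as [wx wy], c as [cx cy]; simpl in *.
assert (V1 : Rabs (u (wx, wy) - u (zx, wy)) <= D * Rabs (wx - zx)).
{ apply (bounded_variation (fun s => u (s, wy)) (fun s => ux (s, wy))).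
  intros t Ht; assert (B : ball (cx, cy) rho (t, wy))
    by (apply ball_C; split; simpl; [apply (near zx) | apply (near zy)]; lra).
  destruct (H (t, wy) B) as (Q1 & _ & Q2 & _); now split. }
assert (V2 : Rabs (u (zx, wy) - u (zx, zy)) <= D * Rabs (wy - zy)).
{ apply (bounded_variation (fun s => u (zx, s)) (fun s => uy (zx, s))).
  intros t Ht; assert (B : ball (cx, cy) rho (zx, t))
    by (apply ball_C; split; simpl; [lra | apply (near zy); lra]).
  destruct (H (zx, t) B) as (_ & Q1 & _ & Q2); now split. }
change (Rabs (u (wx, wy) - u (zx, zy)) < e).
replace (u (wx, wy) - u (zx, zy)) with ((u (wx, wy) - u (zx, wy)) + (u (zx, wy) - u (zx, zy))) by ring.
eapply Rle_lt_trans; [apply Rabs_triang|].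
assert (Wx' : Rabs (wx - zx) < e / (2 * D + 1)) by lra.
assert (Wy' : Rabs (wy - zy) < e / (2 * D + 1)) by lra.
apply Rlt_div_r in Wx'; [|lra]; apply Rlt_div_r in Wy'; [|lra].
pose proof (Rabs_pos (wx - zx)); pose proof (Rabs_pos (wy - zy)); nra.
Qed.

Lemma open_ball_C (c : C) (r : posreal) : open (ball c r).
Proof.
intros z Hz; destruct (proj1 (ball_C _ _ _) Hz) as [Hx Hy].
assert (Hd : 0 < Rmin (r - Rabs (Re z - Re c)) (r - Rabs (Im z - Im c)))
  by (apply Rmin_glb_lt; lra).
exists (mkposreal _ Hd); intros w Hw; destruct (proj1 (ball_C _ _ _) Hw) as [Wx Wy]; simpl in Wx, Wy.
assert (L1 := Rmin_l (r - Rabs (Re z - Re c)) (r - Rabs (Im z - Im c))).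
assert (L2 := Rmin_r (r - Rabs (Re z - Re c)) (r - Rabs (Im z - Im c))).
apply ball_C; split.
- replace (Re w - Re c) with ((Re w - Re z) + (Re z - Re c)) by ring.
  eapply Rle_lt_trans; [apply Rabs_triang | lra].
- replace (Im w - Im c) with ((Im w - Im z) + (Im z - Im c)) by ring.
  eapply Rle_lt_trans; [apply Rabs_triang | lra].
Qed.

Lemma local_frobenius (Omega : C -> Prop) (X Y : C -> C * C) (c : C) :
  open Omega -> Omega c -> psmooth Omega X -> psmooth Omega Y ->
  (forall z, Omega z -> Cconj (fst (X z)) = (- fst (X z))%C /\ Cconj (fst (Y z)) = (- fst (Y z))%C) ->
  (forall z, Omega z -> pdx Y z = padd (padd (pmul (Y z) (X z)) (pdy X z)) (popp (pmul (X z) (Y z)))) ->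
  exists (rho : posreal) (F : C -> C * C),
    (forall z, ball c rho z -> Omega z) /\ F c = pone /\ psmooth (ball c rho) F /\
    forall z, ball c rho z ->
      pderiv (fun s => F (s, Im z)) (Re z) (pmul (F z) (X z)) /\
      pderiv (fun s => F (Re z, s)) (Im z) (pmul (F z) (Y z)) /\ pdet (F z) = RtoC 1.
Proof.
intros HO Hc SX SY anti flat.
destruct c as [x0 y0].
assert (SXy := psmooth_pdy _ _ HO SX); assert (SXyy := psmooth_pdy _ _ HO SXy).
destruct (pbound_locally Omega X _ SX Hc) as (K1 & P1 & B1).
destruct (pbound_locally Omega Y _ SY Hc) as (K2 & P2 & B2).
destruct (pbound_locally Omega (pdy X) _ SXy Hc) as (K3 & P3 & B3).
destruct (pbound_locally Omega (pdy (pdy X)) _ SXyy Hc) as (K4 & P4 & B4).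
set (K := K1 + K2 + K3 + K4).
assert (HK : 0 <= K) by (unfold K; lra).
destruct (filter_and _ _ (HO _ Hc) (filter_and _ _ (filter_and _ _ B1 B2) (filter_and _ _ B3 B4)))
  as [r0 Hr0].
assert (HB : forall x y, Rabs (x - x0) < r0 -> Rabs (y - y0) < r0 -> Omega (x, y) /\
  pbound K (X (x, y)) /\ pbound K (Y (x, y)) /\ pbound K (pdy X (x, y)) /\
  pbound K (pdy (pdy X) (x, y))).
{ intros x y Hx Hy; destruct (Hr0 (x, y)) as (Q & (Q1 & Q2) & Q3 & Q4).
  - apply ball_C; now split.
  - repeat split; [exact Q | | | |]; (eapply pbound_le; [|eassumption]); unfold K; lra. }
clear Hr0 B1 B2 B3 B4.
(* Mean value estimates between heights y and y' use every t with |t - y| <= |y' - y| < 2 rho, which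
   stays within 3 rho <= r0 of y0. The other term ensures rho (4 K) <= 1/2 for [linear_ode]. *)
assert (Hrho : 0 < Rmin (r0 / 3) (/ (8 * K + 8))).
{ apply Rmin_glb_lt; [destruct r0; simpl; lra | apply Rinv_0_lt_compat; lra]. }
set (rho := Rmin (r0 / 3) (/ (8 * K + 8))) in *.
assert (Hr3 : rho <= r0 / 3) by apply Rmin_l.
assert (HrK : rho * (4 * K) <= / 2).
{ assert (Q : rho <= / (8 * K + 8)) by apply Rmin_r.
  apply Rle_trans with (/ (8 * K + 8) * (4 * K)); [apply Rmult_le_compat_r; lra|].
  apply Rmult_le_reg_l with (8 * K + 8); [lra|].
  rewrite <- Rmult_assoc, Rinv_r by lra; lra. }
assert (Hr0 := cond_pos r0).
assert (contX : forall x y, Rabs (x - x0) < r0 -> Rabs (y - y0) < r0 ->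
  forall i, continuous (fun s => comp i (X (s, y))) x).
{ intros x y Hx Hy i; apply (@ex_derive_continuous R_AbsRing R_NormedModule); eexists.
  apply (Ck_dx 0 Omega (fun w => comp i (X w)) (x, y) (SX i 1%nat)); now apply HB. }
assert (contY : forall x y, Rabs (x - x0) < r0 -> Rabs (y - y0) < r0 ->
  forall i, continuous (fun s => comp i (Y (x, s))) y).
{ intros x y Hx Hy i; apply (@ex_derive_continuous R_AbsRing R_NormedModule); eexists.
  apply (Ck_dy 0 Omega (fun w => comp i (Y w)) (x, y) (SY i 1%nat)); now apply HB. }
assert (Hx0 : Rabs (x0 - x0) < r0) by (rewrite Rminus_diag, Rabs_R0; lra).
assert (Hy0 : Rabs (y0 - y0) < r0) by (rewrite Rminus_diag, Rabs_R0; lra).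
(* Each integration doubles the bound: 1 for the initial value, 2 on the vertical line, 4 on the
   horizontal ones. *)
destruct (linear_ode (fun t => Y (x0, t)) y0 rho K 1 pone) as (F0 & F00 & HF0); try assumption; try lra.
{ intros [[] []]; unfold comp, pone; simpl; rewrite ?Rabs_R0, ?Rabs_R1; lra. }
{ intros t Ht; split; [apply HB | apply contY]; lra. }
assert (ex2 : forall y, exists u : R -> C * C, Rabs (y - y0) < rho -> u x0 = F0 y /\
  forall t, Rabs (t - x0) < rho -> pderiv u t (pmul (u t) (X (t, y))) /\ pbound 4 (u t)).
{ intros y; destruct (Rlt_dec (Rabs (y - y0)) rho) as [Hy | Hy];
    [|exists (fun _ => pone); intros; contradiction].
  destruct (linear_ode (fun t => X (t, y)) x0 rho K 2 (F0 y)) as (u & u0 & Hu); try assumption; try lra.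
  - replace 2 with (2 * 1) by ring; now apply HF0.
  - intros t Ht; split; [apply HB | apply contX]; lra.
  - exists u; intros _; split; [exact u0|]; intros t Ht; destruct (Hu t Ht) as [Q1 Q2].
    split; [exact Q1|]; eapply pbound_le; [|exact Q2]; lra. }
(* The horizontal solutions are chosen independently for each height and are linked only through
   their initial values [F0 y]; [flat_vertical] provides the missing regularity in y. *)
destruct (choice _ ex2) as [G HG].
set (F := fun z : C => G (Im z) (Re z)).
assert (det0 : forall y, Rabs (y - y0) < rho -> pdet (F0 y) = RtoC 1).
{ intros y Hy; rewrite (ode_det F0 (fun t => Y (x0, t)) y0 rho); [| |exact Hy].
  - rewrite F00; unfold pdet, pone; simpl; rewrite !RtoC_conj; ring.
  - intros t Ht; split; [now apply HF0 | apply anti, HB; lra]. }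
assert (det : forall x y, Rabs (x - x0) < rho -> Rabs (y - y0) < rho -> pdet (F (x, y)) = RtoC 1).
{ intros x y Hx Hy; destruct (HG y Hy) as [G0 G1]; unfold F; simpl.
  rewrite (ode_det (G y) (fun t => X (t, y)) x0 rho); [| |exact Hx].
  - rewrite G0; now apply det0.
  - intros t Ht; split; [now apply G1 | apply anti, HB; lra]. }
assert (Fy0 : forall y, Rabs (y - y0) < rho ->
   pderiv (fun s => F (x0, s)) y (pmul (F (x0, y)) (Y (x0, y)))).
{ intros y Hy; apply pderiv_ext_loc with F0.
  - generalize (near_open _ _ _ Hy); apply filter_imp; intros s Hs.
    symmetry; exact (proj1 (HG s Hs)).
  - replace (F (x0, y)) with (F0 y) by (symmetry; exact (proj1 (HG y Hy))); now apply HF0. }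
assert (Fy : forall x y, Rabs (x - x0) < rho -> Rabs (y - y0) < rho ->
   pderiv (fun s => F (x, s)) y (pmul (F (x, y)) (Y (x, y)))).
{ apply (flat_vertical F X Y (pdy X) (pdx Y) x0 y0 rho K 4); try assumption; try lra.
  - intros x y Hx Hy; assert (Q := HB x y (ltac:(lra)) (ltac:(lra))).
    destruct Q as (HOz & _ & QY & _); destruct (HG y Hy) as [_ G1].
    split; [exact (proj1 (G1 x Hx))|]; split; [now apply Fy0|].
    split; [exact (proj2 (G1 x Hx))|]; split; [now apply det|].
    split; [now apply psmooth_dx with Omega|]; split; [exact QY|].
    split; [now apply anti|]; split; [now apply anti | now apply flat].
  - intros x y y' Hx Hy Hy' d.
    assert (in3 : forall t, Rabs (t - y) <= Rabs (y' - y) -> Rabs (t - y0) < r0).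
    { intros t Ht; apply Rabs_def2 in Hy, Hy'; apply Rabs_le_between in Ht.
      assert (Rabs (y' - y) < 2 * rho) by (apply Rabs_def1; lra).
      apply Rabs_def1; lra. }
    assert (Xy1 : forall t, Rabs (t - y) <= Rabs (y' - y) ->
      pbound (K * Rabs (t - y)) (padd (pdy X (x, t)) (popp (pdy X (x, y))))).
    { intros t Ht; apply (pair_variation (fun s => pdy X (x, s)) (fun s => pdy (pdy X) (x, s))).
      intros s Hs; destruct (HB x s (ltac:(lra)) (in3 s (Rle_trans _ _ _ Hs Ht))) as (Q & _ & _ & _ & Q').
      split; [now apply psmooth_dy with Omega | exact Q']. }
    split.
    + apply (pair_variation (fun s => X (x, s)) (fun s => pdy X (x, s))).
      intros s Hs; destruct (HB x s (ltac:(lra)) (in3 s Hs)) as (Q & _ & _ & Q' & _).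
      split; [now apply psmooth_dy with Omega | exact Q'].
    (* The second-order Taylor remainder becomes the variation of X(x, s) - (s - y) X_y(x, y)
       between y and y', whose derivative X_y(x, s) - X_y(x, y) is bounded by [Xy1]. *)
    + replace (padd d (popp (pscal (y' - y) (pdy X (x, y)))))
        with (padd (padd (X (x, y')) (popp (pscal (y' - y) (pdy X (x, y)))))
          (popp (padd (X (x, y)) (popp (pscal (y - y) (pdy X (x, y))))))).
      2:{ apply comp_ext; intros i; unfold d.
          repeat (rewrite comp_padd || rewrite comp_popp || rewrite comp_pscal); ring. }
      replace (K * (y' - y) ^ 2) with (K * Rabs (y' - y) * Rabs (y' - y))
        by (rewrite <- (pow2_abs (y' - y)); ring).
      apply (pair_variation (fun s => padd (X (x, s)) (popp (pscal (s - y) (pdy X (x, y)))))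
        (fun s => padd (pdy X (x, s)) (popp (pdy X (x, y))))).
      intros s Hs; destruct (HB x s (ltac:(lra)) (in3 s Hs)) as (Q & _); split.
      * apply pderiv_padd; [now apply psmooth_dy with Omega|].
        apply pderiv_comp; intros i; apply is_derive_ext with (fun t => - comp i (pscal (t - y) (pdy X (x, y))));
          [intros t; now rewrite comp_popp|].
        rewrite comp_popp; apply (@is_derive_opp R_AbsRing R_NormedModule).
        exact (proj1 (pderiv_comp _ _ _) (pderiv_pscal y (pdy X (x, y)) s) i).
      * eapply pbound_le; [|exact (Xy1 s Hs)].
        apply Rmult_le_compat_l; lra. }
exists (mkposreal rho Hrho), F.
assert (inb : forall z : C, ball (x0, y0) rho z -> Rabs (Re z - x0) < rho /\ Rabs (Im z - y0) < rho)
  by (intros z Hz; exact (proj1 (ball_C _ _ _) Hz)).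
assert (DF : forall z : C, ball (x0, y0) rho z ->
      pderiv (fun s => F (s, Im z)) (Re z) (pmul (F z) (X z)) /\
      pderiv (fun s => F (Re z, s)) (Im z) (pmul (F z) (Y z)) /\ pdet (F z) = RtoC 1).
{ intros [x y] Hz; destruct (inb _ Hz) as [Hx Hy]; simpl in Hx, Hy.
  split; [exact (proj1 (proj2 (HG y Hy) x Hx))|]; split; [now apply Fy | now apply det]. }
assert (BO : forall z : C, ball (x0, y0) rho z -> Omega z).
{ intros [x y] Hz; destruct (inb _ Hz) as [Hx Hy]; simpl in Hx, Hy; apply HB; lra. }
split; [exact BO|]; split; [|split; [|exact DF]].
- assert (Q : Rabs (y0 - y0) < rho) by (rewrite Rminus_diag, Rabs_R0; exact Hrho).
  rewrite <- F00; exact (proj1 (HG y0 Q)).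
- assert (OB := open_ball_C (x0, y0) (mkposreal rho Hrho)).
  assert (CF : forall i z, ball (x0, y0) rho z -> continuous (fun w => comp i (F w)) z).
  { intros i z Hz.
    apply (continuous_of_partials (x0, y0) (mkposreal rho Hrho) (fun w => comp i (F w))
      (fun w => comp i (pmul (F w) (X w))) (fun w => comp i (pmul (F w) (Y w))) (4 * (4 * K)));
      [|exact Hz].
    intros w Hw; destruct (DF w Hw) as (D1 & D2 & _); destruct (inb w Hw) as [Hx Hy].
    destruct w as [x y]; simpl in Hx, Hy.
    destruct (HB x y (ltac:(lra)) (ltac:(lra))) as (_ & Q1 & Q2 & _).
    assert (QF := proj2 (proj2 (HG y Hy) x Hx)).
    split; [exact (proj1 (pderiv_comp _ _ _) D1 i)|].
    split; [exact (proj1 (pderiv_comp _ _ _) D2 i)|].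
    split; now apply pbound_pmul. }
  (* Bootstrapping: the partial derivatives of [F] are F X and F Y, so class k for [F] yields class
     k + 1. *)
  intros i k; revert i; induction k as [|k IH]; intros i.
  + split; [exact (CF i) | exact I].
  + apply Ck_succ with (fun w => comp i (pmul (F w) (X w))) (fun w => comp i (pmul (F w) (Y w)));
      [exact OB | exact (CF i) | | | |].
    * intros z Hz; destruct (DF z Hz) as (D1 & _ & _); exact (proj1 (pderiv_comp _ _ _) D1 i).
    * intros z Hz; destruct (DF z Hz) as (_ & D2 & _); exact (proj1 (pderiv_comp _ _ _) D2 i).
    * apply Ck_comp_pmul; [exact OB | exact IH|].
      intros j; apply Ck_subset with Omega; [exact BO | apply SX].
    * apply Ck_comp_pmul; [exact OB | exact IH|].
      intros j; apply Ck_subset with Omega; [exact BO | apply SY].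
Qed.

(** * Monodromy *)

Lemma gmul_inv_r (g : SL2tilde) : gmul g (ginv g) = gone.
Proof.
set (k := ginv g).
rewrite <- (gmul_1_l (gmul g k)), <- (gmul_inv_l k), <- gmul_assoc, (gmul_assoc k g k).
unfold k at 2; rewrite gmul_inv_l, gmul_1_l; reflexivity.
Qed.

Lemma gmul_1_r (g : SL2tilde) : gmul g gone = g.
Proof. rewrite <- (gmul_inv_l g), gmul_assoc, gmul_inv_r; apply gmul_1_l. Qed.

Lemma gmul_idem (g : SL2tilde) : gmul g g = g -> g = gone.
Proof.
intros H; rewrite <- (gmul_1_l g), <- (gmul_inv_l g), <- gmul_assoc, H; reflexivity.
Qed.

(** Connectedness of the interval in the form used with Lebesgue numbers; steps of length d / 2
    respect the strict inequality. *)
Lemma unit_induction (Q : R -> Prop) (d : R) :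
  0 < d -> Q 0 ->
  (forall s t, unit_interval s -> unit_interval t -> Rabs (s - t) < d -> Q s -> Q t) ->
  forall t, unit_interval t -> Q t.
Proof.
intros Hd Q0 step.
assert (H : forall n t, unit_interval t -> t <= INR n * (d / 2) -> Q t).
{ induction n as [|n IH]; intros t [Ht0 Ht1] Hn.
  - simpl in Hn; replace t with 0 by lra; exact Q0.
  - rewrite S_INR in Hn; destruct (Rle_dec t (d / 2)) as [Hs | Hs].
    + apply (step 0); try split; try lra; try exact Q0.
      rewrite Rminus_0_l, Rabs_Ropp, Rabs_pos_eq; lra.
    + apply (step (t - d / 2)); try split; try lra.
      * replace (t - d / 2 - t) with (- (d / 2)) by ring; rewrite Rabs_Ropp, Rabs_pos_eq; lra.
      * apply IH; [split; lra | lra]. }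
intros t Ht; destruct (INR_unbounded (1 / (d / 2))) as [n Hn].
apply (H n t Ht); destruct Ht; apply Rlt_div_l in Hn; lra.
Qed.

Lemma lebesgue_square (Omega : C -> Prop) (r : C -> posreal) (h : R * R -> C) :
  continuous_on unit_square h -> (forall p, unit_square p -> Omega (h p)) ->
  exists d, 0 < d /\ forall p, unit_square p -> exists c, Omega c /\
    forall p', unit_square p' -> Rabs (fst p' - fst p) < d -> Rabs (snd p' - snd p) < d ->
      ball c (r c) (h p').
Proof.
intros Hc HO.
(* The factor 2 leaves room for moving first from the centre of a covering square to p and then from
   p to p'. *)
assert (L : forall p, exists e : posreal, unit_square p -> forall p', unit_square p' ->
   Rabs (fst p' - fst p) < 2 * e -> Rabs (snd p' - snd p) < 2 * e -> ball (h p) (r (h p)) (h p')).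
{ intros p; destruct (Classical_Prop.classic (unit_square p)) as [Hp | Hp];
    [|exists (mkposreal 1 Rlt_0_1); intros; contradiction].
  destruct (Hc p Hp _ (locally_ball (h p) (r (h p)))) as [e He].
  exists (mkposreal (e / 2) (ltac:(destruct e; simpl; lra))); intros _ p' Hp' H1 H2.
  simpl in H1, H2; apply He; [|exact Hp'].
  replace (2 * (e / 2)) with (e : R) in H1, H2 by field; split; [exact H1 | exact H2]. }
destruct (choice _ L) as [dl Hdl].
destruct (compactness_value_2d 0 1 0 1 (fun x y => dl (x, y))) as [d Hd].
exists d; split; [apply cond_pos|].
intros [x y] [Hx Hy].
destruct (Classical_Prop.NNPP _ (Hd x y Hx Hy)) as (u & v & Hu & Hv & H1 & H2 & H3).
assert (Huv : unit_square (u, v)) by (split; assumption).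
exists (h (u, v)); split; [now apply HO|]; intros [x' y'] Hp' G1 G2; simpl in G1, G2.
apply (Hdl (u, v) Huv (x', y') Hp'); simpl.
- replace (x' - u) with ((x' - x) + (x - u)) by ring.
  eapply Rle_lt_trans; [apply Rabs_triang | lra].
- replace (y' - v) with ((y' - y) + (y - v)) by ring.
  eapply Rle_lt_trans; [apply Rabs_triang | lra].
Qed.

Lemma lebesgue_path (Omega : C -> Prop) (r : C -> posreal) (gamma : R -> C) :
  path_in Omega gamma ->
  exists d, 0 < d /\ forall s, unit_interval s -> exists c, Omega c /\
    forall t, unit_interval t -> Rabs (t - s) < d -> ball c (r c) (gamma t).
Proof.
intros [Hc HO].
destruct (lebesgue_square Omega r (fun p => gamma (snd p))) as (d & Hd & H).
- intros [x y] [Hx Hy] P HP; destruct (Hc y Hy P HP) as [e He].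
  exists e; intros [x' y'] [_ B] [_ Hy']; now apply He.
- intros [x y] [_ Hy]; now apply HO.
- exists d; split; [exact Hd|]; intros s Hs.
  destruct (H (s, s) (conj Hs Hs)) as (c & Hc' & Hb); exists c; split; [exact Hc'|].
  intros t Ht Hts; exact (Hb (t, t) (conj Ht Ht) Hts Hts).
Qed.

Definition local_cocycle (Omega : C -> Prop) (r : C -> posreal) (P : C -> C -> SL2tilde) : Prop :=
  forall c u v w, Omega c -> ball c (r c) u -> ball c (r c) v -> ball c (r c) w ->
    gmul (P u v) (P v w) = P u w.

(** Parallel transport along [gamma] for the flat connection encoded by [P]; by [lift_unique] it is
    determined by its initial value. *)
Definition lift (P : C -> C -> SL2tilde) (gamma : R -> C) (phi : R -> SL2tilde) (d : R) : Prop :=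
  forall s t, unit_interval s -> unit_interval t -> Rabs (t - s) < d ->
    phi t = gmul (phi s) (P (gamma s) (gamma t)).

Lemma cocycle_refl (Omega : C -> Prop) (r : C -> posreal) (P : C -> C -> SL2tilde) (c u : C) :
  local_cocycle Omega r P -> Omega c -> ball c (r c) u -> P u u = gone.
Proof. intros H Hc Hu; apply gmul_idem; now apply (H c). Qed.

Lemma lift_exists (Omega : C -> Prop) (r : C -> posreal) (P : C -> C -> SL2tilde)
    (gamma : R -> C) (d : R) (g : SL2tilde) :
  local_cocycle Omega r P -> 0 < d ->
  (forall s, unit_interval s -> exists c, Omega c /\
    forall t, unit_interval t -> Rabs (t - s) < d -> ball c (r c) (gamma t)) ->
  exists phi, phi 0 = g /\ lift P gamma phi (d / 2).
Proof.
intros HP Hd Hf.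
set (Q := fun T => exists phi : R -> SL2tilde, phi 0 = g /\
  forall s t, 0 <= s <= T -> 0 <= t <= T -> Rabs (t - s) < d / 2 ->
    phi t = gmul (phi s) (P (gamma s) (gamma t))).
assert (U0 : unit_interval 0) by (split; lra).
assert (H : Q 1).
{ apply (unit_induction Q (d / 2)); [lra | | | split; lra].
  - exists (fun _ => g); split; [reflexivity|]; intros s t Hs Ht _.
    replace s with 0 by lra; replace t with 0 by lra.
    destruct (Hf 0 U0) as (c & Hc & Hb); rewrite (cocycle_refl Omega r P c);
      [now rewrite gmul_1_r | exact HP | exact Hc|].
    apply Hb; [exact U0 | rewrite Rminus_diag, Rabs_R0; lra].
  - intros s t Hs Ht Hst (phi & P0 & HQ).
    destruct (Rle_dec t s) as [Hle | Hle].
    + exists phi; split; [exact P0|]; intros x y Hx Hy; apply HQ; lra.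
    + destruct (Hf s Hs) as (c & Hc & Hb).
      destruct Hs as [Hs0 Hs1], Ht as [Ht0 Ht1]; apply Rabs_def2 in Hst.
      (* The lift is continued by transport from s. Two parameters at distance below d / 2 on
         opposite sides of s have images in one ball with that of s, so the cocycle identity joins
         the two pieces. *)
      exists (fun x => if Rle_dec x s then phi x else gmul (phi s) (P (gamma s) (gamma x))).
      split; [destruct (Rle_dec 0 s); [exact P0 | contradiction]|].
      assert (Bs : ball c (r c) (gamma s))
        by (apply Hb; [split; lra | rewrite Rminus_diag, Rabs_R0; lra]).
      assert (near : forall x, 0 <= x <= t -> s - d / 2 < x -> ball c (r c) (gamma x))
        by (intros x Hx Hxs; apply Hb; [split; lra | apply Rabs_def1; lra]).
      intros x y Hx Hy Hxy; destruct (Rle_dec x s), (Rle_dec y s).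
      * apply HQ; lra.
      * apply Rabs_def2 in Hxy.
        rewrite (HQ x s) by (try apply Rabs_def1; lra).
        rewrite <- gmul_assoc, (HP c); try assumption; try apply near; try lra; reflexivity.
      * apply Rabs_def2 in Hxy.
        rewrite (HQ s y) by (try apply Rabs_def1; lra).
        rewrite <- gmul_assoc, (HP c); try assumption; try apply near; try lra; reflexivity.
      * apply Rabs_def2 in Hxy.
        rewrite <- gmul_assoc, (HP c); try assumption; try apply near; try lra; reflexivity. }
destruct H as (phi & P0 & HQ); exists phi; split; [exact P0|].
intros s t [Hs0 Hs1] [Ht0 Ht1]; apply HQ; split; assumption.
Qed.

Lemma lift_unique (P : C -> C -> SL2tilde) (gamma : R -> C) (phi phi' : R -> SL2tilde) (d d' : R) :
  0 < d -> 0 < d' -> lift P gamma phi d -> lift P gamma phi' d' -> phi 0 = phi' 0 ->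
  forall t, unit_interval t -> phi t = phi' t.
Proof.
intros Hd Hd' H H' E; apply (unit_induction (fun t => phi t = phi' t) (Rmin d d')).
- now apply Rmin_glb_lt.
- exact E.
- intros s t Hs Ht Hst Es; rewrite Rabs_minus_sym in Hst.
  rewrite (H s t), (H' s t), Es; try assumption; try reflexivity;
    eapply Rlt_le_trans; try eassumption; [apply Rmin_r | apply Rmin_l].
Qed.

Lemma lift_ext (P : C -> C -> SL2tilde) (gamma gamma' : R -> C) (phi : R -> SL2tilde) (d : R) :
  (forall t, unit_interval t -> gamma t = gamma' t) -> lift P gamma phi d -> lift P gamma' phi d.
Proof. intros E H s t Hs Ht Hst; rewrite <- !E by assumption; now apply H. Qed.

Lemma lift_affine (P : C -> C -> SL2tilde) (gamma : R -> C) (phi : R -> SL2tilde) (d a b : R) :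
  lift P gamma phi d -> (forall t, unit_interval t -> unit_interval (a + b * t)) ->
  Rabs b <= 1 -> lift P (fun t => gamma (a + b * t)) (fun t => phi (a + b * t)) d.
Proof.
intros H Hab Hb s t Hs Ht Hst; apply H; try now apply Hab.
replace (a + b * t - (a + b * s)) with (b * (t - s)) by ring; rewrite Rabs_mult.
pose proof (Rabs_pos (t - s)); nra.
Qed.

(** Lifts of neighbouring loops of the homotopy differ at time t by the value of [P] between their
    points at time t. At t = 1 both points are the base point, so the end value is the same for all
    loops, and for the constant loop it is [gone]. *)
Lemma loop_lift_closes (Omega : C -> Prop) (r : C -> posreal) (P : C -> C -> SL2tilde)
    (gamma : R -> C) :
  local_cocycle Omega r P -> null_homotopic Omega gamma ->
  exists d phi, 0 < d /\ phi 0 = gone /\ phi 1 = gone /\ lift P gamma phi d.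
Proof.
intros HP (h & Hc & HO & H0 & H1 & Hside).
destruct (lebesgue_square Omega r h Hc HO) as (d & Hd & Hb).
assert (U0 : unit_interval 0) by (split; lra); assert (U1 : unit_interval 1) by (split; lra).
assert (L : forall s, exists phi : R -> SL2tilde, unit_interval s ->
   phi 0 = gone /\ lift P (fun t => h (s, t)) phi (d / 2)).
{ intros s; destruct (Classical_Prop.classic (unit_interval s)) as [Hs | Hs];
    [|exists (fun _ => gone); intros; contradiction].
  destruct (lift_exists Omega r P (fun t => h (s, t)) d gone HP Hd) as (phi & E & Hl).
  - intros t Ht; destruct (Hb (s, t) (conj Hs Ht)) as (c & Hc' & Hbb); exists c; split; [exact Hc'|].
    intros t' Ht' Htt; apply Hbb; [now split | simpl; rewrite Rminus_diag, Rabs_R0; lra | exact Htt].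
  - exists phi; intros _; now split. }
destruct (choice _ L) as [phi Hphi].
assert (refl0 : P (gamma 0) (gamma 0) = gone).
{ destruct (Hb (0, 0) (conj U0 U0)) as (c & Hc' & Hbb).
  apply (cocycle_refl Omega r P c); try assumption; rewrite <- (H0 0 U0).
  apply Hbb; [now split | |]; simpl; rewrite Rminus_diag, Rabs_R0; lra. }
assert (claim : forall s s', unit_interval s -> unit_interval s' -> Rabs (s' - s) < d / 2 ->
  forall t, unit_interval t -> phi s' t = gmul (phi s t) (P (h (s, t)) (h (s', t)))).
{ intros s s' Hs Hs' Hss.
  destruct (Hphi s Hs) as [E L1]; destruct (Hphi s' Hs') as [E' L2].
  apply (unit_induction (fun t => phi s' t = gmul (phi s t) (P (h (s, t)) (h (s', t)))) (d / 2)); [lra | |].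
  - rewrite E, E', (proj1 (Hside s Hs)), (proj1 (Hside s' Hs')), refl0, gmul_1_l; reflexivity.
  - intros t t' Ht Ht' Htt IH; rewrite Rabs_minus_sym in Htt.
    destruct (Hb (s, t) (conj Hs Ht)) as (c & Hc' & Hbb).
    assert (D0 : forall x, Rabs (x - x) < d) by (intros; rewrite Rminus_diag, Rabs_R0; lra).
    assert (B1 : ball c (r c) (h (s, t))) by (apply Hbb; [now split | |]; apply D0).
    assert (B2 : ball c (r c) (h (s', t))) by (apply Hbb; [now split | simpl; lra | apply D0]).
    assert (B3 : ball c (r c) (h (s, t'))) by (apply Hbb; [now split | apply D0 | simpl; lra]).
    assert (B4 : ball c (r c) (h (s', t'))) by (apply Hbb; [now split | |]; simpl; lra).
    rewrite (L2 t t' Ht Ht' Htt), (L1 t t' Ht Ht' Htt), IH, <- !gmul_assoc.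
    rewrite (HP c), (HP c) by assumption; reflexivity. }
assert (const : forall s, unit_interval s -> phi s 1 = phi 0 1).
{ apply (unit_induction (fun s => phi s 1 = phi 0 1) (d / 2)); [lra | reflexivity|].
  intros s s' Hs Hs' Hss E; rewrite Rabs_minus_sym in Hss.
  rewrite (claim s s' Hs Hs' Hss 1 U1), (proj2 (Hside s Hs)), (proj2 (Hside s' Hs')), refl0, gmul_1_r.
  exact E. }
assert (last : forall t, unit_interval t -> phi 1 t = gone).
{ destruct (Hphi 1 U1) as [E L1].
  apply (unit_induction (fun t => phi 1 t = gone) (d / 2)); [lra | exact E|].
  intros t t' Ht Ht' Htt IH; rewrite Rabs_minus_sym in Htt.
  rewrite (L1 t t' Ht Ht' Htt), IH, (H1 t Ht), (H1 t' Ht'), refl0; apply gmul_1_l. }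
exists (d / 2), (phi 0); split; [lra|]; destruct (Hphi 0 U0) as [E L1].
split; [exact E|]; split; [rewrite <- (const 1 U1); now apply last|].
exact (lift_ext P _ gamma _ _ H0 L1).
Qed.

(** A path is continuous only relative to the unit interval; composed with [clamp] it is continuous
    on the whole line, where pieces can be pasted. *)
Definition clamp (t : R) : R := Rmax 0 (Rmin 1 t).

Lemma clamp_unit (t : R) : unit_interval (clamp t).
Proof. unfold clamp, unit_interval, Rmax, Rmin; destruct (Rle_dec 1 t); destruct (Rle_dec 0 _); lra. Qed.

Lemma clamp_id (t : R) : unit_interval t -> clamp t = t.
Proof. intros [H1 H2]; unfold clamp; rewrite Rmin_right, Rmax_right; lra. Qed.

Lemma clamp_contract (s t : R) : Rabs (clamp s - clamp t) <= Rabs (s - t).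
Proof.
unfold clamp, Rmax, Rmin; destruct (Rle_dec 1 s); destruct (Rle_dec 1 t);
  repeat destruct (Rle_dec 0 _); unfold Rabs; repeat destruct (Rcase_abs _); lra.
Qed.

Lemma continuous_clamp (gamma : R -> C) (t : R) :
  continuous_on unit_interval gamma -> continuous (fun s => gamma (clamp s)) t.
Proof.
intros H Q HQ; destruct (H (clamp t) (clamp_unit t) Q HQ) as [e He].
exists e; intros s Hs; apply He; [|apply clamp_unit].
eapply Rle_lt_trans; [apply clamp_contract | exact Hs].
Qed.

Lemma continuous_paste (f g : R -> C) (a t : R) :
  (forall s, continuous f s) -> (forall s, continuous g s) -> f a = g a ->
  continuous (fun s => if Rle_dec s a then f s else g s) t.
Proof.
intros Hf Hg E Q HQ; unfold filtermap.
destruct (Rtotal_order t a) as [Ht | [-> | Ht]].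
- destruct (Rle_dec t a) as [_ | N]; [|lra].
  assert (P : 0 < a - t) by lra.
  generalize (filter_and (fun s => Q (f s)) (ball t (mkposreal _ P)) (Hf t Q HQ)
    (locally_ball t (mkposreal _ P))).
  apply filter_imp; intros s [H1 H2]; apply Rabs_def2 in H2.
  unfold minus, plus, opp in H2; simpl in H2.
  destruct (Rle_dec s a); [exact H1 | lra].
- destruct (Rle_dec a a) as [_ | N]; [|lra].
  assert (HQ' := HQ); rewrite E in HQ'.
  generalize (filter_and (fun s => Q (f s)) (fun s => Q (g s)) (Hf a Q HQ) (Hg a Q HQ')); apply filter_imp.
  intros s [H1 H2]; destruct (Rle_dec s a); assumption.
- destruct (Rle_dec t a) as [N | _]; [lra|].
  assert (P : 0 < t - a) by lra.
  generalize (filter_and (fun s => Q (g s)) (ball t (mkposreal _ P)) (Hg t Q HQ)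
    (locally_ball t (mkposreal _ P))).
  apply filter_imp; intros s [H1 H2]; apply Rabs_def2 in H2.
  unfold minus, plus, opp in H2; simpl in H2.
  destruct (Rle_dec s a); [lra | exact H1].
Qed.

Lemma continuous_affine_comp (f : R -> C) (a b t : R) :
  (forall s, continuous f s) -> continuous (fun s => f (a + b * s)) t.
Proof.
intros Hf; apply (continuous_comp (fun s => a + b * s) f); [|apply Hf].
apply (@continuous_plus _ _ R_NormedModule); [apply continuous_const|].
apply (@continuous_mult _ R_AbsRing); [apply continuous_const | apply continuous_id].
Qed.

Definition segment (u v : C) (t : R) : C :=
  (Re u + t * (Re v - Re u), Im u + t * (Im v - Im u)).

Lemma continuous_segment (u v : C) (t : R) : continuous (segment u v) t.
Proof.
assert (L : forall a b : R, continuous (fun s => a + s * b) t).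
{ intros a b; apply (@continuous_plus _ _ R_NormedModule); [apply continuous_const|].
  apply (@continuous_mult _ R_AbsRing); [apply continuous_id | apply continuous_const]. }
intros Q [e He]; unfold filtermap.
generalize (filter_and
  (fun s => ball (Re u + t * (Re v - Re u)) e (Re u + s * (Re v - Re u)))
  (fun s => ball (Im u + t * (Im v - Im u)) e (Im u + s * (Im v - Im u)))
  (L _ _ _ (locally_ball _ e)) (L _ _ _ (locally_ball _ e))); apply filter_imp.
intros s [H1 H2]; apply He; split; assumption.
Qed.

Lemma segment_ball (c u v : C) (r : posreal) (t : R) :
  unit_interval t -> ball c r u -> ball c r v -> ball c r (segment u v t).
Proof.
intros [Ht0 Ht1] Hu Hv; destruct (proj1 (ball_C _ _ _) Hu) as [U1 U2].
destruct (proj1 (ball_C _ _ _) Hv) as [V1 V2].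
assert (conv : forall a b e : R, Rabs a < e -> Rabs b < e -> Rabs ((1 - t) * a + t * b) < e).
{ intros a b e Ha Hb; assert (M := Rmax_lub_lt _ _ _ Ha Hb).
  pose proof (Rmax_l (Rabs a) (Rabs b)); pose proof (Rmax_r (Rabs a) (Rabs b)).
  eapply Rle_lt_trans; [apply Rabs_triang|].
  rewrite !Rabs_mult, (Rabs_pos_eq (1 - t)), (Rabs_pos_eq t) by lra; nra. }
apply ball_C; unfold segment; simpl; split.
- replace (Re u + t * (Re v - Re u) - Re c) with ((1 - t) * (Re u - Re c) + t * (Re v - Re c)) by ring.
  now apply conv.
- replace (Im u + t * (Im v - Im u) - Im c) with ((1 - t) * (Im u - Im c) + t * (Im v - Im c)) by ring.
  now apply conv.
Qed.

(** [F z] is the end value of the lift along a chosen path from [z0] to z. For u and v in one ball,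
    the path to u, the segment from u to v and the reversed path to v form a loop, whose lift
    closes. *)
Theorem cocycle_trivial (Omega : C -> Prop) (r : C -> posreal) (P : C -> C -> SL2tilde) :
  simply_connected_domain Omega ->
  (forall c z, Omega c -> ball c (r c) z -> Omega z) ->
  local_cocycle Omega r P ->
  exists F : C -> SL2tilde, forall c u v, Omega c -> ball c (r c) u -> ball c (r c) v ->
    F v = gmul (F u) (P u v).
Proof.
intros [_ [z0 Hz0] conn loops] Hsub HP.
assert (U0 : unit_interval 0) by (split; lra); assert (U1 : unit_interval 1) by (split; lra).
assert (L : forall z, exists gp : (R -> C) * (R -> SL2tilde), Omega z ->
  path_in Omega (fst gp) /\ fst gp 0 = z0 /\ fst gp 1 = z /\ snd gp 0 = gone /\
  exists d, 0 < d /\ lift P (fst gp) (snd gp) d).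
{ intros z; destruct (Classical_Prop.classic (Omega z)) as [Hz | Hz];
    [|exists (fun _ => z0, fun _ => gone); intros; contradiction].
  destruct (conn z0 z Hz0 Hz) as (gamma & Hg & E0 & E1).
  destruct (lebesgue_path Omega r gamma Hg) as (d & Hd & Hb).
  destruct (lift_exists Omega r P gamma d gone HP Hd Hb) as (phi & Ephi & Hl).
  exists (gamma, phi); intros _; simpl; repeat (split; [assumption|]).
  exists (d / 2); split; [lra | exact Hl]. }
destruct (choice _ L) as [gp Hgp].
exists (fun z => snd (gp z) 1); intros c u v Hc Hu Hv.
destruct (Hgp u (Hsub c u Hc Hu)) as (Gu & Gu0 & Gu1 & Pu0 & du & Hdu & Lu).
destruct (Hgp v (Hsub c v Hc Hv)) as (Gv & Gv0 & Gv1 & Pv0 & dv & Hdv & Lv).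
destruct (gp u) as [gu pu], (gp v) as [gv pv]; simpl in *.
(* The loop is run through in thirds: out along [gu], across the segment, and back along [gv]. *)
set (f1 := fun t => gu (clamp (0 + 3 * t))).
set (f2 := fun t => segment u v (- 1 + 3 * t)).
set (f3 := fun t => gv (clamp (3 + - 3 * t))).
set (f23 := fun t => if Rle_dec t (2 / 3) then f2 t else f3 t).
set (l := fun t => if Rle_dec t (1 / 3) then f1 t else f23 t).
assert (c1 : forall t, continuous f1 t).
{ intros t; apply (continuous_affine_comp (fun s => gu (clamp s)) 0 3).
  intros s; apply continuous_clamp, Gu. }
assert (c2 : forall t, continuous f2 t).
{ intros t; apply (continuous_affine_comp (segment u v) (- 1) 3); apply continuous_segment. }
assert (c3 : forall t, continuous f3 t).
{ intros t; apply (continuous_affine_comp (fun s => gv (clamp s)) 3 (- 3)).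
  intros s; apply continuous_clamp, Gv. }
assert (e23 : f2 (2 / 3) = f3 (2 / 3)).
{ unfold f2, f3; replace (- 1 + 3 * (2 / 3)) with 1 by field.
  replace (3 + - 3 * (2 / 3)) with 1 by field; rewrite (clamp_id 1 U1), Gv1.
  unfold segment; apply injective_projections; unfold Re, Im; simpl; ring. }
assert (e12 : f1 (1 / 3) = f23 (1 / 3)).
{ unfold f23; destruct (Rle_dec (1 / 3) (2 / 3)); [|lra]; unfold f1, f2.
  replace (0 + 3 * (1 / 3)) with 1 by field; replace (- 1 + 3 * (1 / 3)) with 0 by field.
  rewrite (clamp_id 1 U1), Gu1; unfold segment; apply injective_projections;
    unfold Re, Im; simpl; ring. }
assert (cl : forall t, continuous l t).
{ intros t; apply continuous_paste; try assumption; intros s; now apply continuous_paste. }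
assert (l1 : forall t, unit_interval t -> l (0 + / 3 * t) = gu t).
{ intros t [Ht0 Ht1]; unfold l; destruct (Rle_dec (0 + / 3 * t) (1 / 3)); [|lra]; unfold f1.
  replace (0 + 3 * (0 + / 3 * t)) with t by field; now rewrite clamp_id by (split; lra). }
assert (l2 : forall t, unit_interval t -> l (1 / 3 + / 3 * t) = segment u v t).
{ intros t [Ht0 Ht1]; unfold l; destruct (Rle_dec (1 / 3 + / 3 * t) (1 / 3)).
  - replace (1 / 3 + / 3 * t) with (1 / 3) by lra; rewrite e12; unfold f23.
    destruct (Rle_dec (1 / 3) (2 / 3)); [|lra]; unfold f2; f_equal; lra.
  - unfold f23; destruct (Rle_dec (1 / 3 + / 3 * t) (2 / 3)); [|lra]; unfold f2; f_equal; lra. }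
assert (l3 : forall t, unit_interval t -> l (1 + - / 3 * t) = gv t).
{ intros t [Ht0 Ht1]; unfold l; destruct (Rle_dec (1 + - / 3 * t) (1 / 3)); [lra|].
  assert (E3 : f3 (1 + - / 3 * t) = gv t).
  { unfold f3; replace (3 + - 3 * (1 + - / 3 * t)) with t by field.
    now rewrite clamp_id by (split; lra). }
  rewrite <- E3; unfold f23; destruct (Rle_dec (1 + - / 3 * t) (2 / 3)); [|reflexivity].
  replace (1 + - / 3 * t) with (2 / 3) by lra; exact e23. }
assert (l0 : l 0 = z0).
{ rewrite <- Gu0, <- (l1 0 U0); f_equal; ring. }
assert (l1' : l 1 = z0).
{ rewrite <- Gv0, <- (l3 0 U0); f_equal; ring. }
assert (pl : path_in Omega l).
{ split.
  - intros t _ Q HQ; generalize (cl t Q HQ); unfold filtermap, within; apply filter_imp; tauto.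
  - intros t [Ht0 Ht1]; destruct (Rle_dec t (1 / 3)); [|destruct (Rle_dec t (2 / 3))].
    + replace t with (0 + / 3 * (3 * t)) by field; rewrite l1 by (split; lra).
      apply Gu; split; lra.
    + replace t with (1 / 3 + / 3 * (3 * t - 1)) by field; rewrite l2 by (split; lra).
      apply (Hsub c); [exact Hc|]; apply segment_ball; try assumption; split; lra.
    + replace t with (1 + - / 3 * (3 - 3 * t)) by field; rewrite l3 by (split; lra).
      apply Gv; split; lra. }
destruct (loop_lift_closes Omega r P l HP (loops l pl (eq_trans l0 (eq_sym l1'))))
  as (d & phi & Hd & Ph0 & Ph1 & Lphi).
assert (abs3 : Rabs (/ 3) <= 1) by (rewrite Rabs_pos_eq; lra).
assert (abs3' : Rabs (- / 3) <= 1) by (rewrite Rabs_Ropp; exact abs3).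
assert (A1 := lift_ext P _ gu _ _ l1
  (lift_affine P l phi d 0 (/ 3) Lphi (ltac:(intros t [? ?]; split; lra)) abs3)).
assert (A2 := lift_ext P _ (segment u v) _ _ l2
  (lift_affine P l phi d (1 / 3) (/ 3) Lphi (ltac:(intros t [? ?]; split; lra)) abs3)).
assert (A3 := lift_ext P _ gv _ _ l3
  (lift_affine P l phi d 1 (- / 3) Lphi (ltac:(intros t [? ?]; split; lra)) abs3')).
(* Uniqueness identifies the lift on the outer thirds with the chosen lifts. The last third is read
   backwards from t = 1, where closing of the lift gives the initial value [gone]. *)
assert (E1 : phi (1 / 3) = pu 1).
{ rewrite <- (lift_unique P gu (fun t => phi (0 + / 3 * t)) pu d du); try assumption.
  - f_equal; field.
  - rewrite Pu0, <- Ph0; f_equal; ring. }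
assert (E3 : phi (2 / 3) = pv 1).
{ rewrite <- (lift_unique P gv (fun t => phi (1 + - / 3 * t)) pv d dv); try assumption.
  - f_equal; field.
  - rewrite Pv0, <- Ph1; f_equal; ring. }
(* The segment stays in one ball, where the cocycle identity makes left multiples of [P u] a
   lift. *)
assert (E2 : phi (2 / 3) = gmul (phi (1 / 3)) (P u v)).
{ replace (2 / 3) with (1 / 3 + / 3 * 1) by field.
  rewrite (lift_unique P (segment u v) (fun t => phi (1 / 3 + / 3 * t))
    (fun t => gmul (phi (1 / 3)) (P u (segment u v t))) d 1); try assumption; try lra.
  - do 2 f_equal; unfold segment; apply injective_projections; unfold Re, Im; simpl; ring.
  - intros s t Hs Ht _; rewrite <- gmul_assoc, (HP c); try assumption; try reflexivity;
      now apply segment_ball.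
  - replace (segment u v 0) with u
      by (unfold segment; apply injective_projections; unfold Re, Im; simpl; ring).
    rewrite (cocycle_refl Omega r P c), gmul_1_r by assumption; f_equal; ring. }
rewrite <- E3, <- E1; exact E2.
Qed.

(** * Surfaces with given spinor *)

Open Scope C_scope.

(* The su(1,1) matrix [of_vec a] for real [a]. *)
Definition pvec (a : vec) : C * C := (Ci / 4 * a I3, / 2 * (a I1 + Ci * a I2)).

(** The left-translated f_x; since the map is real, f_zbar corresponds to the conjugate of [Z]. *)
Definition vel_x (Z : vec) : vec := fun k => Z k + Cconj (Z k).
Definition vel_y (Z : vec) : vec := fun k => Ci * (Z k - Cconj (Z k)).

Lemma vel_x_conj (Z : vec) (k : idx) : Cconj (vel_x Z k) = vel_x Z k.
Proof. unfold vel_x; rewrite Cplus_conj, Cconj_conj; ring. Qed.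

Lemma vel_y_conj (Z : vec) (k : idx) : Cconj (vel_y Z k) = vel_y Z k.
Proof. unfold vel_y; rewrite Cmult_conj, Cminus_conj, Cconj_conj, Ci_conj; ring. Qed.

Lemma Cconj_quarter : Cconj (/ 4) = / 4.
Proof. rewrite Cconj_inv, RtoC_conj by C_neq; reflexivity. Qed.

Lemma pvec_anti (a : vec) :
  (forall k, Cconj (a k) = a k) -> Cconj (fst (pvec a)) = - fst (pvec a).
Proof.
intros H; unfold pvec, Cdiv; simpl; rewrite !Cmult_conj, H, Ci_conj, Cconj_quarter; ring.
Qed.

Lemma pvec_snd_conj (a : vec) :
  (forall k, Cconj (a k) = a k) -> Cconj (snd (pvec a)) = / 2 * (a I1 - Ci * a I2).
Proof.
intros H; unfold pvec; simpl; rewrite Cmult_conj, Cplus_conj, Cmult_conj, !H, Ci_conj, Cconj_half; ring.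
Qed.

(** The right-hand side of [spin_mean] is real for real [h], so the imaginary part of its left-hand
    side vanishes; this is the present identity. *)
Lemma spin_dZ_flat (p s dp ds : C) (h : R) (k : idx) :
  dp = spin_V p s h * Cconj s ->
  ds = - (h / 2 * spin_E p s - Ci * (/ 2 * (p * Cconj p) - 3 / 4 * (s * Cconj s))) * Cconj p ->
  let Z := spin_Z p s in let Zb := fun j => Cconj (Z j) in
  spin_dZ p s dp ds k - Cconj (spin_dZ p s dp ds k)
  = nabla_lie Z Zb k - nabla_lie Zb Z k.
Proof.
intros -> -> Z Zb; rewrite !nabla_lieE; unfold Zb, Z; rewrite !spin_Z_conj.
destruct k; unfold spin_dZ, spin_Z, spin_V, Cdiv;
  repeat (rewrite Cplus_conj || rewrite Cminus_conj || rewrite Copp_conj || rewrite Cmult_conj);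
  rewrite ?spin_E_conj, ?Cconj_conj, ?RtoC_conj, ?Cconj_half, ?Cconj_quarter, ?Ci_conj;
  unfold spin_E; field [Ci2]; C_neq.
Qed.

Lemma psmooth_pair (Omega : C -> Prop) (u v : C -> C) :
  smoothC Omega u -> smoothC Omega v -> psmooth Omega (fun z => (u z, v z)).
Proof. intros [H1 H2] [H3 H4] [[] []]; assumption. Qed.

(** With M = d_z Z and N = d_zbar Z, the two explicit vectors are the x-derivative of [vel_y Z] and
    the y-derivative of [vel_x Z]. Their difference is 2 i (N - conj N), in which M cancels. *)
Lemma pvec_flat (Z N : vec) :
  let Zb := fun k => Cconj (Z k) in
  (forall k, N k - Cconj (N k) = nabla_lie Z Zb k - nabla_lie Zb Z k) ->
  forall M : vec,
  pvec (fun k => Ci * (M k - Cconj (N k) + (N k - Cconj (M k))))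
  = padd (padd (pmul (pvec (vel_y Z)) (pvec (vel_x Z)))
        (pvec (fun k => Ci * ((M k + Cconj (N k)) - (N k + Cconj (M k))))))
      (popp (pmul (pvec (vel_x Z)) (pvec (vel_y Z)))).
Proof.
intros Zb H M.
assert (EN : forall k, N k = Cconj (N k) + (nabla_lie Z Zb k - nabla_lie Zb Z k)).
{ intros k; rewrite <- H; ring. }
assert (EN1 := EN I1); assert (EN2 := EN I2); assert (EN3 := EN I3).
rewrite !nabla_lieE in EN1, EN2, EN3; unfold Zb in *.
assert (A1 := pvec_snd_conj _ (vel_x_conj Z)); assert (A2 := pvec_snd_conj _ (vel_y_conj Z)).
assert (A3 := pvec_anti _ (vel_x_conj Z)); assert (A4 := pvec_anti _ (vel_y_conj Z)).
unfold pmul, padd, popp; rewrite A1, A2, A3, A4; unfold pvec; simpl.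
set (n1 := Cconj (N I1)) in *; set (n2 := Cconj (N I2)) in *; set (n3 := Cconj (N I3)) in *.
apply injective_projections; simpl; rewrite ?EN1, ?EN2, ?EN3; unfold vel_x, vel_y;
  field [Ci2]; C_neq.
Qed.

(** * Integration of flat forms in the covering group *)

Lemma between_const (f : R -> R) (a b : R) :
  (forall t, (Rmin a b <= t <= Rmax a b)%R -> is_derive f t 0%R) -> f a = f b.
Proof.
intros H; destruct (MVT_gen f a b (fun _ => 0%R)) as (c & _ & E).
- intros t Ht; apply H; lra.
- intros t Ht; apply continuity_pt_filterlim; apply (@ex_derive_continuous R_AbsRing R_NormedModule).
  exists 0%R; now apply H.
- lra.
Qed.

Lemma between_ball (c x y r t : R) :
  (Rabs (x - c) < r)%R -> (Rabs (y - c) < r)%R -> (Rmin x y <= t <= Rmax x y)%R ->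
  (Rabs (t - c) < r)%R.
Proof.
intros Hx Hy [H1 H2]; apply Rabs_def2 in Hx, Hy; apply Rabs_def1;
  unfold Rmin, Rmax in *; destruct (Rle_dec x y); lra.
Qed.

(** By hypothesis the adjugate of [M t] is its negative, so the two terms of the derivative of u
    v^{-1} cancel. *)
Lemma same_equation (u v M : R -> C * C) (t : R) :
  Cconj (fst (M t)) = - fst (M t) ->
  pderiv u t (pmul (u t) (M t)) -> pderiv v t (pmul (v t) (M t)) ->
  pderiv (fun s => pmul (u s) (padj (v s))) t (RtoC 0, RtoC 0).
Proof.
intros HM Hu Hv; eapply pderiv_val; [exact (pderiv_pmul _ _ _ _ _ Hu (pderiv_padj _ _ _ Hv))|].
cbv beta; destruct (u t) as [u1 u2], (v t) as [v1 v2], (M t) as [m1 m2]; simpl in HM.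
unfold padd, pmul, padj; simpl; apply injective_projections; simpl;
  repeat (rewrite Cplus_conj || rewrite Cmult_conj || rewrite Copp_conj || rewrite Cconj_conj);
  rewrite HM; ring.
Qed.

(* Two solutions differ by a left factor, constant along an axis-parallel path from [u] to [v]. *)
Lemma solutions_rel (X Y F G : C -> C * C) (c c' : C) (r r' : posreal) (u v : C) :
  (forall z, ball c r z -> Cconj (fst (X z)) = - fst (X z) /\ Cconj (fst (Y z)) = - fst (Y z)) ->
  (forall z, ball c r z -> pderiv (fun s => F (s, Im z)) (Re z) (pmul (F z) (X z)) /\
      pderiv (fun s => F (Re z, s)) (Im z) (pmul (F z) (Y z)) /\ pdet (F z) = RtoC 1) ->
  (forall z, ball c' r' z -> pderiv (fun s => G (s, Im z)) (Re z) (pmul (G z) (X z)) /\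
      pderiv (fun s => G (Re z, s)) (Im z) (pmul (G z) (Y z)) /\ pdet (G z) = RtoC 1) ->
  ball c r u -> ball c r v -> ball c' r' u -> ball c' r' v ->
  pmul (padj (F u)) (F v) = pmul (padj (G u)) (G v).
Proof.
intros anti HF HG Bu Bv Bu' Bv'.
destruct (proj1 (ball_C _ _ _) Bu) as [U1 U2]; destruct (proj1 (ball_C _ _ _) Bv) as [V1 V2].
destruct (proj1 (ball_C _ _ _) Bu') as [U1' U2']; destruct (proj1 (ball_C _ _ _) Bv') as [V1' V2'].
set (T := fun z => pmul (F z) (padj (G z))).
assert (E1 : T u = T (Re v, Im u)).
{ apply comp_ext; intros i.
  transitivity (comp i (T (Re u, Im u))); [destruct u; reflexivity|].
  apply (between_const (fun s => comp i (T (s, Im u)))); intros t Ht.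
  assert (B : ball c r (t, Im u))
    by (apply ball_C; split; [exact (between_ball _ _ _ _ _ U1 V1 Ht) | exact U2]).
  assert (B' : ball c' r' (t, Im u))
    by (apply ball_C; split; [exact (between_ball _ _ _ _ _ U1' V1' Ht) | exact U2']).
  eapply is_derive_val; [|exact (eq_refl 0%R)].
  eapply is_derive_val; [apply (proj1 (pderiv_comp _ _ _)
    (same_equation (fun s => F (s, Im u)) (fun s => G (s, Im u)) (fun s => X (s, Im u)) t
      (proj1 (anti _ B)) (proj1 (HF _ B)) (proj1 (HG _ B'))))|].
  destruct i as [[] []]; reflexivity. }
assert (E2 : T (Re v, Im u) = T v).
{ apply comp_ext; intros i.
  transitivity (comp i (T (Re v, Im v))); [|destruct v; reflexivity].
  apply (between_const (fun s => comp i (T (Re v, s)))); intros t Ht.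
  assert (B : ball c r (Re v, t))
    by (apply ball_C; split; [exact V1 | exact (between_ball _ _ _ _ _ U2 V2 Ht)]).
  assert (B' : ball c' r' (Re v, t))
    by (apply ball_C; split; [exact V1' | exact (between_ball _ _ _ _ _ U2' V2' Ht)]).
  eapply is_derive_val; [apply (proj1 (pderiv_comp _ _ _)
    (same_equation (fun s => F (Re v, s)) (fun s => G (Re v, s)) (fun s => Y (Re v, s)) t
      (proj2 (anti _ B)) (proj1 (proj2 (HF _ B))) (proj1 (proj2 (HG _ B')))))|].
  destruct i as [[] []]; reflexivity. }
assert (E := eq_trans E1 E2); unfold T in E.
assert (Du := proj2 (proj2 (HF u Bu))); assert (Dv := proj2 (proj2 (HG v Bv'))).
transitivity (pmul (padj (F u)) (pmul (pmul (F v) (padj (G v))) (G v))).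
- rewrite <- pmul_assoc, (padj_pmul _ Dv), pmul_1_r; reflexivity.
- rewrite <- E, !pmul_assoc, (padj_pmul _ Du), pmul_1_l; reflexivity.
Qed.

(* The sheet of the cover over the matrices with diagonal entry in the right half plane. *)
Definition lift_right (u : C * C) : SL2tilde := (snd u, arg_right (fst u)).

Lemma diag_lift_right (u : C * C) :
  pdet u = 1 -> (0 < Re (fst u))%R -> diag (lift_right u) = fst u.
Proof.
intros Hd Hr; rewrite (arg_rightE (fst u) Hr); unfold diag, lift_right, off, angle; simpl fst; simpl snd.
do 2 f_equal.
rewrite <- (sqrt_pow2 (Cmod (fst u))) by apply Cmod_ge_0; f_equal.
apply RtoC_inj; rewrite RtoC_plus, !Cmod2_conj.
unfold pdet in Hd; rewrite <- Hd; ring.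
Qed.

Lemma arg_right_quarter (w : C) :
  (Rabs (Im w) < Re w)%R -> (Rabs (arg_right w) < PI / 4)%R.
Proof.
intros H; unfold arg_right.
assert (P : (0 < Re w)%R) by (pose proof (Rabs_pos (Im w)); lra).
apply Rabs_def2 in H; destruct H as [H1 H2].
assert (Q1 : (Im w / Re w < 1)%R) by (apply Rlt_div_l; lra).
assert (Q2 : (-1 < Im w / Re w)%R) by (apply Rlt_div_r; lra).
apply Rabs_def1.
- rewrite <- atan_1; now apply atan_increasing.
- rewrite <- atan_1, <- atan_opp; now apply atan_increasing.
Qed.

(** Both quotients lie over the same matrix. Their angles involve four arguments below pi / 4 and
    two corrections below pi / 2 in absolute value, so they differ by less than 4 pi / 4 + 2 pi / 2
    = 2 pi and [cover_close] applies. *)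
Lemma lift_right_rel (u v u' v' : C * C) :
  (forall w, List.In w (u :: v :: u' :: v' :: nil)%list -> pdet w = 1 /\ (Rabs (Im (fst w)) < Re (fst w))%R) ->
  pmul (padj u) v = pmul (padj u') v' ->
  gmul (ginv (lift_right u)) (lift_right v) = gmul (ginv (lift_right u')) (lift_right v').
Proof.
intros H E.
assert (D : forall w, List.In w (u :: v :: u' :: v' :: nil)%list -> diag (lift_right w) = fst w).
{ intros w Hw; destruct (H w Hw) as [H1 H2]; apply diag_lift_right; [exact H1|].
  pose proof (Rabs_pos (Im (fst w))); lra. }
assert (Iu : List.In u (u :: v :: u' :: v' :: nil)%list) by (simpl; tauto).
assert (Iv : List.In v (u :: v :: u' :: v' :: nil)%list) by (simpl; tauto).
assert (Iu' : List.In u' (u :: v :: u' :: v' :: nil)%list) by (simpl; tauto).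
assert (Iv' : List.In v' (u :: v :: u' :: v' :: nil)%list) by (simpl; tauto).
apply cover_close.
- rewrite !rel_diagE; unfold rel_diag; rewrite !D by assumption.
  apply (f_equal fst) in E; unfold pmul, padj in E; simpl in E; simpl.
  match type of E with ?a = ?b => transitivity a; [ring | rewrite E; ring] end.
- rewrite !rel_offE; unfold rel_off; rewrite !D by assumption.
  apply (f_equal snd) in E; unfold pmul, padj in E; simpl in E; simpl.
  match type of E with ?a = ?b => transitivity a; [ring | rewrite E; ring] end.
- assert (A : forall w, List.In w (u :: v :: u' :: v' :: nil)%list -> (Rabs (angle (lift_right w)) < PI / 4)%R)
    by (intros w Hw; apply arg_right_quarter, H, Hw).
  assert (B : forall g k, exists e,
    (- PI / 2 < e < PI / 2)%R /\ angle (gmul (ginv g) k) = (- angle g + angle k + e)%R).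
  { intros g k; eexists; split; [|reflexivity]; apply arg_right_bound. }
  destruct (B (lift_right u) (lift_right v)) as (e1 & He1 & ->).
  destruct (B (lift_right u') (lift_right v')) as (e2 & He2 & ->).
  pose proof (A u Iu) as A1; pose proof (A v Iv) as A2; pose proof (A u' Iu') as A3;
    pose proof (A v' Iv') as A4.
  apply Rabs_def2 in A1, A2, A3, A4; apply Rabs_def1; lra.
Qed.

(** The inequality between imaginary and real part keeps the diagonal entry in the sector where
    [lift_right_rel] identifies quotients. *)
Definition local_solution (Omega : C -> Prop) (X Y : C -> C * C) (c : C)
    (r : posreal) (F : C -> C * C) : Prop :=
  F c = pone /\ psmooth (ball c r) F /\
  forall z, ball c r z -> Omega z /\ (Rabs (Im (fst (F z))) < Re (fst (F z)))%R /\
    pderiv (fun s => F (s, Im z)) (Re z) (pmul (F z) (X z)) /\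
    pderiv (fun s => F (Re z, s)) (Im z) (pmul (F z) (Y z)) /\ pdet (F z) = 1.

Lemma local_solution_exists (Omega : C -> Prop) (X Y : C -> C * C) (c : C) :
  open Omega -> Omega c -> psmooth Omega X -> psmooth Omega Y ->
  (forall z, Omega z -> Cconj (fst (X z)) = - fst (X z) /\ Cconj (fst (Y z)) = - fst (Y z)) ->
  (forall z, Omega z -> pdx Y z = padd (padd (pmul (Y z) (X z)) (pdy X z)) (popp (pmul (X z) (Y z)))) ->
  exists r F, local_solution Omega X Y c r F.
Proof.
intros HO Hc SX SY anti flat.
destruct (local_frobenius Omega X Y c HO Hc SX SY anti flat) as (rho & F & BO & Fc & SF & DF).
assert (Bc : ball c rho c) by apply ball_center.
assert (C1 := Ck_cont 0 _ _ c (SF (true, true) 0%nat) Bc).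
assert (C2 := Ck_cont 0 _ _ c (SF (true, false) 0%nat) Bc).
unfold comp in C1, C2; simpl in C1, C2.
(* The diagonal entry is 1 at c; where its parts have moved by less than 1/2, the real part exceeds
   1/2 and the imaginary part stays below it. *)
assert (half : (0 < / 2)%R) by lra.
assert (L : locally c (fun z => ball (Re (fst (F c))) (mkposreal _ half) (Re (fst (F z))) /\
   ball (Im (fst (F c))) (mkposreal _ half) (Im (fst (F z))))).
{ exact (filter_and
    (fun z => ball (Re (fst (F c))) (mkposreal _ half) (Re (fst (F z))))
    (fun z => ball (Im (fst (F c))) (mkposreal _ half) (Im (fst (F z))))
    (C1 _ (locally_ball _ _)) (C2 _ (locally_ball _ _))). }
rewrite Fc in L; destruct L as [e He].
assert (P : (0 < Rmin rho e)%R) by (apply Rmin_glb_lt; apply cond_pos).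
exists (mkposreal _ P), F.
assert (sub : forall z, ball c (mkposreal _ P) z -> ball c rho z)
  by (intros z; apply ball_le, Rmin_l).
split; [exact Fc|]; split.
- intros i k; apply Ck_subset with (ball c rho); [exact sub | apply SF].
- intros z Hz; split; [now apply BO, sub|]; split; [|now apply DF, sub].
  assert (Hz' : ball c e z) by (revert Hz; apply ball_le, Rmin_r).
  destruct (He z Hz') as [H1 H2].
  change (Rabs (Re (fst (F z)) - 1) < / 2)%R in H1; change (Rabs (Im (fst (F z)) - 0) < / 2)%R in H2.
  rewrite Rminus_0_r in H2; apply Rabs_def2 in H1; lra.
Qed.

Theorem flat_integrable (Omega : C -> Prop) (X Y : C -> C * C) :
  simply_connected_domain Omega -> psmooth Omega X -> psmooth Omega Y ->
  (forall z, Omega z -> Cconj (fst (X z)) = - fst (X z) /\ Cconj (fst (Y z)) = - fst (Y z)) ->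
  (forall z, Omega z -> pdx Y z = padd (padd (pmul (Y z) (X z)) (pdy X z)) (popp (pmul (X z) (Y z)))) ->
  exists f : C -> SL2tilde, smoothG Omega f /\
    forall z, Omega z ->
    has_d (fun w => rel_diag (f z) (f w)) z
      (/ 2 * (fst (X z) - Ci * fst (Y z))) (/ 2 * (fst (X z) + Ci * fst (Y z))) /\
    has_d (fun w => rel_off (f z) (f w)) z
      (/ 2 * (snd (X z) - Ci * snd (Y z))) (/ 2 * (snd (X z) + Ci * snd (Y z))).
Proof.
intros Hscd SX SY anti flat; assert (HO := scd_open _ Hscd).
assert (L : forall c, exists rF : posreal * (C -> C * C), Omega c ->
   local_solution Omega X Y c (fst rF) (snd rF)).
{ intros c; destruct (Classical_Prop.classic (Omega c)) as [Hc | Hc];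
    [|exists (mkposreal 1 Rlt_0_1, fun _ => pone); intros; contradiction].
  destruct (local_solution_exists Omega X Y c HO Hc SX SY anti flat) as (r & F & H).
  now exists (r, F). }
destruct (choice _ L) as [rF HrF].
set (r := fun c => fst (rF c)); set (S := fun c z => lift_right (snd (rF c) z)).
(* [P u v] is computed in some ball that contains both points, if there is one; [HP] shows that the
   choice of the ball does not matter. *)
set (good := fun (uv : C * C) c => Omega c /\ ball c (r c) (fst uv) /\ ball c (r c) (snd uv)).
assert (K : forall uv, exists c, (exists c', good uv c') -> good uv c).
{ intros uv; destruct (Classical_Prop.classic (exists c', good uv c')) as [[c Hc] | N];
    [now exists c | exists 0; intros; contradiction]. }
destruct (choice _ K) as [kc Hkc].
set (P := fun u v => gmul (ginv (S (kc (u, v)) u)) (S (kc (u, v)) v)).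
assert (HP : forall c u v, Omega c -> ball c (r c) u -> ball c (r c) v ->
   P u v = gmul (ginv (S c u)) (S c v)).
{ intros c u v Hc Hu Hv; unfold P.
  destruct (Hkc (u, v)) as (Hk & Hku & Hkv); [exists c; exact (conj Hc (conj Hu Hv))|].
  simpl in Hku, Hkv; set (k := kc (u, v)) in *.
  destruct (HrF c Hc) as (_ & _ & D); destruct (HrF k Hk) as (_ & _ & Dk).
  apply lift_right_rel.
  - intros w [<- | [<- | [<- | [<- | []]]]].
    + now split; apply (Dk u Hku).
    + now split; apply (Dk v Hkv).
    + now split; apply (D u Hu).
    + now split; apply (D v Hv).
  - apply (solutions_rel X Y (snd (rF k)) (snd (rF c)) k c (r k) (r c)); try assumption.
    + intros z Hz; apply anti, (Dk z Hz).
    + intros z Hz; apply (Dk z Hz).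
    + intros z Hz; apply (D z Hz). }
assert (coc : local_cocycle Omega r P).
{ intros c u v w Hc Hu Hv Hw; rewrite !(HP c) by assumption.
  rewrite <- gmul_assoc, (gmul_assoc (S c v)), gmul_inv_r, gmul_1_l; reflexivity. }
destruct (cocycle_trivial Omega r P Hscd) as [f Hf]; [|exact coc|].
{ intros c z Hc Hz; destruct (HrF c Hc) as (_ & _ & D); apply (D z Hz). }
assert (Sc : forall c, Omega c -> S c c = gone).
{ intros c Hc; destruct (HrF c Hc) as (E & _); unfold S; rewrite E.
  unfold lift_right, pone, gone; simpl; now rewrite arg_right_real. }
assert (fS : forall c z, Omega c -> ball c (r c) z -> f z = gmul (f c) (S c z)).
{ intros c z Hc Hz; assert (Bc : ball c (r c) c) by apply ball_center.
  rewrite (Hf c c z Hc Bc Hz), (HP c c z Hc Bc Hz), (Sc c Hc).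
  f_equal; rewrite <- (gmul_1_l (ginv gone)), gmul_inv_r, gmul_1_l; reflexivity. }
assert (dS : forall c z, Omega c -> ball c (r c) z -> diag (S c z) = fst (snd (rF c) z)).
{ intros c z Hc Hz; destruct (HrF c Hc) as (_ & _ & D); destruct (D z Hz) as (_ & D1 & _ & _ & D2).
  apply diag_lift_right; [exact D2|]; pose proof (Rabs_pos (Im (fst (snd (rF c) z)))); lra. }
exists f; split.
- assert (loc : forall c, Omega c -> smoothG (ball c (r c)) f).
  { intros c Hc; assert (OB := open_ball_C c (r c)).
    destruct (HrF c Hc) as (_ & SF & D).
    assert (S1 : smoothC (ball c (r c)) (fun z => fst (snd (rF c) z)))
      by (split; [exact (SF (true, true)) | exact (SF (true, false))]).
    assert (S2 : smoothC (ball c (r c)) (fun z => snd (snd (rF c) z)))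
      by (split; [exact (SF (false, true)) | exact (SF (false, false))]).
    set (g := f c) in *; set (a := fun z => fst (snd (rF c) z)) in *;
      set (b := fun z => snd (snd (rF c) z)) in *.
    split.
    - apply smoothC_ext with (fun z => diag g * b z + off g * Cconj (a z)); [exact OB | |].
      + intros z Hz; rewrite (fS c z Hc Hz), off_gmul, (dS c z Hc Hz); reflexivity.
      + apply smoothC_plus; [exact OB | |]; apply smoothC_mult; try exact OB;
          try (now apply smoothC_const); [exact S2 | now apply smoothC_conj].
    (* Left multiplication by the constant [g], written out in the chart; both arguments of
       [arg_right] have positive real part, where it is smooth. *)
    - intros k; apply Ck_ext with (fun z => (angle g + arg_right (a z))
        + arg_right (1 + off g * Cconj (b z) * / (diag g * a z)))%R; [exact OB | |].
      + intros z Hz; rewrite (fS c z Hc Hz); unfold gmul, angle at 3; simpl snd.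
        rewrite (dS c z Hc Hz); reflexivity.
      + assert (a0 : forall z, ball c (r c) z -> (0 < Re (a z))%R).
        { intros z Hz; destruct (D z Hz) as (_ & D1 & _); fold (a z) in D1.
          pose proof (Rabs_pos (Im (a z))); lra. }
        apply Ck_plus; [exact OB | apply Ck_plus; [exact OB | now apply Ck_const|] |].
        * apply (smooth_arg_right _ a OB); [|exact S1].
          intros z Hz; pose proof (a0 z Hz); lra.
        * apply (smooth_arg_right _ _ OB).
          -- intros z Hz; pose proof (ratio_right g (S c z)) as Q; rewrite (dS c z Hc Hz) in Q.
             apply Rgt_not_eq; exact Q.
          -- apply smoothC_plus; [exact OB | now apply smoothC_const|].
             apply smoothC_mult; [exact OB | |].
             ++ apply smoothC_mult; [exact OB | now apply smoothC_const | now apply smoothC_conj].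
             ++ apply smoothC_inv; [exact OB | |].
                ** intros z Hz; apply Cmult_neq_0; [apply diag_neq0|].
                   intros E; pose proof (a0 z Hz) as Q; rewrite E in Q; simpl in Q; lra.
                ** apply smoothC_mult; [exact OB | now apply smoothC_const | exact S1]. }
  split; [split|]; intros k; apply Ck_local; intros c Hc; exists (ball c (r c));
    (split; [apply ball_center | apply (loc c Hc)]).
(* In the ball centred at z itself the quotient f(z)^{-1} f(w) is [S z w], and the local solution is
   1 at z, so its derivatives there are X and Y. *)
- intros z Hz; destruct (HrF z Hz) as (E & _ & D).
  assert (Bz : ball z (r z) z) by apply ball_center.
  destruct (D z Bz) as (_ & _ & [Dx1 Dx2] & [Dy1 Dy2] & _).
  rewrite E, pmul_1_l in Dx1, Dx2, Dy1, Dy2.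
  assert (OB := open_ball_C z (r z)).
  assert (rel : forall w, ball z (r z) w -> gmul (ginv (f z)) (f w) = S z w).
  { intros w Hw; rewrite (fS z w Hz Hw), gmul_assoc, gmul_inv_l, gmul_1_l; reflexivity. }
  split.
  + apply has_d_ext with (ball z (r z)) (fun w => fst (snd (rF z) w)); try assumption.
    * intros w Hw; rewrite <- rel_diagE, (rel w Hw); symmetry; now apply dS.
    * now apply has_d_intro.
  + apply has_d_ext with (ball z (r z)) (fun w => snd (snd (rF z) w)); try assumption.
    * intros w Hw; rewrite <- rel_offE, (rel w Hw); reflexivity.
    * now apply has_d_intro.
Qed.

Lemma spin_integrable (Omega : C -> Prop) (psi1 psi2 : C -> C) (H : C -> R) :
  simply_connected_domain Omega -> smoothC Omega psi1 -> smoothC Omega psi2 ->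
  dirac Omega psi1 psi2 H ->
  exists f : C -> SL2tilde, smoothG Omega f /\
    forall z, Omega z -> forall k, left_deriv d_z f z k = spin_Z (psi1 z) (Cconj (psi2 z)) k.
Proof.
intros Hscd S1 S2 HD; assert (HO := scd_open _ Hscd).
set (Z := fun z => spin_Z (psi1 z) (Cconj (psi2 z))).
set (X := fun z => pvec (vel_x (Z z))); set (Y := fun z => pvec (vel_y (Z z))).
assert (S2b := smoothC_conj Omega psi2 HO S2).
assert (SZ : forall k, smoothC Omega (fun z => Z z k)).
{ intros k; unfold Z, spin_Z.
  assert (sq : forall F, smoothC Omega F -> smoothC Omega (fun z => F z ^ 2)).
  { intros F HF; apply smoothC_mult; [exact HO | exact HF|].
    apply smoothC_mult; [exact HO | exact HF | now apply smoothC_const]. }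
  destruct k.
  - apply smoothC_mult; [exact HO | now apply smoothC_const|].
    apply smoothC_plus; [exact HO | |]; now apply sq.
  - apply smoothC_mult; [exact HO | now apply smoothC_const|].
    apply smoothC_minus; [exact HO | |]; now apply sq.
  - now apply smoothC_mult. }
assert (SZb : forall k, smoothC Omega (fun z => Cconj (Z z k)))
  by (intros k; now apply smoothC_conj).
assert (Sx : forall k, smoothC Omega (fun z => vel_x (Z z) k))
  by (intros k; now apply smoothC_plus).
assert (Sy : forall k, smoothC Omega (fun z => vel_y (Z z) k)).
{ intros k; apply smoothC_mult; [exact HO | now apply smoothC_const | now apply smoothC_minus]. }
assert (Spv : forall a : C -> vec, (forall k, smoothC Omega (fun z => a z k)) ->
   psmooth Omega (fun z => pvec (a z))).
{ intros a Ha; apply psmooth_pair.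
  - apply smoothC_mult; [exact HO | now apply smoothC_const | apply Ha].
  - apply smoothC_mult; [exact HO | now apply smoothC_const|].
    apply smoothC_plus; [exact HO | apply Ha|].
    apply smoothC_mult; [exact HO | now apply smoothC_const | apply Ha]. }
destruct (flat_integrable Omega X Y Hscd (Spv _ Sx) (Spv _ Sy)) as (f & Sf & Hf).
- intros z _; split; apply pvec_anti; [apply vel_x_conj | apply vel_y_conj].
- intros z Hz.
  assert (DZ := fun k => has_d_smooth Omega _ z (SZ k) Hz).
  assert (DZb := fun k => has_d_conj _ _ _ _ (DZ k)).
  set (M := fun k => d_z (fun w => Z w k) z); set (N := fun k => d_zbar (fun w => Z w k) z).
  assert (EN : forall k, N k - Cconj (N k)
    = nabla_lie (Z z) (fun j => Cconj (Z z j)) k - nabla_lie (fun j => Cconj (Z z j)) (Z z) k).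
  { intros k; destruct (proj1 (dirac_spin _ _ _ _) HD z Hz) as [D1 D2].
    assert (E : N k = spin_dZ (psi1 z) (Cconj (psi2 z)) (d_zbar psi1 z) (Cconj (d_z psi2 z)) k).
    { apply (has_d_d_zbar _ z _ _ (has_d_spin_Z psi1 (fun w => Cconj (psi2 w)) z _ _ _ _ k
        (has_d_smooth Omega psi1 z S1 Hz) (d_conj Omega psi2 z S2 Hz))). }
    rewrite E; exact (spin_dZ_flat _ _ _ _ (H z) k D1 D2). }
  assert (Q := pvec_flat (Z z) N EN M).
  assert (Ey : forall k, d_x (fun w => vel_y (Z w) k) z
    = Ci * (M k - Cconj (N k) + (N k - Cconj (M k)))).
  { intros k.
    assert (T : has_d (fun w => vel_y (Z w) k) z (Ci * (M k - Cconj (N k))) (Ci * (N k - Cconj (M k)))).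
    { eapply has_d_val; [apply (has_d_mult (fun _ => Ci) (fun w => Z w k - Cconj (Z w k)));
        [apply has_d_const | exact (has_d_minus _ _ _ _ _ _ _ (DZ k) (DZb k))] | |];
        unfold M, N; ring. }
    rewrite (has_d_d_x _ _ _ _ T); ring. }
  assert (Ex : forall k, d_y (fun w => vel_x (Z w) k) z
    = Ci * ((M k + Cconj (N k)) - (N k + Cconj (M k)))).
  { intros k; exact (has_d_d_y _ _ _ _ (has_d_plus _ _ _ _ _ _ _ (DZ k) (DZb k))). }
  (* [pvec] is linear with constant coefficients and therefore commutes with [d_x] and [d_y]. *)
  assert (lin : forall (D : (C -> C) -> C -> C) (a : C -> vec),
    (forall (c : C) F, smoothC Omega F -> D (fun w => c * F w) z = c * D F z) ->
    (forall F G, smoothC Omega F -> smoothC Omega G -> D (fun w => F w + G w) z = D F z + D G z) ->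
    (forall k, smoothC Omega (fun w => a w k)) ->
    (D (fun w => fst (pvec (a w))) z, D (fun w => snd (pvec (a w))) z)
    = pvec (fun k => D (fun w => a w k) z)).
  { intros D a Dc Dp Ha; unfold pvec; apply injective_projections; simpl.
    - apply Dc, Ha.
    - rewrite (Dc (/ 2)), Dp, Dc; try apply Ha; [reflexivity | |].
      + apply smoothC_mult; [exact HO | now apply smoothC_const | apply Ha].
      + apply smoothC_plus; [exact HO | apply Ha|].
        apply smoothC_mult; [exact HO | now apply smoothC_const | apply Ha]. }
  assert (EY : pdx Y z = pvec (fun k => d_x (fun w => vel_y (Z w) k) z)).
  { rewrite <- (lin d_x (fun w => vel_y (Z w))); [reflexivity | | | exact Sy].
    - intros c F HF; assert (T := has_d_smooth Omega F z HF Hz).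
      rewrite (has_d_d_x _ _ _ _ T), (has_d_d_x _ _ _ _ (has_d_mult _ _ _ _ _ _ _ (has_d_const c z) T)).
      cbv beta; ring.
    - intros F G HF HG; assert (T := has_d_smooth Omega F z HF Hz);
        assert (T' := has_d_smooth Omega G z HG Hz).
      rewrite (has_d_d_x _ _ _ _ T), (has_d_d_x _ _ _ _ T'),
        (has_d_d_x _ _ _ _ (has_d_plus _ _ _ _ _ _ _ T T')).
      ring. }
  assert (EX : pdy X z = pvec (fun k => d_y (fun w => vel_x (Z w) k) z)).
  { rewrite <- (lin d_y (fun w => vel_x (Z w))); [reflexivity | | | exact Sx].
    - intros c F HF; assert (T := has_d_smooth Omega F z HF Hz).
      rewrite (has_d_d_y _ _ _ _ T), (has_d_d_y _ _ _ _ (has_d_mult _ _ _ _ _ _ _ (has_d_const c z) T)).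
      cbv beta; ring.
    - intros F G HF HG; assert (T := has_d_smooth Omega F z HF Hz);
        assert (T' := has_d_smooth Omega G z HG Hz).
      rewrite (has_d_d_y _ _ _ _ T), (has_d_d_y _ _ _ _ T'),
        (has_d_d_y _ _ _ _ (has_d_plus _ _ _ _ _ _ _ T T')).
      ring. }
  rewrite EX, EY; unfold pvec at 1 2; rewrite !Ex, !Ey; exact Q.
- exists f; split; [exact Sf|]; intros z Hz k; destruct (Hf z Hz) as [Hd Ho].
  assert (Hoc := has_d_conj _ _ _ _ Ho).
  rewrite (left_derivE d_z f z k (d_z_ext z)), (has_d_d_z _ _ _ _ Hd), (has_d_d_z _ _ _ _ Ho),
    (has_d_d_z _ _ _ _ Hoc).
  fold (Z z); assert (Ax := pvec_snd_conj _ (vel_x_conj (Z z)));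
    assert (Ay := pvec_snd_conj _ (vel_y_conj (Z z))).
  rewrite Cmult_conj, Cplus_conj, Cmult_conj, Ci_conj, Cconj_half; unfold X, Y; rewrite Ax, Ay.
  destruct k; unfold pvec, vel_x, vel_y; simpl; field [Ci2]; C_neq.
Qed.

Theorem theorem2 (Omega : C -> Prop) (hOmega : simply_connected_domain Omega) :
  (* (1) *)
  (forall (f : C -> SL2tilde) (alpha : C -> R) (psi1 psi2 : C -> C) (H : C -> R),
     surface Omega f alpha psi1 psi2 H -> dirac Omega psi1 psi2 H)
  /\
  (* (2) *)
  (forall (psi1 psi2 : C -> C) (H : C -> R),
     smoothC Omega psi1 -> smoothC Omega psi2 ->
     (forall z, Omega z -> ~ (psi1 z = 0 /\ psi2 z = 0)) ->
     smooth Omega H ->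
     dirac Omega psi1 psi2 H ->
     exists (f : C -> SL2tilde) (alpha : C -> R),
       surface Omega f alpha psi1 psi2 H)
  /\
  (* (3) *)
  (forall (f : C -> SL2tilde) (alpha : C -> R) (psi1 psi2 : C -> C) (H : C -> R),
     surface Omega f alpha psi1 psi2 H ->
     let A := hopf f alpha in
     let alphaC := fun w => RtoC (alpha w) in
     let HC := fun w => RtoC (H w) in
     let Z3 := fun w => psi1 w * Cconj (psi2 w) in
     (* Weingarten equations *)
     dirac Omega psi1 psi2 H /\
     (forall z, Omega z ->
        d_z psi1 z = d_z alphaC z * psi1 z + A z * RtoC (exp (- alpha z)) * psi2 z
                     + 5 * Ci / 4 * psi1 z ^ 2 * Cconj (psi2 z) /\
        d_zbar psi2 z = - Cconj (A z) * RtoC (exp (- alpha z)) * psi1 z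
                        + d_zbar alphaC z * psi2 z
                        + 5 * Ci / 4 * Cconj (psi1 z) * psi2 z ^ 2) /\
     (* Hopf differential *)
     (forall z, Omega z ->
        A z = (Cconj (psi2 z) * d_z psi1 z - psi1 z * d_z (fun w => Cconj (psi2 w)) z)
              - 5 * Ci / 2 * psi1 z ^ 2 * Cconj (psi2 z) ^ 2) /\
     (* Codazzi equations *)
     (forall z, Omega z ->
        d_zbar (d_z alphaC) z - RtoC (exp (- 2 * alpha z) * Cmod (A z) ^ 2)
          + / 4 * RtoC (exp (2 * alpha z) * H z ^ 2)
        = RtoC (exp (2 * alpha z)) - 5 * RtoC (Cmod (Z3 z) ^ 2) /\
        d_zbar (fun w => A w + 5 * Z3 w ^ 2 / (2 * (HC w - Ci))) z
        = / 2 * d_z HC z * RtoC (exp (2 * alpha z))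
          + d_zbar (fun w => 5 / (2 * (HC w - Ci))) z * Z3 z ^ 2)).
Proof.
assert (HO := scd_open _ hOmega).
split; [|split].
- intros f alpha psi1 psi2 H Hs; apply (surface_data Omega f alpha psi1 psi2 H HO Hs).
- intros psi1 psi2 H S1 S2 N SH HD.
  destruct (spin_integrable Omega psi1 psi2 H hOmega S1 S2 HD) as (f & Sf & HZ).
  (* By [spin_conformal] the only possible [alpha] on [Omega] is the logarithm of this function,
     which is positive because the spinor does not vanish. *)
  set (E := fun z => (Cmod (psi1 z) ^ 2 + Cmod (Cconj (psi2 z)) ^ 2)%R).
  assert (HE : forall z, Omega z -> RtoC (exp (ln (E z))) = spin_E (psi1 z) (Cconj (psi2 z))).
  { intros z Hz; rewrite spin_E_real, exp_ln; [reflexivity|].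
    assert (Q : psi1 z <> 0 \/ psi2 z <> 0).
    { destruct (Classical_Prop.classic (psi1 z = 0)) as [E1 | E1]; [right | now left].
      intros E2; exact (N z Hz (conj E1 E2)). }
    unfold E; rewrite Cmod_conj.
    pose proof (pow2_ge_0 (Cmod (psi1 z))); pose proof (pow2_ge_0 (Cmod (psi2 z))).
    destruct Q as [Q | Q]; apply Cmod_gt_0 in Q; assert (T := pow_lt _ 2 Q); lra. }
  exists f, (fun z => ln (E z)); split; [|split].
  + now apply (spin_conformal Omega f _ psi1 (fun z => Cconj (psi2 z)) Sf HZ).
  + split; [exact S1|]; split; [exact S2|]; intros z Hz.
    exact (conj (HZ z Hz I1) (conj (HZ z Hz I2) (HZ z Hz I3))).
  + now apply (surface_spin Omega f _ psi1 psi2 H HO S1 S2 Sf HZ HE).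
- intros f alpha psi1 psi2 H Hs A alphaC HC Z3.
  split; [|split; [|split]].
  + apply (surface_data Omega f alpha psi1 psi2 H HO Hs).
  + intros z Hz; exact (proj1 (surface_weingarten_codazzi Omega f alpha psi1 psi2 H z HO Hs Hz)).
  + intros z Hz; exact (hopf_spin Omega f alpha psi1 psi2 H z HO Hs Hz).
  + intros z Hz; exact (proj2 (surface_weingarten_codazzi Omega f alpha psi1 psi2 H z HO Hs Hz)).
Qed.
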